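(* Let $K$ be a field, let $n,d,h$ be natural numbers, and let $f\in K\langle\langle x_1,\ldots,x_n\rangle\rangle$ be an algebraic Laurent series of degree $d$ and height at most $h$. Then there is an explicit number $N(n,d,h)$ depending only on $n$, $d$ and $h$, and a rational Laurent series $R\in K\langle\langle x_1,\ldots,x_n,y_1,\ldots,y_n\rangle\rangle$ (i.e. an element of $K(x_1,\ldots,x_n,y_1,\ldots,y_n)$ embedded in this field) of height at most $N(n,d,h)$ such that $f=\Delta_{1/2}(R)$.
   Context: For a vector of indeterminates $(z_1,\ldots,z_k)$, $K\langle\langle z_1,\ldots,z_k\rangle\rangle$ denotes the field of formal series $\sum_{\mathbf i\in\mathbb{Z}^k}a(\mathbf i)z_1^{i_1}\cdots z_k^{i_k}$ whose support $\{\mathbf i: a(\mathbf i)\ne0\}$ is well-ordered for the order $\prec$ on $\mathbb{Z}^k$ where $\mathbf i\prec\mathbf j$ iff $\mathbf i\neq\mathbf j$ and, for the largest index $k_0$ with $i_{k_0}\ne j_{k_0}$, $i_{k_0}<j_{k_0}$; equivalently it is defined recursively by $K\langle\langle z_1,\ldots,z_k\rangle\rangle=K\langle\langle z_1,\ldots,z_{k-1}\rangle\rangle((z_k))$. It contains $K(z_1,\ldots,z_k)$. Here the variables are ordered $x_1,\ldots,x_n,y_1,\ldots,y_n$. An element is algebraic if algebraic over $K(z_1,\ldots,z_k)$; its degree is the degree of its minimal polynomial, and its height is the minimum over nonzero $P(Y)\in K[z_1,\ldots,z_k][Y]$ with $P(f)=0$ of the maximum total degree of the coefficients of $P$. For $F=\sum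 a(i_1,\ldots,i_{2n})x_1^{i_1}\cdots x_n^{i_n}y_1^{i_{n+1}}\cdots y_n^{i_{2n}}$, $\Delta_{1/2}(F):=\sum_{(i_1,\ldots,i_n)\in\mathbb{Z}^n}a(i_1,\ldots,i_n,i_1,\ldots,i_n)x_1^{i_1}\cdots x_n^{i_n}\in K\langle\langle x_1,\ldots,x_n\rangle\rangle$. *)

(* Defs.v *)
From HB Require Import structures.
From mathcomp Require Import all_boot all_order all_algebra.
From mathcomp Require Import boolp classical_sets functions fsbigop.
From mathcomp Require Import mpoly zify.

Set Implicit Arguments.
Unset Strict Implicit.
Unset Printing Implicit Defensive.

Import Order.TTheory GRing.Theory Num.Theory.
Local Open Scope ring_scope.

Section LaurentDef.
Variable F : fieldType.

Definition vanish_below (f : int -> F) (a : int) := forall m, m < a -> f m = 0.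

Definition laurent_pred : {pred int -> F} :=
  [pred f | `[< exists a, vanish_below f a >]].

Record laurent := Laurent { lcoef :> int -> F; _ : lcoef \in laurent_pred }.

HB.instance Definition _ := [isSub for lcoef].
HB.instance Definition _ := [Choice of laurent by <:].

Lemma laurent_zmod_closed : zmod_closed laurent_pred.
Proof.
split; first by apply/asboolP; exists 0.
move=> f g /asboolP[a fa] /asboolP[b gb]; apply/asboolP.
exists (Num.min a b) => m; rewrite lt_min => /andP[ma mb].
by rewrite /GRing.opp /GRing.add /= fa // gb // subr0.
Qed.

HB.instance Definition _ :=
  GRing.isZmodClosed.Build _ laurent_pred laurent_zmod_closed.
HB.instance Definition _ := [SubChoice_isSubZmodule of laurent by <:].

Lemma lcoefP (f : laurent) : exists a, vanish_below f a.
Proof. by case: f => f /= /asboolP. Qed.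

Lemma lcoef_inj (f g : laurent) : (forall m, f m = g m) -> f = g.
Proof. by move=> fg; apply/val_inj/funext. Qed.

Lemma lcoef0 m : (0 : laurent) m = 0. Proof. by []. Qed.
Lemma lcoefD (f g : laurent) m : (f + g) m = f m + g m. Proof. by []. Qed.
Lemma lcoefN (f : laurent) m : (- f) m = - f m. Proof. by []. Qed.

Lemma eq_above (f g : int -> F) a :
    vanish_below f a -> vanish_below g a ->
  (forall k : nat, f (a + k%:Z) = g (a + k%:Z)) -> forall m, f m = g m.
Proof.
move=> fa ga fg m; have [ma|am] := ltP m a; first by rewrite fa ?ga.
have -> : m = a + `|(m - a)%R|%N%:Z by rewrite gez0_abs ?subr_ge0 // subrKC.
exact: fg.
Qed.

(* The sum is finite: only finitely many i have f i != 0 and g (m - i) != 0. *)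
Definition lconv (f g : int -> F) (m : int) : F :=
  \sum_(i \in [set: int]) f i * g (m - i).

Definition ltrunc (f : int -> F) (a : int) (n : nat) : {poly F} :=
  \poly_(j < n) f (a + j%:Z).

Lemma vanish_lconv f g a b :
  vanish_below f a -> vanish_below g b -> vanish_below (lconv f g) (a + b).
Proof.
move=> fa gb m mab; apply: fsbig1 => i _.
have [ia|ai] := ltP i a; first by rewrite fa ?mul0r.
rewrite gb ?mulr0 // ltrBlDr (lt_le_trans mab) // addrC lerD2l //.
Qed.

Lemma lconvE f g a b n k :
    vanish_below f a -> vanish_below g b -> (k < n)%N ->
  lconv f g (a + b + k%:Z) = (ltrunc f a n * ltrunc g b n)`_k.
Proof.
move=> fa gb kn; rewrite /lconv.
pose r := [seq a + j%:Z | j <- iota 0 k.+1].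
have inj_a : injective (fun j : nat => a + j%:Z) by move=> i j /addrI [].
have ur : uniq r by rewrite map_inj_uniq ?iota_uniq.
rewrite -(@fsbig_widen _ _ _ _ [set` r]%classic) //; last first.
  move=> i [_ /= /negP nir]; have [ia|ai] := ltP i a; first by rewrite fa ?mul0r.
  rewrite gb ?mulr0 //; rewrite ltNge; apply: contra nir => h.
  apply/mapP; exists `|(i - a)%R|%N.
    rewrite mem_iota add0n leq0n /=; lia.
  by rewrite gez0_abs ?subr_ge0 // subrKC.
rewrite -fsbig_seq // big_map -[iota 0 _]/(index_iota 0 k.+1) big_mkord coefM.
apply: eq_bigr => j _; have jk : (j <= k)%N by rewrite -ltnS.
rewrite !coef_poly (leq_ltn_trans jk kn) (leq_ltn_trans (leq_subr _ _) kn).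
by congr (_ * g _); lia.
Qed.

Lemma lconv_pred (f g : laurent) : lconv f g \in laurent_pred.
Proof.
have [a fa] := lcoefP f; have [b gb] := lcoefP g.
by apply/asboolP; exists (a + b); apply: vanish_lconv.
Qed.

Definition lmul (f g : laurent) : laurent := Laurent (lconv_pred f g).

Definition lmonom_fun (c : F) (n : int) : int -> F :=
  fun m => if m == n then c else 0.

Lemma lmonom_pred c n : lmonom_fun c n \in laurent_pred.
Proof.
by apply/asboolP; exists n => m mn; rewrite /lmonom_fun lt_eqF.
Qed.

Definition lmonom c n : laurent := Laurent (lmonom_pred c n).

Lemma coef_ltrunc f a n k : (k < n)%N -> (ltrunc f a n)`_k = f (a + k%:Z).
Proof. by move=> kn; rewrite coef_poly kn. Qed.

Lemma coefM_trunc (p p' q : {poly F}) k n : (k < n)%N ->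
  (forall j, (j < n)%N -> p`_j = p'`_j) -> (p * q)`_k = (p' * q)`_k.
Proof.
move=> kn pp'; rewrite !coefM; apply: eq_bigr => j _; rewrite pp' //.
exact: leq_ltn_trans (leq_ord j) kn.
Qed.

Lemma lmulC : commutative lmul.
Proof.
move=> f g; apply: lcoef_inj.
have [a fa] := lcoefP f; have [b gb] := lcoefP g.
apply: (@eq_above _ _ (a + b)) => [||k].
- exact: vanish_lconv.
- by rewrite addrC; apply: vanish_lconv.
- by rewrite /= (lconvE fa gb (ltnSn k)) [a + b]addrC (lconvE gb fa (ltnSn k)) mulrC.
Qed.

Lemma lmulA : associative lmul.
Proof.
move=> f g h; apply: lcoef_inj.
have [a fa] := lcoefP f; have [b gb] := lcoefP g; have [c hc] := lcoefP h.
have fgab := vanish_lconv fa gb; have ghbc := vanish_lconv gb hc.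
apply: (@eq_above _ _ (a + b + c)) => [||k].
- by rewrite -addrA; apply: vanish_lconv.
- exact: vanish_lconv.
rewrite /= (lconvE fgab hc (ltnSn k)) -(addrA a b c) (lconvE fa ghbc (ltnSn k)).
transitivity (ltrunc f a k.+1 * ltrunc g b k.+1 * ltrunc h c k.+1)`_k.
  rewrite -mulrA mulrC [in RHS]mulrC.
  apply: (@coefM_trunc _ _ _ _ k.+1) => // j jk.
  by rewrite coef_ltrunc // (lconvE gb hc jk).
apply: (@coefM_trunc _ _ _ _ k.+1) => // j jk.
by rewrite coef_ltrunc // (lconvE fa gb jk).
Qed.

Lemma lmul1 : left_id (lmonom 1 0) lmul.
Proof.
move=> f; apply: lcoef_inj; have [a fa] := lcoefP f.
have o0 : vanish_below (lmonom 1 0) 0.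
  by move=> m m0; rewrite /= /lmonom_fun lt_eqF.
apply: (@eq_above _ _ a) => // [|k].
  by rewrite -[a]add0r; apply: vanish_lconv.
rewrite -[a]add0r [LHS]/= (lconvE o0 fa (ltnSn k)).
rewrite (_ : ltrunc _ _ _ = 1) ?mul1r ?coef_ltrunc ?add0r //.
apply/polyP => j; rewrite coef_poly coef1 /= /lmonom_fun add0r.
by case: j => [|j] //=; case: ifP.
Qed.

Lemma lmulDl : left_distributive lmul +%R.
Proof.
move=> f g h; apply: lcoef_inj.
have [a fa] := lcoefP f; have [b gb] := lcoefP g; have [c hc] := lcoefP h.
pose d := Num.min a b.
have fd : vanish_below f d.
  by move=> m; rewrite lt_min => /andP[ma _]; apply: fa.
have gd : vanish_below g d.
  by move=> m; rewrite lt_min => /andP[_ mb]; apply: gb.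
have fgd : vanish_below (f + g) d.
  by move=> m md; rewrite lcoefD fd ?gd ?addr0.
apply: (@eq_above _ _ (d + c)) => [||k].
- exact: vanish_lconv.
- by move=> m md; rewrite lcoefD /= !(@vanish_lconv _ _ d c) ?addr0.
rewrite lcoefD /= (lconvE fgd hc (ltnSn k)) (lconvE fd hc (ltnSn k)).
rewrite (lconvE gd hc (ltnSn k)) -coefD -mulrDl.
apply: (@coefM_trunc _ _ _ _ k.+1) => // j jk.
by rewrite coefD !coef_ltrunc.
Qed.

Lemma lone_neq0 : lmonom 1 0 != 0.
Proof.
apply/eqP => /(congr1 (fun f : laurent => f 0)).
by rewrite lcoef0 /= /lmonom_fun eqxx; apply/eqP/oner_neq0.
Qed.

HB.instance Definition _ := GRing.Zmodule_isComNzRing.Build laurent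
  lmulA lmulC lmul1 lmulDl lone_neq0.

Lemma lcoefM (f g : laurent) m :
  (f * g) m = \sum_(i \in [set: int]) f i * g (m - i).
Proof. by []. Qed.

Lemma laurent_inv_ex (f : laurent) : f != 0 -> exists g : laurent, g * f = 1.
Proof.
move=> f0; have [a fa] := lcoefP f.
have [k fk] : exists k : nat, f (a + k%:Z) != 0.
  apply: contrapT => nk; case/eqP: f0; apply: lcoef_inj.
  apply: (@eq_above _ _ a) => // k; rewrite lcoef0.
  by apply: contrapT => /eqP fk; apply: nk; exists k.
case: (ex_minnP (ex_intro (fun k : nat => f (a + k%:Z) != 0) k fk)) => {k fk} v fv minv.
pose b := a + v%:Z; pose c (j : nat) := f (b + j%:Z).
have fb : vanish_below f b.
  move=> m mb; have [ma|am] := ltP m a; first exact: fa.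
  have em : m = a + `|(m - a)%R|%N%:Z by rewrite gez0_abs ?subr_ge0 // subrKC.
  rewrite em; apply: contrapT => /eqP /minv; apply/negP; rewrite -ltnNge.
  by rewrite -ltz_nat gez0_abs ?subr_ge0 // ltrBlDl.
have c0 : c 0%N != 0 by rewrite /c addr0.
pose fix s n : seq F :=
  if n is n'.+1 then
    rcons (s n') (((n' == 0%N)%:R -
       \sum_(j < n') (s n')`_j * c (n' - j)%N) / c 0%N)
  else [::].
have ss n : size (s n) = n by elim: n => //= n IH; rewrite size_rcons IH.
pose u n := (s n.+1)`_n.
have su n j : (j < n)%N -> (s n)`_j = u j.
  elim: n => // n IH; rewrite ltnS leq_eqVlt => /predU1P[-> //|jn] /=.
  by rewrite nth_rcons ss jn IH.
have uE n : \sum_(j < n.+1) u j * c (n - j)%N = (n == 0%N)%:R.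
  rewrite big_ord_recr /= subnn {2}/u /= nth_rcons ss ltnn eqxx divfK //.
  rewrite [X in _ - X](eq_bigr (fun j : 'I_n => u j * c (n - j)%N)) ?subrKC //.
  by move=> j _; rewrite su.
pose g (m : int) : F := if m < - b then 0 else u `|(m + b)%R|%N.
have gb : vanish_below g (- b) by move=> m mb; rewrite /g mb.
have gp : g \in laurent_pred by apply/asboolP; exists (- b).
exists (Laurent gp); apply: lcoef_inj.
have e0 : - b + b = 0 by rewrite addNr.
apply: (@eq_above _ _ (- b + b)) => [|m|k].
- exact: vanish_lconv.
- by rewrite e0 => m0; rewrite /= /lmonom_fun lt_eqF.
rewrite [LHS](lconvE gb fb (ltnSn k)) coefM e0 add0r /= /lmonom_fun.
rewrite -[_ == _]/(k == 0%N) (_ : (if _ then _ else _) = (k == 0%N)%:R); last by case: eqP.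
rewrite -uE; apply: eq_bigr => j _.
rewrite coef_ltrunc ?ltn_ord // coef_ltrunc ?ltnS ?leq_subr // /g.
by rewrite ltNge lerDl /= addrAC addNr add0r.
Qed.

Definition linv (f : laurent) : laurent := xget 0 [set g | g * f = 1]%classic.

Lemma lmulVf (f : laurent) : f != 0 -> linv f * f = 1.
Proof. by move=> /laurent_inv_ex/xgetPex; apply. Qed.

Lemma linv0 : linv 0 = 0.
Proof.
rewrite /linv; case: xgetP => // g _ /= /esym /eqP.
by rewrite mulr0 oner_eq0.
Qed.

HB.instance Definition _ := GRing.ComNzRing_isField.Build laurent lmulVf linv0.

Definition laurentC (c : F) : laurent := lmonom c 0.
Definition laurentX : laurent := lmonom 1 1.

Lemma lmonomM c d m n : lmonom c m * lmonom d n = lmonom (c * d) (m + n).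
Proof.
apply: lcoef_inj => k; rewrite lcoefM.
rewrite -(@fsbig_widen _ _ _ _ [set m]%classic) //; last first.
  by move=> i [_ /= /eqP]; rewrite /lmonom_fun => /negPf ->; rewrite mul0r.
rewrite fsbig_set1 /= /lmonom_fun eqxx subr_eq [n + m]addrC.
by case: ifP => _; rewrite ?mulr0.
Qed.

Lemma laurentC_zmod : zmod_morphism laurentC.
Proof.
move=> c d; apply: lcoef_inj => m; rewrite lcoefD lcoefN /= /lmonom_fun.
by case: ifP; rewrite ?subr0.
Qed.

Lemma laurentC_monoid : monoid_morphism laurentC.
Proof. by split=> // c d; rewrite /laurentC lmonomM addr0. Qed.

HB.instance Definition _ :=
  GRing.isZmodMorphism.Build F laurent laurentC laurentC_zmod.
HB.instance Definition _ :=
  GRing.isMonoidMorphism.Build F laurent laurentC laurentC_monoid.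

Lemma laurentXn n : laurentX ^+ n = lmonom 1 n%:Z.
Proof.
by elim: n => // n IH; rewrite exprS IH lmonomM mul1r -addn1 PoszD addrC.
Qed.

Lemma lcoefCXn c n m :
  (laurentC c * laurentX ^+ n) m = if m == n%:Z then c else 0.
Proof. by rewrite laurentXn lmonomM mulr1 add0r. Qed.

End LaurentDef.

(* K<<z_0, ..., z_(k-1)>> = K<<z_0, ..., z_(k-2)>>((z_(k-1))): the variable of
   largest index is the outermost one. *)
Fixpoint lseries (K : fieldType) (k : nat) : fieldType :=
  if k is k'.+1 then GRing.Field.clone (laurent (lseries K k')) _ else K.

Fixpoint lseriesC (K : fieldType) (k : nat) : {rmorphism K -> lseries K k} :=
  if k is k'.+1 return {rmorphism K -> lseries K k}
  then @laurentC (lseries K k') \o lseriesC K k' else idfun.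

Fixpoint lseriesX (K : fieldType) (k : nat) : 'I_k -> lseries K k :=
  match k return 'I_k -> lseries K k with
  | 0%N => fun _ => 0
  | k'.+1 => fun i =>
      if unlift ord_max i is Some j then laurentC (lseriesX K j)
      else laurentX (lseries K k')
  end.

Fixpoint lseries_coef (K : fieldType) (k : nat) :
    lseries K k -> 'rV[int]_k -> K :=
  match k return lseries K k -> 'rV[int]_k -> K with
  | 0%N => fun f _ => f
  | k'.+1 => fun (f : laurent (lseries K k')) i =>
      lseries_coef (f (i 0 ord_max)) (\row_(j < k') i 0 (lift ord_max j))
  end.

Section LSeries.
Variable K : fieldType.

Lemma lseries_coefS k (f : lseries K k.+1) i :
  lseries_coef f i =
  lseries_coef ((f : laurent _) (i 0 ord_max))
    (\row_(j < k) i 0 (lift ord_max j)).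
Proof. by []. Qed.

Lemma lseries_coef_inj k (f g : lseries K k) :
  lseries_coef f =1 lseries_coef g -> f = g.
Proof.
elim: k f g => [|k IH] f g fg; first exact: (fg 0).
apply: lcoef_inj => m; apply: IH => i.
have := fg (\row_j if unlift ord_max j is Some j' then i 0 j' else m).
rewrite !lseries_coefS !mxE unlift_none.
rewrite (_ : \row_j _ = i) //; apply/rowP => j.
by rewrite !mxE liftK.
Qed.

Lemma lseries_coef0 k i : lseries_coef (0 : lseries K k) i = 0.
Proof.
by elim: k i => [//|k IH] i; rewrite lseries_coefS [X in lseries_coef X]lcoef0.
Qed.

Lemma lseries_coefD k (f g : lseries K k) i :
  lseries_coef (f + g) i = lseries_coef f i + lseries_coef g i.
Proof.
elim: k f g i => [//|k IH] f g i.
by rewrite !lseries_coefS [X in lseries_coef X]lcoefD IH.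
Qed.

Lemma lseriesCS k c : lseriesC K k.+1 c = laurentC (lseriesC K k c).
Proof. by []. Qed.

Lemma lseriesX_max k : lseriesX K (@ord_max k) = laurentX (lseries K k).
Proof. by rewrite /= unlift_none. Qed.

Lemma lseriesX_lift k (j : 'I_k) :
  lseriesX K (lift ord_max j) = laurentC (lseriesX K j).
Proof. by rewrite /= liftK. Qed.

Lemma lseries_coef_monom k (c : K) (m : 'I_k -> nat) i :
  lseries_coef (lseriesC K k c * \prod_(j < k) lseriesX K j ^+ m j) i =
  if [forall j, i 0 j == (m j)%:Z] then c else 0.
Proof.
elim: k m i => [|k IH] m i.
  rewrite big_ord0 mulr1 ifT //; apply/forallP; by case.
rewrite big_ord_recr lseriesX_max.
rewrite (eq_bigr (fun j : 'I_k =>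
  laurentC (lseriesX K j ^+ m (lift ord_max j)))); last first.
  move=> j _; rewrite (_ : widen_ord _ _ = lift ord_max j).
    by rewrite lseriesX_lift rmorphXn.
  by apply: val_inj; rewrite [RHS]lift_max.
rewrite -rmorph_prod mulrA lseriesCS -[_ * laurentC _]rmorphM lseries_coefS.
pose P := lseriesC K k c * \prod_(j < k) lseriesX K j ^+ m (lift ord_max j).
transitivity (lseries_coef (if i 0 ord_max == (m ord_max)%:Z then P else 0)
  (\row_(j < k) i 0 (lift ord_max j))).
  by congr lseries_coef; apply: lcoefCXn.
rewrite {}/P.
case: (eqVneq (i 0 ord_max)) => [im|/negPf im]; last first.
  rewrite lseries_coef0 ifF //; apply/negP => /forallP /(_ ord_max).
  by rewrite im.
rewrite (IH (fun j => m (lift ord_max j))); congr (if _ then _ else _).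
apply/forallP/forallP => [h j|h j]; last by rewrite mxE; apply: h.
by case: (unliftP ord_max j) => [j'|] ->; [have := h j'; rewrite mxE|rewrite im].
Qed.

Definition mpoly_lseries k (p : {mpoly K[k]}) : lseries K k :=
  mmap (lseriesC K k) (@lseriesX K k) p.

HB.instance Definition _ k := GRing.RMorphism.copy (@mpoly_lseries k)
  (mmap (lseriesC K k) (@lseriesX K k)).

Lemma lseries_coef_mpoly k (p : {mpoly K[k]}) (m : 'X_{1..k}) :
  lseries_coef (mpoly_lseries p) (\row_j (m j)%:Z) = p@_m.
Proof.
rewrite {2}[p]mpolyE /mpoly_lseries /mmap raddf_sum /=.
rewrite (big_morph (fun f => lseries_coef f _) (id1 := 0) (op1 := +%R));
  [|by move=> f g; rewrite lseries_coefD|by rewrite lseries_coef0].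
apply: eq_bigr => m' _; rewrite /mmap1 lseries_coef_monom mcoeffZ mcoeffX.
have -> : [forall j, (\row_j (m j)%:Z) 0 j == (m' j)%:Z] = (m' == m).
  apply/forallP/eqP => [h|-> j]; last by rewrite mxE.
  by apply/mnmP => j; have := h j; rewrite mxE => /eqP [].
by case: eqP; rewrite ?mulr1 ?mulr0.
Qed.

Lemma mpoly_lseries_inj k : injective (@mpoly_lseries k).
Proof. by move=> p q pq; apply/mpolyP => m; rewrite -!lseries_coef_mpoly pq. Qed.

Lemma mpoly_lseries_eq0 k (p : {mpoly K[k]}) :
  (mpoly_lseries p == 0) = (p == 0).
Proof. by rewrite -(rmorph0 (@mpoly_lseries k)) (inj_eq (@mpoly_lseries_inj k)). Qed.

Definition frac_lseries k (x : {fraction {mpoly K[k]}}) : lseries K k :=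
  mpoly_lseries \n_(repr x) / mpoly_lseries \d_(repr x).

Lemma denom_lseries_neq0 k (x : {ratio {mpoly K[k]}}) :
  mpoly_lseries \d_x != 0.
Proof. by rewrite mpoly_lseries_eq0 denom_ratioP. Qed.

Lemma frac_lseries_pi k (x : {ratio {mpoly K[k]}}) :
  frac_lseries (\pi_{fraction {mpoly K[k]}} x)%qT =
  mpoly_lseries \n_x / mpoly_lseries \d_x.
Proof.
apply/eqP; rewrite /frac_lseries eqr_div ?denom_lseries_neq0 // -!rmorphM.
by rewrite FracField.equivf_l [X in _ == mpoly_lseries X]mulrC.
Qed.

Lemma frac_lseries_tofrac k (p : {mpoly K[k]}) :
  frac_lseries (tofrac p) = mpoly_lseries p.
Proof.
rewrite /tofrac; unlock.
by rewrite frac_lseries_pi !numden_Ratio ?oner_neq0 // rmorph1 divr1.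
Qed.

Lemma frac_lseries_zmod k : zmod_morphism (@frac_lseries k).
Proof.
move=> x y; rewrite -[x]reprK -[y]reprK; set a := repr x; set b := repr y.
have -> : (\pi_{fraction {mpoly K[k]}} a - \pi_{fraction {mpoly K[k]}} b =
    \pi_{fraction {mpoly K[k]}} (FracField.addf a (FracField.oppf b)))%qT.
  by rewrite FracField.pi_add FracField.pi_opp.
rewrite !frac_lseries_pi.
rewrite /FracField.addf /FracField.oppf.
rewrite !numden_Ratio ?mulf_neq0 ?denom_ratioP //.
rewrite mulNr rmorphB !rmorphM -[in RHS]mulNr addf_div ?denom_lseries_neq0 //.
by rewrite mulNr.
Qed.

Lemma frac_lseries_monoid k : monoid_morphism (@frac_lseries k).
Proof.
split=> [|x y]; first by rewrite -tofrac1 frac_lseries_tofrac rmorph1.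
rewrite -[x]reprK -[y]reprK; set a := repr x; set b := repr y.
have -> : (\pi_{fraction {mpoly K[k]}} a * \pi_{fraction {mpoly K[k]}} b =
    \pi_{fraction {mpoly K[k]}} (FracField.mulf a b))%qT.
  by rewrite FracField.pi_mul.
rewrite !frac_lseries_pi /FracField.mulf.
by rewrite !numden_Ratio ?mulf_neq0 ?denom_ratioP // !rmorphM mulf_div.
Qed.

HB.instance Definition _ k := GRing.isZmodMorphism.Build
  {fraction {mpoly K[k]}} (lseries K k) (@frac_lseries k)
  (@frac_lseries_zmod k).
HB.instance Definition _ k := GRing.isMonoidMorphism.Build
  {fraction {mpoly K[k]}} (lseries K k) (@frac_lseries k)
  (@frac_lseries_monoid k).

(* f is algebraic over K(z), with minimal polynomial p. *)
Definition is_minpoly k (f : lseries K k) (p : {poly {fraction {mpoly K[k]}}}) :=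
  [/\ p \is monic, irreducible_poly p & root (map_poly (@frac_lseries k) p) f].

Definition algebraic_of_degree k (f : lseries K k) (d : nat) :=
  exists2 p, is_minpoly f p & size p = d.+1.

(* msize q is the total degree of q plus one, and msize 0 = 0. *)
Definition max_coef_degree k (P : {poly {mpoly K[k]}}) : nat :=
  \max_(i < size P) (msize P`_i).-1.

Definition annihilates k (P : {poly {mpoly K[k]}}) (f : lseries K k) :=
  P != 0 /\ root (map_poly (@mpoly_lseries k) P) f.

Definition is_height k (f : lseries K k) (h : nat) :=
  (exists2 P, annihilates P f & max_coef_degree P = h) /\
  (forall P, annihilates P f -> (h <= max_coef_degree P)%N).

Definition height_at_most k (f : lseries K k) (h : nat) :=
  exists2 m, is_height f m & (m <= h)%N.

(* With the variables x_1, ..., x_n, y_1, ..., y_n of F in this order, this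
   says f = Delta_{1/2}(F); f is unique by lseries_coef_inj. *)
Definition half_diagonal n (F : lseries K (n + n)) (f : lseries K n) :=
  forall i : 'rV[int]_n, lseries_coef f i = lseries_coef F (row_mx i i).

End LSeries.

(* Used to express that a bound is explicit. *)
Inductive primrec : forall k : nat, (k.-tuple nat -> nat) -> Prop :=
| PrimrecZero k : primrec (fun _ : k.-tuple nat => 0%N)
| PrimrecSucc : primrec (fun v : 1.-tuple nat => (thead v).+1)
| PrimrecProj k (i : 'I_k) : primrec (fun v : k.-tuple nat => tnth v i)
| PrimrecComp k m (g : m.-tuple nat -> nat) (f : 'I_m -> k.-tuple nat -> nat) :
    primrec g -> (forall i, primrec (f i)) ->
    primrec (fun v : k.-tuple nat => g [tuple f i v | i < m])
| PrimrecRec k (f : k.-tuple nat -> nat) (g : k.+2.-tuple nat -> nat) :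
    primrec f -> primrec g ->
    primrec (fun v : k.+1.-tuple nat =>
      iteri (thead v) (fun m r => g [tuple of m :: r :: behead v])
        (f [tuple of behead v])).

(* Main.v *)
(* Induction on n.  Put L = K<<x_1, ..., x_(n-1)>>, let t be the last variable
   and see f as an element of L((t)), multiplied by a power of t that makes it a
   power series.  An annihilating polynomial P with P'(f) <> 0 is found among
   those of least degree: in characteristic p, a polynomial in Y^p would be
   shortened by a Cartier operator.  If e is the order of P'(f), then Taylor
   expansion at a truncation u of f gives f = u + t^(e+1) g, where g is a simple
   root of a polynomial Q over L[t] with Q(0) = 0 and Q'(0) = 1 mod t.
   Furstenberg's formula makes g(t) the diagonal in (t, y) of
   y^2 Q'(ty, y) / Q(ty, y); here Q(ty, y) = y (1 + y T) with T a polynomial in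
   t and y, so the only denominator is invertible as a power series in y and
   the quotient has the same meaning in every field of iterated series.

   The coefficients in L that occur here are algebraic of bounded height, and
   they span, with their monomials, a finite family e_j on which numerator and
   denominator act by matrices of polynomials.  Cramer's rule then writes f as
   the diagonal of sum_j c_j e_j with e_j in L algebraic and c_j in K(x, t, y),
   all denominators being q(x) + y T'.  Replacing x_i by x_i x'_i in c_j, and
   each e_j by a rational series with half diagonal e_j, yields R.

   The minimal polynomial over K[x] divides, by Gauss's lemma, the polynomial
   realising the height, so it has degree d and height at most h. *)

Require Import Defs.
From HB Require Import structures.
From mathcomp Require Import all_boot all_order all_algebra.
From mathcomp Require Import boolp classical_sets functions fsbigop.
From mathcomp Require Import mpoly zify ring.

Set Implicit Arguments.
Unset Strict Implicit.
Unset Printing Implicit Defensive.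

Import Order.TTheory GRing.Theory Num.Theory.

(** * Degrees, coefficients and variables *)

Section Degree.
Local Open Scope ring_scope.
Variable K : fieldType.

Definition mdeg_le k (p : {mpoly K[k]}) (N : nat) := (msize p <= N.+1)%N.

Lemma mdeg_leW k (p : {mpoly K[k]}) M N :
  (M <= N)%N -> mdeg_le p M -> mdeg_le p N.
Proof. by rewrite /mdeg_le => MN pM; apply: leq_trans pM _. Qed.

Lemma mdeg_leC k c N : mdeg_le (c%:MP : {mpoly K[k]}) N.
Proof. by rewrite /mdeg_le mmeasureC; case: (c != 0). Qed.

Lemma mdeg_le0 k N : mdeg_le (0 : {mpoly K[k]}) N.
Proof. by rewrite -(mpolyC0 k); apply: mdeg_leC. Qed.

Lemma mdeg_le1 k N : mdeg_le (1 : {mpoly K[k]}) N.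
Proof. by rewrite -mpolyC1; apply: mdeg_leC. Qed.

Lemma mdeg_leXU k (i : 'I_k) N : (0 < N)%N -> mdeg_le ('X_i : {mpoly K[k]}) N.
Proof. by move=> N0; rewrite /mdeg_le msizeX mdeg1. Qed.

Lemma mdeg_leD k (p q : {mpoly K[k]}) N :
  mdeg_le p N -> mdeg_le q N -> mdeg_le (p + q) N.
Proof.
by move=> pN qN; apply: leq_trans (msizeD_le p q) _; rewrite geq_max; apply/andP.
Qed.

Lemma mdeg_leN k (p : {mpoly K[k]}) N : mdeg_le p N -> mdeg_le (- p) N.
Proof. by rewrite /mdeg_le mmeasureN. Qed.

Lemma mdeg_le_sum k I (r : seq I) (P : pred I) (p : I -> {mpoly K[k]}) N :
  (forall i, P i -> mdeg_le (p i) N) -> mdeg_le (\sum_(i <- r | P i) p i) N.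
Proof.
move=> pN; elim/big_rec: _ => [|i q Pi qN]; first exact: mdeg_le0.
by apply: mdeg_leD => //; apply: pN.
Qed.

Lemma mdeg_le_mulrn k (p : {mpoly K[k]}) N m :
  mdeg_le p N -> mdeg_le (p *+ m) N.
Proof.
move=> pN; elim: m => [|m IH]; first exact: mdeg_le0.
by rewrite mulrS; apply: mdeg_leD.
Qed.

Lemma mdeg_leM k (p q : {mpoly K[k]}) M N :
  mdeg_le p M -> mdeg_le q N -> mdeg_le (p * q) (M + N).
Proof.
rewrite /mdeg_le => pM qN.
have [->|p0] := eqVneq p 0; first by rewrite mul0r msize0.
have [->|q0] := eqVneq q 0; first by rewrite mulr0 msize0.
by rewrite msizeM //; move: (msize p) (msize q) pM qN => a b; lia.
Qed.

Lemma mdeg_leX k (p : {mpoly K[k]}) N e :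
  mdeg_le p N -> mdeg_le (p ^+ e) (e * N).
Proof.
move=> pN; elim: e => [|e IH]; first exact: mdeg_le1.
by rewrite exprS mulSn; apply: mdeg_leM.
Qed.

Lemma mdeg_le_prod k I (r : seq I) (p : I -> {mpoly K[k]}) N :
  (forall i, mdeg_le (p i) N) -> mdeg_le (\prod_(i <- r) p i) (size r * N).
Proof.
move=> pN; elim: r => [|i r IH]; first by rewrite big_nil; apply: mdeg_le1.
by rewrite big_cons mulSn; apply: mdeg_leM.
Qed.

Lemma mdeg_le_mcoeff k (p : {mpoly K[k]}) N m :
  mdeg_le p N -> p@_m != 0 -> (mdeg m <= N)%N.
Proof.
move=> pN; rewrite -mcoeff_msupp => /msize_mdeg_lt mp.
by rewrite -ltnS; apply: leq_trans mp pN.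
Qed.

Lemma mdeg_le_mmap k l (p : {mpoly K[k]}) N D (v : 'I_k -> {mpoly K[l]}) :
    mdeg_le p N -> (forall i, mdeg_le (v i) D) ->
  mdeg_le (mmap (@mpolyC l K) v p) (N * D).
Proof.
move=> pN vD; rewrite /mmap big_seq; apply: mdeg_le_sum => m.
rewrite mcoeff_msupp => /(mdeg_le_mcoeff pN) mN.
apply: (@mdeg_leW _ _ (0 + mdeg m * D)); first by rewrite add0n leq_mul2r mN orbT.
apply: mdeg_leM; first exact: mdeg_leC.
rewrite /mmap1 mdegE; elim: (index_enum _) => [|i r IH].
  by rewrite !big_nil; apply: mdeg_le1.
by rewrite !big_cons mulnDl; apply: mdeg_leM => //; apply: mdeg_leX.
Qed.

End Degree.

Section Coefficients.
Local Open Scope ring_scope.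
Variable K : fieldType.

(* Coefficient extraction with exponent vectors given as functions on nat, so
   that inserting and deleting variables needs no casts between types 'I_k. *)
Fixpoint cf k : lseries K k -> (nat -> int) -> K :=
  match k return lseries K k -> (nat -> int) -> K with
  | 0 => fun f _ => f
  | k'.+1 => fun (f : laurent (lseries K k')) i => cf (f (i k')) i
  end.

Lemma cfS k (f : lseries K k.+1) i : cf f i = cf ((f : laurent _) (i k)) i.
Proof. by []. Qed.

Lemma eq_cf k (f : lseries K k) i j :
  (forall l, (l < k)%N -> i l = j l) -> cf f i = cf f j.
Proof.
elim: k f => [//|k IH] f ij; rewrite !cfS ij //; apply: IH => l lk.
exact/ij/ltnW.
Qed.

Lemma lseries_coefE k (f : lseries K k) (r : 'rV[int]_k) (i : nat -> int) :
  (forall j : 'I_k, r 0 j = i j) -> lseries_coef f r = cf f i.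
Proof.
elim: k f r => [//|k IH] f r ri; rewrite lseries_coefS cfS ri /=.
by apply: IH => j; rewrite mxE ri lift_max.
Qed.

Lemma cf_inj k (f g : lseries K k) : (forall i, cf f i = cf g i) -> f = g.
Proof.
move=> fg; apply: lseries_coef_inj => r.
pose i j := if insub j is Some o then r 0 o else 0 : int.
have ri (j : 'I_k) : r 0 j = i j by rewrite /i valK.
by rewrite !(lseries_coefE _ ri).
Qed.

Lemma cf0 k i : cf (0 : lseries K k) i = 0.
Proof. by elim: k i => [//|k IH] i; apply: (IH). Qed.

Lemma cfD k (f g : lseries K k) i : cf (f + g) i = cf f i + cf g i.
Proof. by elim: k f g => [//|k IH] f g; apply: (IH). Qed.

End Coefficients.

Section Monomials.
Local Open Scope ring_scope.
Variable F : fieldType.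

Lemma lcoef_monomM (c : F) (a : int) (f : laurent F) m :
  (lmonom c a * f) m = c * f (m - a).
Proof.
rewrite lcoefM -(@fsbig_widen _ _ _ _ [set a]%classic) //; last first.
  by move=> i [_ /= /eqP]; rewrite /lmonom_fun => /negPf ->; rewrite mul0r.
by rewrite fsbig_set1 /= /lmonom_fun eqxx.
Qed.

Lemma lcoefCM (c : F) (f : laurent F) m : (laurentC c * f) m = c * f m.
Proof. by rewrite lcoef_monomM subr0. Qed.

Lemma lcoefXM (f : laurent F) m : (laurentX F * f) m = f (m - 1).
Proof. by rewrite lcoef_monomM mul1r. Qed.

Lemma lcoefXnM (f : laurent F) n m : (laurentX F ^+ n * f) m = f (m - n%:Z).
Proof. by rewrite laurentXn lcoef_monomM mul1r. Qed.

Lemma laurentX_neq0 : laurentX F != 0.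
Proof.
apply/eqP => /(congr1 (fun f : laurent F => f 1)).
by rewrite lcoef0 /= /lmonom_fun eqxx; apply/eqP/oner_neq0.
Qed.

Lemma lcoef_monom (c : F) a m : lmonom c a m = if m == a then c else 0.
Proof. by []. Qed.

Lemma lcoef1 m : (1 : laurent F) m = (m == 0)%:R.
Proof. by rewrite [LHS]lcoef_monom; case: eqP. Qed.

Lemma lcoef_sum I (r : seq I) (P : pred I) (f : I -> laurent F) m :
  (\sum_(j <- r | P j) f j) m = \sum_(j <- r | P j) f j m.
Proof. exact: (big_morph (fun f : laurent F => f m)). Qed.

Lemma vanish_belowW (f : laurent F) a b :
  b <= a -> vanish_below f a -> vanish_below f b.
Proof. by move=> ba fa m mb; apply: fa; apply: lt_le_trans ba. Qed.

Lemma vanish_below_mul (f g : laurent F) a b :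
  vanish_below f a -> vanish_below g b -> vanish_below (f * g) (a + b).
Proof. exact: vanish_lconv. Qed.

Lemma lcoefM_eq0 (f g : laurent F) m :
  (forall i, f i * g (m - i) = 0) -> (f * g) m = 0.
Proof. by move=> fg; rewrite lcoefM; apply: fsbig1 => i _; apply: fg. Qed.

Lemma lcoefM_lead (f g : laurent F) a b :
  vanish_below f a -> vanish_below g b -> (f * g) (a + b) = f a * g b.
Proof.
move=> fa gb; rewrite -[a + b]addr0.
rewrite [LHS](lconvE fa gb (ltnSn 0)) coefM big_ord1 !coef_poly /=.
by rewrite !addr0.
Qed.

Lemma lcoefM_fin (f g : laurent F) a b (m : int) n :
    vanish_below f a -> vanish_below g b -> m < a + b + n%:Z ->
  (f * g) m = \sum_(j < n) f (a + j%:Z) * g (m - a - j%:Z).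
Proof.
move=> fa gb mab; rewrite lcoefM.
pose r := [seq a + j%:Z | j <- iota 0 n].
have ur : uniq r by rewrite map_inj_uniq ?iota_uniq // => i j /addrI [].
rewrite -(@fsbig_widen _ _ _ _ [set` r]%classic) //; last first.
  move=> i [_ /= /negP nir]; have [ia|ai] := ltP i a; first by rewrite fa ?mul0r.
  rewrite gb ?mulr0 //; rewrite ltNge; apply: contra nir => h.
  apply/mapP; exists `|(i - a)%R|%N.
    rewrite mem_iota add0n leq0n /=; lia.
  by rewrite gez0_abs ?subr_ge0 // subrKC.
rewrite -fsbig_seq // big_map (_ : iota 0 n = index_iota 0 n) ?big_mkord.
  by apply: eq_bigr => j _; congr (_ * g _); lia.
by rewrite /index_iota subn0.
Qed.

End Monomials.

Section LaurentMap.
Local Open Scope ring_scope.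
Variables F G : fieldType.

Definition lmapi_fun (g : int -> F -> G) (f : laurent F) : int -> G :=
  fun m => if f m == 0 then 0 else g m (f m).

Lemma lmapi_pred g f : lmapi_fun g f \in @laurent_pred G.
Proof.
have [a fa] := lcoefP f; apply/asboolP; exists a => m ma.
by rewrite /lmapi_fun fa ?eqxx.
Qed.

Definition lmapi g f : laurent G := Laurent (lmapi_pred g f).

Lemma lcoef_lmapi g f m : (forall i, g i 0 = 0) -> lmapi g f m = g m (f m).
Proof. by move=> g0 /=; rewrite /lmapi_fun; case: eqP => // ->. Qed.

Variable g : {rmorphism F -> G}.

Definition lmap := lmapi (fun=> g).

Lemma lcoef_lmap f m : lmap f m = g (f m).
Proof. by rewrite lcoef_lmapi // => _; rewrite rmorph0. Qed.

Lemma lmap_zmod : zmod_morphism lmap.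
Proof.
move=> f f'; apply: lcoef_inj => m.
by rewrite lcoefD lcoefN !lcoef_lmap lcoefD lcoefN rmorphB.
Qed.

Lemma lmap_monoid : monoid_morphism lmap.
Proof.
split=> [|f f']; apply: lcoef_inj => m.
  by rewrite lcoef_lmap !lcoef1 rmorph_nat.
have [a fa] := lcoefP f; have [b fb] := lcoefP f'.
have ga : vanish_below (lmap f) a by move=> l la; rewrite lcoef_lmap fa ?rmorph0.
have gb : vanish_below (lmap f') b by move=> l lb; rewrite lcoef_lmap fb ?rmorph0.
have mab : m < a + b + (`|(m - a - b)%R|%N.+1)%:Z by lia.
rewrite lcoef_lmap (lcoefM_fin fa fb mab) (lcoefM_fin ga gb mab) rmorph_sum.
by apply: eq_bigr => j _; rewrite rmorphM !lcoef_lmap.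
Qed.

HB.instance Definition _ :=
  GRing.isZmodMorphism.Build (laurent F) (laurent G) lmap lmap_zmod.
HB.instance Definition _ :=
  GRing.isMonoidMorphism.Build (laurent F) (laurent G) lmap lmap_monoid.

Lemma lmapC c : lmap (laurentC c) = laurentC (g c).
Proof.
apply: lcoef_inj => m; rewrite lcoef_lmap !lcoef_monom.
by case: eqP; rewrite ?rmorph0.
Qed.

Lemma lmapX : lmap (laurentX F) = laurentX G.
Proof.
apply: lcoef_inj => m; rewrite lcoef_lmap !lcoef_monom.
by case: eqP; rewrite ?rmorph0 ?rmorph1.
Qed.

End LaurentMap.

Section VariableSeries.
Local Open Scope ring_scope.
Variable K : fieldType.

Fixpoint lX k (j : nat) : lseries K k :=
  match k return lseries K k with
  | 0 => 0
  | k'.+1 => if j == k' then laurentX (lseries K k') else laurentC (lX k' j)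
  end.

Lemma lX_ord k (j : 'I_k) : lseriesX K j = lX k j.
Proof.
elim: k j => [[]//|k IH] j; case: (unliftP ord_max j) => [j' ->|->].
  rewrite lseriesX_lift IH lift_max /= ifN //.
  by rewrite neq_ltn ltn_ord.
by rewrite lseriesX_max /= eqxx.
Qed.

Lemma lX_max k : lX k.+1 k = laurentX (lseries K k).
Proof. by rewrite /= eqxx. Qed.

Lemma lX_lt k j : (j < k)%N -> lX k.+1 j = laurentC (lX k j).
Proof. by move=> jk; rewrite /= ltn_eqF. Qed.

Lemma cfXM k (f : lseries K k) j i : (j < k)%N ->
  cf (lX k j * f) i = cf f (fun l => i l - (l == j)%:Z).
Proof.
elim: k f => [//|k IH] f; rewrite ltnS leq_eqVlt => /predU1P[->|jk].
  rewrite lX_max !cfS [X in cf X]lcoefXM eqxx.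
  by apply: eq_cf => l lk; rewrite ltn_eqF // subr0.
rewrite lX_lt // !cfS [X in cf X]lcoefCM IH // gtn_eqF // subr0.
by [].
Qed.

Lemma lX_neq0 k j : (j < k)%N -> lX k j != 0.
Proof.
elim: k => [//|k IH]; rewrite ltnS leq_eqVlt => /predU1P[->|jk].
  by rewrite lX_max; apply: laurentX_neq0.
by rewrite lX_lt // -(rmorph0 (@laurentC (lseries K k))) (inj_eq (fmorph_inj _)) IH.
Qed.

Lemma mpoly_ring_ind k (P : {mpoly K[k]} -> Prop) :
    (forall c, P c%:MP) -> (forall i, P 'X_i) ->
    (forall p q, P p -> P q -> P (p + q)) ->
    (forall p q, P p -> P q -> P (p * q)) ->
  forall p, P p.
Proof.
move=> PC PX PD PM p; rewrite [p]mpolyE.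
elim/big_rec: _ => [|m q _ Pq]; first by rewrite -(mpolyC0 k); apply: PC.
apply: (PD) => //; rewrite -mul_mpolyC; apply: (PM) => //.
rewrite mpolyXE_id; elim/big_rec: _ => [|i r _ Pr]; first by rewrite -mpolyC1.
apply: (PM) => //; elim: (m i) => [|e IH]; first by rewrite expr0 -mpolyC1.
by rewrite exprS; apply: (PM).
Qed.

Lemma mpoly_lseriesD k (p q : {mpoly K[k]}) :
  mpoly_lseries (p + q) = mpoly_lseries p + mpoly_lseries q.
Proof. exact: rmorphD. Qed.

Lemma mpoly_lseriesM k (p q : {mpoly K[k]}) :
  mpoly_lseries (p * q) = mpoly_lseries p * mpoly_lseries q.
Proof. exact: rmorphM. Qed.

Lemma mpoly_lseriesC k c : mpoly_lseries (c%:MP : {mpoly K[k]}) = lseriesC K k c.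
Proof. by rewrite /mpoly_lseries mmapC. Qed.

Lemma mpoly_lseriesX k (j : 'I_k) : mpoly_lseries ('X_j : {mpoly K[k]}) = lX k j.
Proof. by rewrite /mpoly_lseries mmapX mmap1U lX_ord. Qed.

Lemma lX_mpoly k j (jk : (j < k)%N) :
  lX k j = mpoly_lseries ('X_(Ordinal jk) : {mpoly K[k]}).
Proof. by rewrite mpoly_lseriesX. Qed.

End VariableSeries.

(** * Half diagonals *)

Section HalfDiagonal.
Local Open Scope ring_scope.
Variable K : fieldType.

(* For a series in x_0, ..., x_(n+a), the coefficient of x_n^m, the a variables
   above x_n being renumbered. *)
Fixpoint ext n (m : int) a : lseries K (a + n.+1) -> lseries K (a + n) :=
  match a return lseries K (a + n.+1) -> lseries K (a + n) with
  | 0 => fun F : laurent (lseries K n) => F m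
  | a'.+1 => fun F : laurent (lseries K (a' + n.+1)) =>
      lmapi (fun=> ext m (a := a')) F
  end.

Lemma ext0 n m a : ext m (0 : lseries K (a + n.+1)) = 0.
Proof.
elim: a => [//|a IH]; apply: lcoef_inj => k.
by rewrite [LHS]lcoef_lmapi // !lcoef0 IH.
Qed.

Lemma extS n m a (F : laurent (lseries K (a + n.+1))) k :
  (ext m (F : lseries K (a.+1 + n.+1)) : laurent _) k = ext m (F k).
Proof. by rewrite [LHS]lcoef_lmapi // => _; apply: ext0. Qed.

Lemma extD n m a (F G : lseries K (a + n.+1)) : ext m (F + G) = ext m F + ext m G.
Proof.
elim: a F G => [//|a IH] F G; apply: lcoef_inj => k.
by rewrite lcoefD !extS -IH.
Qed.

Definition ins n (m : int) (i : nat -> int) (j : nat) : int :=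
  if (j < n)%N then i j else if j == n then m else i j.-1.

Lemma cf_ext n m a (F : lseries K (a + n.+1)) i :
  cf (ext m F) i = cf F (ins n m i).
Proof.
elim: a F => [|a IH] F.
  rewrite [RHS]cfS /ins ltnn eqxx; apply: eq_cf => l ln; by rewrite ln.
rewrite [LHS](@cfS _ (a + n)) extS IH [RHS](@cfS _ (a + n.+1)); congr (cf (lcoef F _) _).
by rewrite /ins addnS ltnNge leqW ?leq_addl //= gtn_eqF // ltnS leq_addl.
Qed.

Fixpoint lins n a : {rmorphism lseries K (a + n) -> lseries K (a + n.+1)} :=
  match a return {rmorphism lseries K (a + n) -> lseries K (a + n.+1)} with
  | 0 => @laurentC (lseries K n)
  | a'.+1 => lmap (lins n a')
  end.

Lemma linsC n a c : lins n a (lseriesC K (a + n) c) = lseriesC K (a + n.+1) c.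
Proof.
elim: a => [//|a IH].
by rewrite [RHS](@lseriesCS _ (a + n.+1)) -IH -lmapC.
Qed.

Lemma linsX n a j : (j < a + n)%N ->
  lins n a (lX K (a + n) j) = lX K (a + n.+1) (if (j < n)%N then j else j.+1).
Proof.
elim: a => [|a IH] jan; first by rewrite add0n in jan; rewrite jan lX_lt.
have: (j <= a + n)%N by [].
rewrite leq_eqVlt => /predU1P[->|{}jan].
  rewrite [lX K (a.+1 + n) _](@lX_max _ (a + n)) [LHS]lmapX ltnNge leq_addl /=.
  by rewrite -addnS [RHS](@lX_max _ (a + n.+1)).
rewrite [lX K (a.+1 + n) _](@lX_lt _ (a + n)) // [LHS]lmapC IH //.
by rewrite [RHS](@lX_lt _ (a + n.+1)) //; case: ifP => // _; lia.
Qed.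

Lemma ext_linsM n m a (C : lseries K (a + n)) (F : lseries K (a + n.+1)) :
  ext m (lins n a C * F) = C * ext m F.
Proof.
elim: a C F => [|a IH] C F; first by rewrite [LHS]lcoefCM.
apply: lcoef_inj => k; rewrite extS.
pose C' : laurent (lseries K (a + n)) := C.
pose F' : laurent (lseries K (a + n.+1)) := F.
have [b Cb] := lcoefP C'; have [d Fd] := lcoefP F'.
have kbd : k < b + d + (`|(k - b - d)%R|%N.+1)%:Z by lia.
have iCb : vanish_below (lmap (lins n a) C') b.
  by move=> l lb; rewrite lcoef_lmap Cb // rmorph0.
have eFd : vanish_below (ext m F : laurent (lseries K (a + n))) d.
  by move=> l ld; rewrite extS Fd // ext0.
rewrite [X in ext _ X](lcoefM_fin iCb Fd kbd) [RHS](lcoefM_fin Cb eFd kbd).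
rewrite (big_morph (ext m (a := a)) (@extD n m a) (ext0 n m a)).
by apply: eq_bigr => j _; rewrite extS lcoef_lmap IH.
Qed.

Lemma ext_XM n m a (F : lseries K (a + n.+1)) :
  ext m (lX K (a + n.+1) n * F) = ext (m - 1) F.
Proof.
apply: cf_inj => i; rewrite !cf_ext cfXM; last by rewrite addnS ltnS leq_addl.
apply: eq_cf => l _; rewrite /ins.
by case: ltngtP => //; rewrite subr0.
Qed.

Fixpoint Delta n : lseries K (n + n) -> lseries K n :=
  match n return lseries K (n + n) -> lseries K n with
  | 0 => id
  | n'.+1 => fun F : laurent (lseries K (n' + n'.+1)) =>
      lmapi (fun m x => Delta (ext m x)) F
  end.

Lemma Delta0 n : Delta (0 : lseries K (n + n)) = 0.
Proof.
elim: n => [//|n IH]; apply: lcoef_inj => k.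
have g0 i : Delta (ext i (0 : lseries K (n + n.+1))) = 0 by rewrite ext0 IH.
by rewrite [LHS]lcoef_lmapi //; apply: g0.
Qed.

Lemma DeltaS n (F : laurent (lseries K (n + n.+1))) m :
  (Delta (F : lseries K (n.+1 + n.+1)) : laurent _) m = Delta (ext m (F m)).
Proof. by rewrite [LHS]lcoef_lmapi // => i; rewrite ext0; apply: Delta0. Qed.

Definition dbl n (i : nat -> int) j : int := if (j < n)%N then i j else i (j - n)%N.

Lemma cf_Delta n (F : lseries K (n + n)) i : cf (Delta F) i = cf F (dbl n i).
Proof.
elim: n F => [//|n IH] F; rewrite [LHS]cfS DeltaS IH cf_ext [RHS](@cfS _ (n + n.+1)).
have -> : dbl n.+1 i (n + n.+1)%N = i n.
  by rewrite /dbl ifN ?addnK //; lia.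
apply: eq_cf => l ln; rewrite /ins /dbl ltnS.
case: (ltngtP l n) => [//|nl|->]; last by [].
by rewrite ifN; [congr i|]; lia.
Qed.

Lemma half_diagonal_Delta n (F : lseries K (n + n)) : half_diagonal F (Delta F).
Proof.
move=> r; pose i j := if insub j is Some o then r 0 o else 0 : int.
have ri (j : 'I_n) : r 0 j = i j by rewrite /i valK.
rewrite (lseries_coefE _ ri) cf_Delta; apply/esym/lseries_coefE => j.
rewrite mxE; case: splitP => k jk; rewrite ri /dbl jk; first by rewrite ltn_ord.
by rewrite ltnNge leq_addr addKn.
Qed.

Lemma DeltaD n (F G : lseries K (n + n)) : Delta (F + G) = Delta F + Delta G.
Proof. by apply: cf_inj => i; rewrite cfD !cf_Delta cfD. Qed.

Lemma cfC k c i :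
  cf (lseriesC K k c) i = if `[< forall j, (j < k)%N -> i j = 0 >] then c else 0.
Proof.
elim: k => [|k IH]; first by case: asboolP => // -[].
rewrite cfS lseriesCS [X in cf X]lcoef_monom.
case: (eqVneq (i k) 0) => [ik|ik].
  rewrite IH; congr (if _ then _ else _); apply/asbool_equiv_eq; split=> h j jk.
    by move: jk; rewrite ltnS leq_eqVlt => /predU1P[->//|]; apply: h.
  exact/h/ltnW.
rewrite cf0; case: asboolP => // /(_ k (ltnSn k)) /eqP.
by rewrite (negPf ik).
Qed.

Lemma Delta_C n c : Delta (lseriesC K (n + n) c) = lseriesC K n c.
Proof.
apply: cf_inj => i; rewrite cf_Delta !cfC; congr (if _ then _ else _).
apply/asbool_equiv_eq; split=> h j jn.
  by have := h j (ltn_addr n jn); rewrite /dbl jn.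
by rewrite /dbl; case: ltnP => nj; apply: h; lia.
Qed.

Definition sig_var n (j : nat) : lseries K (n + n) :=
  lX K (n + n) j * lX K (n + n) (n + j).

Lemma Delta_sig_var n j (F : lseries K (n + n)) : (j < n)%N ->
  Delta (sig_var n j * F) = lX K n j * Delta F.
Proof.
move=> jn; apply: cf_inj => i; rewrite cf_Delta -mulrA !cfXM ?cf_Delta; try lia.
apply: eq_cf => l ln; rewrite /dbl.
case: ltnP => nl; first by rewrite (_ : l == (n + j)%N = false) ?subr0 //; lia.
rewrite [l == j]gtn_eqF ?(leq_trans jn) // subr0; congr (_ - _); congr Posz.
by congr nat_of_bool; lia.
Qed.

Definition sig n (p : {mpoly K[n]}) : lseries K (n + n) :=
  mmap (lseriesC K (n + n)) (fun j : 'I_n => sig_var n j) p.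

HB.instance Definition _ n := GRing.RMorphism.copy (@sig n)
  (mmap (lseriesC K (n + n)) (fun j : 'I_n => sig_var n j)).

Lemma Delta_CM n c (F : lseries K (n + n)) :
  Delta (lseriesC K (n + n) c * F) = lseriesC K n c * Delta F.
Proof.
have cfCM k (f : lseries K k) i : cf (lseriesC K k c * f) i = c * cf f i.
  elim: k f => [//|k IH] f.
  by rewrite lseriesCS !cfS [X in cf X]lcoefCM IH.
by apply: cf_inj => i; rewrite cf_Delta !cfCM cf_Delta.
Qed.

Lemma Delta_sigM n p (F : lseries K (n + n)) :
  Delta (sig p * F) = mpoly_lseries p * Delta F.
Proof.
elim/mpoly_ring_ind: p F => [c|j|p q Pp Pq|p q Pp Pq] F.
- by rewrite mpoly_lseriesC /sig mmapC Delta_CM.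
- by rewrite mpoly_lseriesX /sig mmapX mmap1U Delta_sig_var.
- by rewrite !rmorphD !mulrDl DeltaD Pp Pq.
- by rewrite !rmorphM -!mulrA Pp Pq.
Qed.

Lemma sig_eq0 n (p : {mpoly K[n]}) : (sig p == 0) = (p == 0).
Proof.
apply/eqP/eqP => [sp0|->]; last by rewrite rmorph0.
have := Delta_sigM p 1; rewrite sp0 mul0r Delta0 -(rmorph1 (lseriesC K _)).
rewrite Delta_C rmorph1 mulr1 => /esym/eqP.
by rewrite mpoly_lseries_eq0 => /eqP.
Qed.

Lemma Delta_sigV n p (F : lseries K (n + n)) : p != 0 ->
  Delta (F / sig p) = Delta F / mpoly_lseries p.
Proof.
move=> p0; have f0 : mpoly_lseries p != 0 by rewrite mpoly_lseries_eq0.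
apply: (mulfI f0); rewrite -Delta_sigM mulrCA mulfV ?sig_eq0 // mulr1.
by rewrite mulrCA mulfV // mulr1.
Qed.

End HalfDiagonal.

Section Truncation.
Local Open Scope ring_scope.
Variable F : fieldType.

Definition lcut (k : int) (f : laurent F) : laurent F :=
  lmapi (fun m x => if m < k then x else 0) f.

Lemma lcoef_lcut k f m : lcut k f m = if m < k then f m else 0.
Proof. by rewrite lcoef_lmapi // => i; rewrite if_same. Qed.

Lemma lcutM k (t f : laurent F) l :
  vanish_below t 0 -> l < k -> (t * lcut k f) l = (t * f) l.
Proof.
move=> t0 lk; have [b fb] := lcoefP f.
have cb : vanish_below (lcut k f) b.
  by move=> m mb; rewrite lcoef_lcut fb ?if_same.
have lb : l < 0 + b + (`|(l - b)%R|%N.+1)%:Z by lia.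
rewrite (lcoefM_fin t0 cb lb) (lcoefM_fin t0 fb lb); apply: eq_bigr => j _.
by rewrite lcoef_lcut ifT //; lia.
Qed.

Lemma vanish_below_D (f g : laurent F) a :
  vanish_below f a -> vanish_below g a -> vanish_below (f + g) a.
Proof. by move=> fa ga m ma; rewrite lcoefD fa ?ga ?addr0. Qed.

Lemma vanish_belowC (c : F) : vanish_below (laurentC c) 0.
Proof. by move=> m m0; rewrite lcoef_monom lt_eqF. Qed.

Lemma vanish_belowX : vanish_below (laurentX F) 1.
Proof. by move=> m m0; rewrite lcoef_monom lt_eqF. Qed.

Lemma vanish_below0_mul (f g : laurent F) :
  vanish_below f 0 -> vanish_below g 0 -> vanish_below (f * g) 0.
Proof. by rewrite -{3}[0]addr0; apply: vanish_below_mul. Qed.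

Lemma lcoef_lin (c : F) (f h : laurent F) k :
  (laurentC c * f + laurentX F * h) k = c * f k + h (k - 1).
Proof. by rewrite lcoefD lcoefCM lcoefXM. Qed.

End Truncation.

Lemma lcoef2_lin (F : fieldType) (c : F) (f h : laurent (laurent F)) k m :
  ((laurentC (laurentC c) * f + laurentX _ * h) k m = c * f k m + h (k - 1)%R m)%R.
Proof. by rewrite lcoef_lin [LHS]lcoefD lcoefCM. Qed.

Section Step.
Local Open Scope ring_scope.
Variables (K : fieldType) (n : nat).

Lemma mpoly_lseries_widen k (p : {mpoly K[k]}) :
  mpoly_lseries (mwiden p) = laurentC (mpoly_lseries p).
Proof.
elim/mpoly_ring_ind: p => [c|j|p q Pp Pq|p q Pp Pq].
- by rewrite mwidenC !mpoly_lseriesC.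
- rewrite mwidenX mnmwiden1 mpoly_lseriesX mpoly_lseriesX.
  by rewrite -lX_lt.
- by rewrite !rmorphD /= Pp Pq.
- by rewrite !rmorphM /= Pp Pq.
Qed.

Lemma mpoly_lseries_ge0 k (p : {mpoly K[k.+1]}) :
  vanish_below (mpoly_lseries p : laurent _) 0.
Proof.
elim/mpoly_ring_ind: p => [c|j|p q Pp Pq|p q Pp Pq].
- by rewrite mpoly_lseriesC; apply: vanish_belowC.
- rewrite mpoly_lseriesX /=; case: eqP => _; last exact: vanish_belowC.
  exact: (vanish_belowW ler01 (@vanish_belowX _)).
- by rewrite rmorphD; apply: vanish_below_D.
- by rewrite rmorphM; apply: vanish_below0_mul.
Qed.

(* The variables x_0, ..., x_(n-1), t, y are sent to x_j * x'_j, t, y. *)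
Definition stp_var (j : nat) : lseries K (n.+1 + n.+1) :=
  if (j < n)%N then sig_var K n.+1 j
  else if j == n then lX K (n.+1 + n.+1) n else lX K (n.+1 + n.+1) (n + n.+1).

Definition stp (p : {mpoly K[n.+2]}) : lseries K (n.+1 + n.+1) :=
  mmap (lseriesC K (n.+1 + n.+1)) (fun j : 'I_n.+2 => stp_var j) p.

HB.instance Definition _ := GRing.RMorphism.copy stp
  (mmap (lseriesC K (n.+1 + n.+1)) (fun j : 'I_n.+2 => stp_var j)).

Lemma stpC c : stp c%:MP = lseriesC K (n.+1 + n.+1) c.
Proof. by rewrite /stp mmapC. Qed.

Lemma stpX j : stp 'X_j = stp_var j.
Proof. by rewrite /stp mmapX mmap1U. Qed.

Lemma stpD p q : stp (p + q) = stp p + stp q. Proof. exact: rmorphD. Qed.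
Lemma stpM p q : stp (p * q) = stp p * stp q. Proof. exact: rmorphM. Qed.

Lemma stp_var_lt j : (j < n)%N ->
  stp_var j = laurentC (lins K n n (sig_var K n j)).
Proof.
have X l : (l < n + n.+1)%N ->
    lX K (n.+1 + n.+1) l = laurentC (lX K (n + n.+1) l) by apply: lX_lt.
move=> jn; rewrite /stp_var jn /sig_var !X; try lia.
rewrite [lins _ _ _ _]rmorphM rmorphM !linsX ?jn; try lia.
by rewrite [(n + j < n)%N]ltnNge leq_addr.
Qed.

Lemma stp_t : stp_var n = laurentC (lX K (n + n.+1) n).
Proof. by rewrite /stp_var ltnn eqxx; apply: (@lX_lt K (n + n.+1)); rewrite addnS ltnS leq_addl. Qed.

Lemma stp_y : stp_var n.+1 = laurentX (lseries K (n + n.+1)).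
Proof. by rewrite /stp_var ltnNge leqnSn /= gtn_eqF //; apply: (@lX_max K (n + n.+1)). Qed.

Lemma stp_widen q : stp (mwiden (mwiden q)) = laurentC (lins K n n (sig q)).
Proof.
elim/mpoly_ring_ind: q => [c|j|p q Pp Pq|p q Pp Pq].
- by rewrite !mwidenC stpC /sig mmapC linsC.
- rewrite mwidenX mnmwiden1 mwidenX mnmwiden1 stpX /sig mmapX mmap1U.
  exact: (stp_var_lt (ltn_ord j)).
- by rewrite !rmorphD /= Pp Pq.
- by rewrite !rmorphM /= Pp Pq.
Qed.

Lemma stp_ge0 p : vanish_below (stp p : laurent (lseries K (n + n.+1))) 0.
Proof.
elim/mpoly_ring_ind: p => [c|j|p q Pp Pq|p q Pp Pq].
- by rewrite stpC; apply: vanish_belowC.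
- rewrite stpX; have [jn|] := ltnP j n.
    by rewrite stp_var_lt //; apply: vanish_belowC.
  rewrite leq_eqVlt => /predU1P[<-|nj].
    by rewrite stp_t; apply: vanish_belowC.
  have -> : nat_of_ord j = n.+1 by apply/eqP; rewrite eqn_leq nj -ltnS ltn_ord.
  rewrite stp_y; exact: (vanish_belowW ler01 (@vanish_belowX _)).
- by rewrite rmorphD; apply: vanish_below_D.
- by rewrite rmorphM; apply: vanish_below0_mul.
Qed.

(* Diagonals are taken in the variables x only, t and y being untouched. *)
Definition half2 (F : laurent (lseries K (n + n.+1)))
    (f : laurent (laurent (lseries K n))) :=
  forall k m, Delta (ext m (F k)) = f k m.

Lemma half2_0 : half2 0 0.
Proof. by move=> k m; rewrite lcoef0 ext0 Delta0. Qed.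

Lemma half2_D F f G g : half2 F f -> half2 G g -> half2 (F + G) (f + g).
Proof. by move=> Ff Gg k m; rewrite !lcoefD extD DeltaD Ff Gg. Qed.

Lemma half2_CM C (c : lseries K n) F f :
    (forall G, Delta (C * G) = c * Delta G) -> half2 F f ->
  half2 (laurentC (lins K n n C) * F) (laurentC (laurentC c) * f).
Proof.
by move=> Cc Ff k m; rewrite !lcoefCM ext_linsM Cc Ff.
Qed.

Lemma half2_t F f : half2 F f ->
  half2 (laurentC (lX K (n + n.+1) n) * F) (laurentC (laurentX (lseries K n)) * f).
Proof. by move=> Ff k m; rewrite lcoefCM ext_XM lcoefCM lcoefXM Ff. Qed.

Lemma half2_stp p F f : half2 F f -> half2 (stp p * F) (mpoly_lseries p * f).
Proof.
elim/mpoly_ring_ind: p F f => [c|j|p q Pp Pq|p q Pp Pq] F f Ff.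
- rewrite stpC mpoly_lseriesC.
  have -> : lseriesC K (n.+1 + n.+1) c = laurentC (lins K n n (lseriesC K (n + n) c)).
    by rewrite linsC.
  by apply: half2_CM => // G; apply: Delta_CM.
- rewrite stpX mpoly_lseriesX; have [jn|] := ltnP j n.
    rewrite stp_var_lt // lX_lt; last exact: ltnW.
    rewrite lX_lt //; apply: half2_CM => // G; exact: Delta_sig_var.
  rewrite leq_eqVlt => /predU1P[<-|nj].
    by rewrite stp_t lX_lt // lX_max; apply: half2_t.
  have -> : nat_of_ord j = n.+1 by apply/eqP; rewrite eqn_leq nj -ltnS ltn_ord.
  by rewrite stp_y lX_max => k m; rewrite !lcoefXM.
- by rewrite !rmorphD !mulrDl; apply: half2_D; [apply: Pp|apply: Pq].
- by rewrite !rmorphM -!mulrA; apply: Pp; apply: Pq.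
Qed.

Lemma ext1 m a : ext m (1 : lseries K (a + n.+1)) = (m == 0)%:R.
Proof.
apply: cf_inj => i; rewrite cf_ext -(rmorph1 (lseriesC K _)) cfC.
case: (eqVneq m 0) => [->|m0].
  rewrite -(rmorph1 (lseriesC K _)) cfC; congr (if _ then _ else _).
  apply/asbool_equiv_eq; split=> h j jan.
    have [jn|nj] := ltnP j n.
      by have := h j; rewrite /ins jn; apply; lia.
    have := h j.+1; rewrite /ins [(j.+1 < n)%N]ltnNge leqW //= gtn_eqF ?ltnS //.
    by apply; lia.
  rewrite /ins; case: ltngtP => // jn; apply: h; lia.
rewrite cf0; case: asboolP => // /(_ n); rewrite /ins ltnn eqxx => h.
by case/eqP: m0; apply: h; lia.
Qed.

Lemma half2_lins S :
  half2 (laurentC (lins K n n S)) (laurentC (laurentC (Delta S))).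
Proof.
move=> k m; rewrite !lcoef_monom; case: (k == 0); last first.
  by rewrite ext0 Delta0.
rewrite -[lins _ _ _ _]mulr1 ext_linsM ext1 lcoef_monom.
by case: (m == 0); rewrite ?mulr1 ?mulr0 ?Delta0.
Qed.

Lemma half2_Delta F f (g : laurent (lseries K n)) :
    half2 F f -> (forall m, f m m = g m) ->
  Delta (F : lseries K (n.+1 + n.+1)) = g.
Proof. by move=> Ff fg; apply: lcoef_inj => m; rewrite DeltaS Ff fg. Qed.

Lemma stp_den_neq0 q T : q != 0 ->
  stp (mwiden (mwiden q) + 'X_ord_max * T) != 0.
Proof.
move=> q0; apply/eqP => /(congr1 (fun f : laurent (lseries K (n + n.+1)) => f 0)).
rewrite stpD stpM stp_widen stpX stp_y lcoefD lcoef0 lcoefXM.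
rewrite stp_ge0 ?addr0 // lcoef_monom eqxx => /eqP.
by rewrite fmorph_eq0 sig_eq0 (negPf q0).
Qed.

(* Dividing by q + y T is done by recursion on the exponent of y, the part of
   the quotient below y^k determining the coefficient of y^k up to q. *)
Lemma half2_div q T F f (den := mwiden (mwiden q) + 'X_ord_max * T) :
  q != 0 -> half2 F f -> half2 (F / stp den) (f / mpoly_lseries den).
Proof.
move=> q0 Ff.
have sden0 : stp den != 0 by apply: stp_den_neq0.
have den0 : mpoly_lseries den != 0.
  by rewrite mpoly_lseries_eq0; apply: contraNneq sden0 => ->; rewrite rmorph0.
set G := F / stp den; set g := f / mpoly_lseries den.
have FE : F = stp den * G by rewrite mulrC divfK.
have fE : f = mpoly_lseries den * g by rewrite mulrC divfK.
have {sden0 den0} Fk k : F k = lins K n n (sig q) * G k + (stp T * G) (k - 1).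
  rewrite FE stpD stpM stp_widen stpX stp_y mulrDl -mulrA.
  exact: lcoef_lin.
have fk k m : f k m = mpoly_lseries q * g k m + (mpoly_lseries T * g) (k - 1) m.
  rewrite fE mpoly_lseriesD mpoly_lseriesM !mpoly_lseries_widen mpoly_lseriesX.
  rewrite lX_max mulrDl -mulrA.
  exact: lcoef2_lin.
have [b Gb] := lcoefP G; have [b' gb'] := lcoefP g.
pose b0 := Num.min b b'.
suff h N : forall k m, k < b0 + N%:Z -> Delta (ext m (G k)) = g k m.
  by move=> k m; apply: (h `|(k - b0 + 1)%R|%N); lia.
elim: N => [|N IH] k m kb.
  rewrite Gb; last lia.
  by rewrite gb' ?ext0 ?Delta0 // ; lia.
have cut : half2 (lcut k G) (lcut k g).
  move=> l m'; rewrite !lcoef_lcut; case: ltP => [lk|_]; last first.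
    by rewrite ext0 Delta0.
  by apply: IH; lia.
have k1 : k - 1 < k by lia.
have Tk : Delta (ext m ((stp T * G) (k - 1))) = (mpoly_lseries T * g) (k - 1) m.
  have eG := lcutM G (stp_ge0 T) k1.
  have eg := lcutM g (mpoly_lseries_ge0 T) k1.
  have := half2_stp T cut (k - 1) m.
  by rewrite [lcoef _ _]eG [lcoef (_ * lcut k g) _]eg.
have := Ff k m; rewrite Fk fk extD DeltaD ext_linsM Delta_sigM Tk.
by move/addIr/mulfI; apply; rewrite mpoly_lseries_eq0.
Qed.

End Step.

(** * Furstenberg's formula *)

Section Furstenberg.
Local Open Scope ring_scope.
Variable L : fieldType.
Local Notation L2 := (laurent (laurent L)).
Local Notation y := (laurentX (laurent L)).

Lemma lcoef2D (F G : L2) k m : (F + G) k m = F k m + G k m. Proof. by []. Qed.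
Lemma lcoef2N (F : L2) k m : (- F) k m = - F k m. Proof. by []. Qed.

Lemma lcoef2M_eq0 (F G : L2) k m :
  (forall i l, F i l * G (k - i) (m - l) = 0) -> (F * G) k m = 0.
Proof.
move=> FG; have [a Fa] := lcoefP F; have [b Gb] := lcoefP G.
have kab : k < a + b + (`|(k - a - b)%R|%N.+1)%:Z by lia.
rewrite (lcoefM_fin Fa Gb kab) lcoef_sum big1 // => j _.
apply: lcoefM_eq0 => l; have := FG (a + j%:Z) l.
by rewrite opprD addrA.
Qed.

(* The substitution t -> t y, where y is the outer variable. *)
Definition dsub (g : laurent L) : L2 := lmapi (fun k c => lmonom c k) g.

Lemma lcoef_dsub g k m : dsub g k m = if m == k then g k else 0.
Proof.
rewrite lcoef_lmapi // => i; apply: lcoef_inj => l.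
by rewrite lcoef_monom if_same.
Qed.

Lemma dsub_zmod : zmod_morphism dsub.
Proof.
move=> f g; apply: lcoef_inj => k; apply: lcoef_inj => m.
rewrite lcoef2D lcoef2N !lcoef_dsub.
by rewrite lcoefD lcoefN; case: ifP; rewrite ?subr0.
Qed.

Lemma vanish_below_dsub (g : laurent L) a : vanish_below g a -> vanish_below (dsub g) a.
Proof.
move=> ga k ka; apply: lcoef_inj => m.
by rewrite lcoef_dsub ga // if_same.
Qed.

Lemma dsub_monoid : monoid_morphism dsub.
Proof.
split=> [|f g]; apply: lcoef_inj => k; apply: lcoef_inj => m.
  rewrite lcoef_dsub !lcoef1; case: (eqVneq k 0) => [->|k0].
    by rewrite lcoef1; case: eqP.
  by rewrite if_same.
have [a fa] := lcoefP f; have [b gb] := lcoefP g.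
have fga := vanish_below_dsub fa; have ggb := vanish_below_dsub gb.
have kab : k < a + b + (`|(k - a - b)%R|%N.+1)%:Z by lia.
rewrite lcoef_dsub (lcoefM_fin fa gb kab) (lcoefM_fin fga ggb kab) lcoef_sum.
case: eqP => [->|mk].
  apply: eq_bigr => j _.
  rewrite [X in _ = lcoef _ X](_ : k = a + j%:Z + (k - a - j%:Z)); last lia.
  rewrite [RHS](@lcoefM_lead _ _ _ (a + j%:Z) (k - a - j%:Z)) ?lcoef_dsub ?eqxx //.
    by move=> i ij; rewrite lcoef_dsub lt_eqF.
  by move=> i ij; rewrite lcoef_dsub lt_eqF.
rewrite big1 // => j _; apply: lcoefM_eq0 => i; rewrite !lcoef_dsub.
case: eqP => [->|_]; last by rewrite mul0r.
by case: eqP => [h|_]; [case: mk; lia|rewrite mulr0].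
Qed.

HB.instance Definition _ :=
  GRing.isZmodMorphism.Build (laurent L) L2 dsub dsub_zmod.
HB.instance Definition _ :=
  GRing.isMonoidMorphism.Build (laurent L) L2 dsub dsub_monoid.

(* With s = 1 or -1, all monomials t^m y^k of F have s (k - m) >= c. *)
Definition wt (s c : int) (F : L2) := forall k m, s * (k - m) < c -> F k m = 0.

Lemma wtW s c d F : d <= c -> wt s c F -> wt s d F.
Proof. by move=> dc Fc k m h; apply: Fc; apply: lt_le_trans dc. Qed.

Lemma wt0 s c : wt s c 0.
Proof. by move=> k m _; rewrite !lcoef0. Qed.

Lemma wtD s c F G : wt s c F -> wt s c G -> wt s c (F + G).
Proof. by move=> Fc Gc k m h; rewrite !lcoefD Fc ?Gc ?addr0. Qed.

Lemma wtN s c F : wt s c F -> wt s c (- F).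
Proof. by move=> Fc k m h; rewrite !lcoefN Fc ?oppr0. Qed.

Lemma wtM s c d F G : wt s c F -> wt s d G -> wt s (c + d) (F * G).
Proof.
move=> Fc Gd k m h; apply: lcoef2M_eq0 => i l.
have [?|?] := ltP (s * (i - l)) c; first by rewrite Fc ?mul0r.
by rewrite Gd ?mulr0 //; lia.
Qed.

Lemma wt1 s : wt s 0 1.
Proof.
move=> k m h; rewrite lcoef1; case: (eqVneq k 0) h => [-> h|_ _]; last by rewrite lcoef0.
rewrite lcoef1; case: eqP h => // ->; lia.
Qed.

Lemma wt_sum s c I (r : seq I) (P : pred I) (F : I -> L2) :
  (forall i, P i -> wt s c (F i)) -> wt s c (\sum_(i <- r | P i) F i).
Proof.
move=> Fc; elim/big_rec: _ => [|i G Pi Gc]; first exact: wt0.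
by apply: wtD => //; apply: Fc.
Qed.

Lemma wt_diag s c F m : 0 < c -> wt s c F -> F m m = 0.
Proof. by move=> c0 Fc; apply: Fc; rewrite subrr mulr0. Qed.

Lemma wt_dsub s g : wt s 0 (dsub g).
Proof.
move=> k m h; rewrite lcoef_dsub; case: eqP h => // ->.
by rewrite subrr mulr0 ltxx.
Qed.

Lemma wt_monom s k : wt s (s * k) (lmonom 1 k).
Proof.
move=> l m h; rewrite lcoef_monom; case: eqP h => [->|_ _]; last by rewrite lcoef0.
rewrite lcoef1; case: eqP => // ->; by rewrite subr0 ltxx.
Qed.

Lemma wt_Xn n : wt 1 n%:Z (y ^+ n).
Proof. by rewrite laurentXn -{1}[n%:Z]mul1r; apply: wt_monom. Qed.

Lemma wt_inv s (E : L2) : wt s 0 E -> vanish_below E 1 ->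
  1 + E != 0 /\ wt s 0 (1 + E)^-1.
Proof.
move=> E0 E1; have e0 : 1 + E != 0.
  apply/eqP => /(congr1 (fun F : L2 => F 0)); rewrite lcoefD lcoef1 eqxx E1 //.
  by rewrite lcoef0 addr0; apply/eqP/oner_neq0.
split=> //; set G := _^-1.
have GE : G = 1 - E * G.
  by rewrite -[1](mulfV e0) -/G -mulrBl addrK mul1r.
have [b Gb] := lcoefP G.
suff h N : forall k m, k < b + N%:Z -> s * (k - m) < 0 -> G k m = 0.
  by move=> k m; apply: (h `|(k - b + 1)%R|%N); lia.
elim: N => [|N IH] k m kb km; first by rewrite Gb ?lcoef0 //; lia.
rewrite GE lcoef2D lcoef2N (wt1 km) add0r lcoef2M_eq0 ?oppr0 // => i l.
have [i1|i1] := ltP i 1; first by rewrite E1 // lcoef0 mul0r.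
have [?|?] := ltP (s * (i - l)) 0; first by rewrite E0 ?mul0r.
by rewrite IH ?mulr0 //; lia.
Qed.

Lemma poly_root_quotient (Q : {poly laurent L}) (g : laurent L) :
    (forall k, vanish_below Q`_k 0) -> Q`_1 0 = 1 -> vanish_below g 2 ->
    Q.[g] = 0 ->
  exists2 U : {poly laurent L}, Q = U * ('X - g%:P) &
    (forall k, vanish_below U`_k 0) /\ U`_0 0 = 1.
Proof.
move=> Q0 Q1 g2 /eqP; rewrite -/(root Q g) => /factor_theorem[U QU].
have Uk k : U`_k = Q`_k.+1 + U`_k.+1 * g.
  by rewrite QU mulrBr coefB coefMX coefMC subrK.
have U0 k : vanish_below U`_k 0.
  have [n sU] : exists n, (size U <= k + n)%N by exists (size U); apply: leq_addl.
  elim: n k sU => [|n IH] k sU; first by rewrite nth_default // -(addn0 k).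
  rewrite Uk; apply: vanish_below_D => //.
  apply: vanish_below0_mul; first by apply: IH; rewrite addSnnS.
  exact: (vanish_belowW _ g2).
exists U => //; split=> //; rewrite Uk lcoefD Q1.
by rewrite (vanish_below_mul (U0 1) g2) ?addr0.
Qed.

Lemma wt_horner_dsub (U : {poly laurent L}) : wt 1 0 (map_poly dsub U).[y].
Proof.
rewrite horner_coef; apply: wt_sum => i _; rewrite coef_map.
rewrite -[0]addr0; apply: wtM; first exact: wt_dsub.
by apply: wtW (@wt_Xn i).
Qed.

Lemma horner_dsub_unit (U : {poly laurent L}) :
    (forall k, vanish_below U`_k 0) -> U`_0 0 = 1 ->
  vanish_below ((map_poly dsub U).[y] - 1) 1.
Proof.
move=> U0 U1 k k1; rewrite lcoefD lcoefN (@horner_coef_wide _ (size U).+1); last first.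
  by rewrite size_map_poly.
rewrite lcoef_sum big_ord_recl expr0 mulr1 coef_map lcoef1.
rewrite big1 ?addr0 => [|i _]; last first.
  rewrite mulrC lcoefXnM coef_map (vanish_below_dsub (U0 _)) //.
  by rewrite lift0; lia.
have [k0|k0] := ltP k 0.
  by rewrite (vanish_below_dsub (U0 _)) // lt_eqF // subr0.
have -> : k = 0 by lia.
apply/eqP; rewrite subr_eq0; apply/eqP/lcoef_inj => m.
by rewrite lcoef_dsub U1 lcoef1; case: eqP.
Qed.

Lemma log_deriv_split (F : fieldType) (x w u v : F) :
    x != 0 -> 1 - w != 0 -> u != 0 ->
  x ^+ 2 * ((v * (x * (1 - w)) + u) / (u * (x * (1 - w)))) =
    x * w + (x + (x * w * w * (1 - w)^-1 + x ^+ 2 * (v * u^-1))).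
Proof. by move=> x0 w0 u0; field; rewrite x0 w0 u0. Qed.

(* Furstenberg's formula. If Q = (Y - g) U then y^2 Q'/Q is the sum of
   y^2 U'/U, where y has a larger exponent than t in all monomials, and of
   y^2 / (y - g(ty)) = y + g(ty) + ..., where the dots stand for monomials in
   which t has a larger exponent than y. *)
Theorem Furstenberg (Q : {poly laurent L}) (g : laurent L)
    (q := map_poly dsub Q) :
    (forall k, vanish_below Q`_k 0) -> Q`_1 0 = 1 -> vanish_below g 2 ->
    Q.[g] = 0 ->
  q.[y] != 0 /\ forall m, (y ^+ 2 * (q^`().[y] / q.[y])) m m = g m.
Proof.
move=> Q0 Q1 g2 Qg; have [U QU [U0 U1]] := poly_root_quotient Q0 Q1 g2 Qg.
pose u := map_poly dsub U.
have qE : q = u * ('X - (dsub g)%:P).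
  by rewrite /q QU rmorphM rmorphB /= map_polyX map_polyC.
pose w := dsub g / y.
have y0 : y != 0 by apply: laurentX_neq0.
have yV : y^-1 = lmonom 1 (-1).
  apply: (mulfI y0); rewrite mulfV // lmonomM mulr1 //.
have w1 : wt (-1) 1 w.
  rewrite /w yV -[X in wt _ X]add0r; apply: wtM; first exact: wt_dsub.
  exact: (@wt_monom (-1) (-1)).
have wv : vanish_below w 1.
  rewrite /w yV; apply: (@vanish_belowW _ _ (2 + -1)) => //.
  apply: vanish_below_mul.
    exact: vanish_below_dsub.
  by move=> m h; rewrite lcoef_monom lt_eqF.
have [w0 wV] : 1 - w != 0 /\ wt (-1) 0 (1 - w)^-1.
  apply: wt_inv; first exact/wtN/(wtW _ w1).
  by move=> m m1; rewrite lcoefN wv ?oppr0.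
have [u0 uV] : u.[y] != 0 /\ wt 1 0 u.[y]^-1.
  rewrite -(subrKC 1 u.[y]); apply: wt_inv.
    apply: wtD; first exact: wt_horner_dsub.
    exact/wtN/wt1.
  exact: horner_dsub_unit.
have ywE : y - dsub g = y * (1 - w) by rewrite mulrBr mulr1 mulrCA mulfV ?mulr1.
have qy : q.[y] = u.[y] * (y * (1 - w)) by rewrite qE hornerM hornerXsubC ywE.
have yw0 : y * (1 - w) != 0 by rewrite mulf_neq0.
split=> [|m]; first by rewrite qy mulf_neq0.
have -> : y ^+ 2 * (q^`().[y] / q.[y]) =
    dsub g + (y + (dsub g * w * (1 - w)^-1 + y ^+ 2 * (u^`().[y] * u.[y]^-1))).
  have dgE : dsub g = y * w by rewrite mulrCA mulfV ?mulr1.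
  rewrite qy qE derivM derivXsubC mulr1 hornerD hornerM hornerXsubC ywE.
  by rewrite [in RHS]dgE; apply: log_deriv_split.
rewrite !lcoef2D (wt_diag _ _ (@wt_Xn 1)) //.
have hw : wt (-1) 1 (dsub g * w * (1 - w)^-1).
  apply: (@wtM _ 1 0) => //; apply: (@wtM _ 0 1) => //; exact: wt_dsub.
have hu : wt 1 2 (y ^+ 2 * (u^`().[y] * u.[y]^-1)).
  apply: (@wtM _ 2 0); first exact: (@wt_Xn 2).
  by apply: (@wtM _ 0 0) => //; rewrite /u deriv_map; apply: wt_horner_dsub.
by rewrite (wt_diag _ _ hw) // (wt_diag _ _ hu) // !addr0 lcoef_dsub eqxx.
Qed.

End Furstenberg.

(** * Algebraic series *)

Section Algebraic.
Local Notation widen := (widen_ord (leqnSn _)).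
Local Open Scope ring_scope.
Variable K : fieldType.

Definition alg k (h : nat) (f : lseries K k) :=
  exists P : {poly {mpoly K[k]}},
    [/\ P != 0, (size P <= h.+1)%N, forall j, mdeg_le P`_j h
      & (map_poly (@mpoly_lseries K k) P).[f] = 0].

Lemma algW k h h' (f : lseries K k) : (h <= h')%N -> alg h f -> alg h' f.
Proof.
move=> hh [P [P0 sP dP Pf]]; exists P; split=> //.
  exact: leq_trans sP _.
by move=> j; apply: mdeg_leW (dP j).
Qed.

Lemma alg_intro k h (f : lseries K k) (p : nat -> {mpoly K[k]}) :
    (exists2 j, (j <= h)%N & p j != 0) -> (forall j, mdeg_le (p j) h) ->
    \sum_(j < h.+1) mpoly_lseries (p j) * f ^+ j = 0 ->
  alg h f.
Proof.
move=> [j jh pj] dp pf; exists (\poly_(i < h.+1) p i); split.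
- apply: contraNneq pj => /(congr1 (fun P : {poly _} => P`_j)).
  by rewrite coef_poly ltnS jh coef0 => ->.
- exact: size_poly.
- by move=> i; rewrite coef_poly; case: ifP => // _; apply: mdeg_le0.
rewrite (@horner_coef_wide _ h.+1); last first.
  by apply: leq_trans (size_poly _ _) (size_poly _ _).
rewrite -[RHS]pf; apply: eq_bigr => i _.
by rewrite coef_map coef_poly ltn_ord.
Qed.

Lemma alg_elim k h (f : lseries K k) : alg h f ->
  exists p : nat -> {mpoly K[k]},
    [/\ p h != 0, forall j, mdeg_le (p j) h
      & \sum_(j < h.+1) mpoly_lseries (p j) * f ^+ j = 0].
Proof.
move=> [P [P0 sP dP Pf]]; pose Q := P * 'X^(h.+1 - size P).
have sQ : size Q = h.+1 by rewrite size_mulXn // subnK.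
exists (fun j => Q`_j); split=> [|j|].
- by rewrite -[h]/(h.+1.-1) -sQ -lead_coefE lead_coef_eq0 -size_poly_eq0 sQ.
- by rewrite coefMXn; case: ifP => // _; apply: mdeg_le0.
have : (map_poly (@mpoly_lseries K k) Q).[f] = 0.
  by rewrite rmorphM hornerM Pf mul0r.
rewrite (@horner_coef_wide _ h.+1) => [QE|]; last first.
  by rewrite -sQ; apply: size_poly.
by rewrite -[RHS]QE; apply: eq_bigr => j _; rewrite coef_map.
Qed.

Lemma alg_gt0 k h (f : lseries K k) : alg h f -> (0 < h)%N.
Proof.
case: h => // /alg_elim[p [p0 _]]; rewrite big_ord1 expr0 mulr1 => /eqP.
by rewrite mpoly_lseries_eq0 (negPf p0).
Qed.

Lemma alg_inv k h (f : lseries K k) : f != 0 -> alg h f -> alg h f^-1.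
Proof.
move=> f0 /alg_elim[p [ph dp pf]].
apply: (@alg_intro _ _ _ (fun j => p (h - j)%N)) => //.
  by exists 0%N => //; rewrite subn0.
apply: (mulfI (expf_neq0 h f0)); rewrite mulr0 -[RHS]pf mulr_sumr.
rewrite (reindex_inj rev_ord_inj); apply: eq_bigr => j _ /=.
have jh : (j <= h)%N by rewrite -ltnS.
rewrite subSS subKn // mulrCA; congr (_ * _).
by rewrite exprVn -{1}(subnK jh) addnC exprD mulfK // expf_neq0.
Qed.

Lemma alg_mpoly k h (p : {mpoly K[k]}) :
  (0 < h)%N -> mdeg_le p h -> alg h (mpoly_lseries p).
Proof.
move=> h0 dp; exists ('X - p%:P); split.
- by rewrite polyXsubC_eq0.
- by rewrite size_XsubC ltnS.
- move=> j; rewrite coefB coefX coefC; apply: mdeg_leD.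
    by case: eqP => _; [apply: mdeg_le1|apply: mdeg_le0].
  by apply: mdeg_leN; case: eqP => // _; apply: mdeg_le0.
by rewrite rmorphB /= map_polyX map_polyC hornerXsubC subrr.
Qed.

Lemma mdeg_le_widen k (p : {mpoly K[k]}) N : mdeg_le p N -> mdeg_le (mwiden p) N.
Proof.
by move=> dp; rewrite -[N]muln1; apply: mdeg_le_mmap => // i; apply: mdeg_leXU.
Qed.

Lemma alg_widen k h (f : lseries K k) :
  alg h f -> alg h (laurentC f : lseries K k.+1).
Proof.
move=> /alg_elim[p [ph dp pf]].
apply: (@alg_intro k.+1 _ _ (fun j => mwiden (p j))) => [|j|].
- exists h => //; rewrite -mpoly_lseries_eq0 mpoly_lseries_widen fmorph_eq0.
  by rewrite mpoly_lseries_eq0.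
- exact: mdeg_le_widen.
transitivity (laurentC (\sum_(j < h.+1) mpoly_lseries (p j) * f ^+ j)).
  rewrite rmorph_sum; apply: eq_bigr => j _.
  by rewrite mpoly_lseries_widen rmorphM rmorphXn.
by rewrite pf rmorph0.
Qed.

Lemma mpoly_lseries_coef k (p : {mpoly K[k.+1]}) N (l : int) : mdeg_le p N ->
  exists2 p' : {mpoly K[k]}, mdeg_le p' N &
    (mpoly_lseries p : laurent _) l = mpoly_lseries p'
    /\ (p' != 0 -> l <= N%:Z).
Proof.
move=> dp; pose mm (m : 'X_{1..k.+1}) := [multinom m (widen i) | i < k].
pose c (m : 'X_{1..k.+1}) : {mpoly K[k]} :=
  if l == (m ord_max)%:Z then p@_m *: 'X_[mm m] else 0.
have cN m : m \in msupp p -> c m != 0 -> l <= N%:Z.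
  rewrite mcoeff_msupp /c => /(mdeg_le_mcoeff dp) mN; case: (l =P _) => [-> _|_].
    by rewrite lez_nat; apply: leq_trans mN; rewrite mdegE big_ord_recr /= leq_addl.
  by rewrite eqxx.
exists (\sum_(m <- msupp p) c m); first rewrite big_seq.
  apply: mdeg_le_sum => m; rewrite mcoeff_msupp => /(mdeg_le_mcoeff dp) mN.
  rewrite /c; case: ifP => _; last exact: mdeg_le0.
  apply: leq_trans (msizeZ_le _ _) _; rewrite msizeX ltnS; apply: leq_trans mN.
  rewrite !mdegE big_ord_recr /=; apply: leq_trans (leq_addr _ _).
  by apply: leq_sum => i _; rewrite mnmE.
split; last first.
  move=> c0; have [lN//|Nl] := leP l N%:Z.
  case/eqP: c0; rewrite big_seq big1 // => m mp; apply/eqP.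
  by apply: contraTT Nl => /(cN _ mp); rewrite -leNgt.
rewrite [in LHS](mpolyE p) !raddf_sum lcoef_sum; apply: eq_bigr => m _.
have -> : 'X_[m] = mwiden 'X_[mm m] * 'X_ord_max ^+ (m ord_max) :> {mpoly K[k.+1]}.
  rewrite mwidenX mpolyXn -mpolyXD; congr 'X_[_]; apply/mnmP => i.
  rewrite mnmDE mulmnE mnm1E; case: (unliftP ord_max i) => [j ->|->].
    rewrite (_ : lift ord_max j = widen j); last by apply: val_inj; rewrite [LHS]lift_max.
    rewrite mnmwiden_widen mnmE.
    by rewrite -[_ == _]/(_ == _ :> nat) /= gtn_eqF // mul0n addn0.
  by rewrite mnmwiden_ordmax eqxx mul1n.
rewrite scalerAl -mwidenZ.
transitivity ((laurentX (lseries K k) ^+ m ord_max *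
    laurentC (mpoly_lseries (p@_m *: 'X_[mm m]))) l).
  apply: (congr1 (fun f : laurent _ => f l)).
  rewrite [LHS]mpoly_lseriesM mpoly_lseries_widen mulrC; congr (_ * _).
  by rewrite rmorphXn /= mpoly_lseriesX lX_max.
rewrite lcoefXnM lcoef_monom subr_eq0 /c.
by case: eqP => // _; rewrite raddf0.
Qed.

Lemma mpoly_lseries_below k (p : {mpoly K[k.+1]}) N (l : int) :
  mdeg_le p N -> N%:Z < l -> (mpoly_lseries p : laurent _) l = 0.
Proof.
move=> dp Nl; have [p' _ [-> p'0]] := mpoly_lseries_coef l dp.
have [->|/p'0] := eqVneq p' 0; first by rewrite rmorph0.
by rewrite leNgt Nl.
Qed.

Lemma vanish_belowXn F (f : laurent F) n :
  vanish_below f 0 -> vanish_below (f ^+ n) 0.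
Proof.
move=> f0; elim: n => [|n IH]; first exact: vanish_belowC.
by rewrite exprS; apply: vanish_below0_mul.
Qed.

Lemma lcoefX0 F (f : laurent F) n :
  vanish_below f 0 -> (f ^+ n) 0 = f 0 ^+ n.
Proof.
move=> f0; elim: n => [|n IH]; first by rewrite !expr0 lcoef1.
rewrite !exprS -[in LHS](addr0 (0 : int)).
by rewrite [LHS](lcoefM_lead f0 (vanish_belowXn _ f0)) IH.
Qed.

Lemma alg_coef0 k h (f : lseries K k.+1) :
    vanish_below (f : laurent (lseries K k)) 0 -> alg h f ->
  alg h ((f : laurent (lseries K k)) 0).
Proof.
move=> f0 /alg_elim[p [ph dp pf]].
pose c (v : nat) j := (mpoly_lseries (p j) : laurent (lseries K k)) v%:Z.
pose bad v := [exists j : 'I_h.+1, c v j != 0].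
have [v bv] : exists v, bad v.
  apply: contrapT => nb; move/eqP: ph; apply.
  apply/eqP; rewrite -mpoly_lseries_eq0; apply/eqP/lcoef_inj => m.
  have [m0|m0] := ltP m 0; first by rewrite mpoly_lseries_ge0 // lcoef0.
  rewrite lcoef0 -(gez0_abs m0); apply/eqP; apply: contrapT => /negP pm.
  by apply: nb; exists `|m|%N; apply/existsP; exists ord_max.
case: (ex_minnP (ex_intro bad v bv)) => {v bv} v /existsP[j0 cj0] minv.
have pv j : (j < h.+1)%N -> vanish_below (mpoly_lseries (p j) : laurent _) v%:Z.
  move=> jh m mv; have [m0|m0] := ltP m 0; first exact: mpoly_lseries_ge0.
  apply/eqP; apply: contrapT => /negP pm.
  have : bad `|m|%N.
    by apply/existsP; exists (Ordinal jh); rewrite /c gez0_abs.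
  by move/minv; lia.
have [q qP] : exists q : nat -> {mpoly K[k]},
    forall j, mdeg_le (q j) h /\ c v j = mpoly_lseries (q j).
  have pc j : exists q : {mpoly K[k]}, mdeg_le q h /\ c v j = mpoly_lseries q.
    by have [q dq [cq _]] := mpoly_lseries_coef v%:Z (dp j); exists q.
  by have [q qP] := choice pc; exists q.
apply: (@alg_intro _ _ _ q) => [|j|].
- exists j0; first by rewrite -ltnS.
  by rewrite -mpoly_lseries_eq0 -(qP j0).2.
- exact: (qP j).1.
transitivity ((\sum_(j < h.+1) mpoly_lseries (p j) * f ^+ j : laurent _) v%:Z).
  rewrite lcoef_sum; apply: eq_bigr => j _; rewrite -(qP j).2 /c.
  rewrite -[v%:Z in RHS]addr0.
  by rewrite [RHS](lcoefM_lead (pv _ (ltn_ord j)) (vanish_belowXn _ f0)) lcoefX0.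
by rewrite pf lcoef0.
Qed.

Lemma alg_order k h (b : lseries K k.+1) :
    vanish_below (b : laurent (lseries K k)) 0 -> b != 0 -> alg h b ->
  exists e : nat, [/\ (e <= h)%N, vanish_below (b : laurent (lseries K k)) e%:Z
                    & (b : laurent (lseries K k)) e%:Z != 0].
Proof.
move=> b0 bn0 /alg_elim[p [ph dp pb]].
pose bad v := (b : laurent (lseries K k)) v%:Z != 0.
have below v : (forall u, (u < v)%N -> ~~ bad u) ->
    vanish_below (b : laurent (lseries K k)) v%:Z.
  move=> nb m mv; have [m0|m0] := ltP m 0; first exact: b0.
  have := nb `|m|%N; rewrite /bad gez0_abs // negbK => mz; apply/eqP/mz; lia.
have [v bv] : exists v, bad v.
  apply: contrapT => nb; case/eqP: bn0; apply: lcoef_inj => m.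
  apply: (below `|m|%N.+1); last lia.
  by move=> u _; apply/negP => bu; apply: nb; exists u.
case: (ex_minnP (ex_intro bad v bv)) => {v bv} e be mine.
have bel : vanish_below (b : laurent (lseries K k)) e%:Z.
  by apply: below => u ue; apply/negP => /mine; rewrite leqNgt ue.
exists e; split=> //; rewrite leqNgt; apply/negP => he.
have [j pj minj] := ex_minnP (ex_intro (fun j => p j != 0) h ph).
have jh : (j <= h)%N by apply: minj.
have sumE : \sum_(i < h.+1) mpoly_lseries (p i) * b ^+ i =
    mpoly_lseries (p j) * b ^+ j +
      \sum_(j.+1 <= i < h.+1) mpoly_lseries (p i) * b ^+ i.
  rewrite -(big_mkord xpredT (fun i => mpoly_lseries (p i) * b ^+ i)).
  rewrite (@big_cat_nat _ _ _ j) //= ?leqW // [X in X + _]big_nat big1.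
    by rewrite add0r big_ltn.
  move=> i /andP[_ ij]; have [->|/minj] := eqVneq (p i) 0.
    by rewrite rmorph0 mul0r.
  by rewrite leqNgt ij.
have pjb : mpoly_lseries (p j) =
    - (b * \sum_(j.+1 <= i < h.+1) mpoly_lseries (p i) * b ^+ (i - j.+1)).
  have bj0 : b ^+ j != 0 by rewrite expf_neq0.
  apply: (mulIf bj0); apply/eqP; rewrite mulNr -addr_eq0; apply/eqP.
  rewrite -[RHS]pb sumE; congr (_ + _).
  rewrite mulrAC -exprS mulr_sumr; apply: eq_big_nat => i /andP[ji _].
  by rewrite mulrCA -exprD subnKC.
have Sv : vanish_below
    (\sum_(j.+1 <= i < h.+1) mpoly_lseries (p i) * b ^+ (i - j.+1) : laurent _) 0.
  move=> m m0; rewrite lcoef_sum big1 // => i _.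
  exact: (vanish_below0_mul (mpoly_lseries_ge0 _) (vanish_belowXn _ b0)).
case/eqP: pj; apply/eqP; rewrite -mpoly_lseries_eq0; apply/eqP/lcoef_inj => m.
rewrite lcoef0; have [mh|hm] := leP m h%:Z; last exact: mpoly_lseries_below hm.
rewrite pjb; have := vanish_below_mul bel Sv; rewrite addr0 => bS.
by rewrite lcoefN (bS m) ?oppr0 //; lia.
Qed.

End Algebraic.

Section Frames.
Local Open Scope ring_scope.
Variable K : fieldType.

(* q^d w acts on the family e by a matrix with entries of degree at most
   d (H + 1). *)
Definition filt k (I : finType) (e : I -> lseries K k) (q : {mpoly K[k]})
    (H d : nat) (w : lseries K k) :=
  exists2 M : I -> I -> {mpoly K[k]},
    forall i j, mdeg_le (M i j) (d * H.+1) &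
    forall i, mpoly_lseries q ^+ d * w * e i =
      \sum_j mpoly_lseries (M i j) * e j.

Section Closure.
Variables (k : nat) (I : finType) (e : I -> lseries K k) (q : {mpoly K[k]}).
Variables (H : nat) (dq : mdeg_le q H).
Local Notation S := (filt e q H).

Lemma sum_if_eq (F : I -> lseries K k) i : \sum_j (if j == i then F j else 0) = F i.
Proof. by rewrite -big_mkcond big_pred1_eq. Qed.

Lemma filt_mpoly d p : mdeg_le p d -> S d (mpoly_lseries p).
Proof.
move=> dp; exists (fun i j => if j == i then q ^+ d * p else 0) => [i j|i].
  case: eqP => _; last exact: mdeg_le0.
  by rewrite mulnS addnC; apply: mdeg_leM => //; apply: mdeg_leX.
rewrite (eq_bigr (fun j =>
  if j == i then mpoly_lseries (q ^+ d * p) * e j else 0)).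
  by rewrite sum_if_eq rmorphM rmorphXn.
by move=> j _; case: eqP => // _; rewrite rmorph0 mul0r.
Qed.

Lemma filtW d d' w : (d <= d')%N -> S d w -> S d' w.
Proof.
move=> dd [M dM Me]; exists (fun i j => q ^+ (d' - d) * M i j) => [i j|i].
  rewrite -(subnK dd) mulnDl addnK; apply: mdeg_leM => //.
  by apply: (@mdeg_leW _ _ _ ((d' - d) * H)); [lia|apply: mdeg_leX].
rewrite -(subnK dd) addnK exprD -!mulrA [_ * (w * _)]mulrA Me mulr_sumr.
by apply: eq_bigr => j _; rewrite rmorphM rmorphXn mulrA.
Qed.

Lemma filtD d w w' : S d w -> S d w' -> S d (w + w').
Proof.
move=> [M dM Me] [M' dM' Me']; exists (fun i j => M i j + M' i j) => [i j|i].
  exact: mdeg_leD.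
rewrite mulrDr mulrDl Me Me' -big_split; apply: eq_bigr => j _.
by rewrite rmorphD mulrDl.
Qed.

Lemma filtN d w : S d w -> S d (- w).
Proof.
move=> [M dM Me]; exists (fun i j => - M i j) => [i j|i]; first exact: mdeg_leN.
rewrite mulrN mulNr Me -sumrN; apply: eq_bigr => j _.
by rewrite rmorphN mulNr.
Qed.

Lemma filtM d d' w w' : S d w -> S d' w' -> S (d + d') (w * w').
Proof.
move=> [M dM Me] [M' dM' Me'].
exists (fun i j => \sum_l M' i l * M l j) => [i j|i].
  by apply: mdeg_le_sum => l _; rewrite mulnDl addnC; apply: mdeg_leM.
have -> : mpoly_lseries q ^+ (d + d') * (w * w') * e i =
    \sum_l mpoly_lseries (M' i l) * (mpoly_lseries q ^+ d * w * e l).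
  transitivity (mpoly_lseries q ^+ d * w * (mpoly_lseries q ^+ d' * w' * e i)).
    by rewrite exprD; ring.
  by rewrite Me' mulr_sumr; apply: eq_bigr => l _; rewrite mulrCA.
under eq_bigr => l _ do rewrite Me mulr_sumr.
rewrite exchange_big; apply: eq_bigr => j _.
rewrite rmorph_sum mulr_suml; apply: eq_bigr => l _.
by rewrite rmorphM mulrA.
Qed.

Lemma filt0 d : S d 0.
Proof. by rewrite -(rmorph0 (@mpoly_lseries K k)); apply/filt_mpoly/mdeg_le0. Qed.

Lemma filt1 d : S d 1.
Proof. by rewrite -(rmorph1 (@mpoly_lseries K k)); apply/filt_mpoly/mdeg_le1. Qed.

Lemma filtX d w n : S d w -> S (n * d) (w ^+ n).
Proof.
move=> dw; elim: n => [|n IH]; first exact: filt1.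
by rewrite exprS mulSn; apply: filtM.
Qed.

Lemma filt_sum d J (r : seq J) (P : pred J) (w : J -> lseries K k) :
  (forall j, P j -> S d (w j)) -> S d (\sum_(j <- r | P j) w j).
Proof.
move=> Sw; elim/big_rec: _ => [|j v Pj Sv]; first exact: filt0.
by apply: filtD => //; apply: Sw.
Qed.

Lemma coef_char_poly_deg N m (M : 'M[{mpoly K[k]}]_m) :
    (forall i j, mdeg_le (M i j) N) ->
  forall l, mdeg_le (char_poly M)`_l (m * N).
Proof.
move=> dM; rewrite /char_poly /determinant => l; rewrite coef_sum.
apply: mdeg_le_sum => s _.
rewrite mulr_sign (fun_if (fun P : {poly {mpoly K[k]}} => P`_l)) coefN.
suff dP (f : 'I_m -> 'I_m) : mdeg_le (\prod_i char_poly_mx M i (f i))`_l (m * N).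
  by case: ifP => _; [apply: mdeg_leN|]; apply: dP.
have sE : size (index_enum 'I_m) = m.
  by rewrite -[index_enum _]/(Finite.enum _) -enumT size_enum_ord.
rewrite -[X in mdeg_le _ (X * N)]sE {sE}.
elim: (index_enum _) l => [|i r IH] l.
  by rewrite big_nil coef1; case: eqP => _; [apply: mdeg_le1|apply: mdeg_le0].
rewrite big_cons coefM mulSn; apply: mdeg_le_sum => j _; apply: mdeg_leM => //.
rewrite !mxE coefB coefC coefMn coefX; apply: mdeg_leD.
  case: (i == f i); last by rewrite mulr0n; apply: mdeg_le0.
  by rewrite mulr1n; case: (_ == _); [apply: mdeg_le1|apply: mdeg_le0].
by apply: mdeg_leN; case: eqP => // _; apply: mdeg_le0.
Qed.

Lemma alg_filt d w i0 : q != 0 -> e i0 != 0 -> S d w ->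
  alg (#|I| + 2 * (#|I| * (d * H.+1))) w.
Proof.
move=> q0 e0 [M dM Me].
pose A : 'M[{mpoly K[k]}]_#|I| := \matrix_(i, j) M (enum_val j) (enum_val i).
pose v : 'rV[lseries K k]_#|I| := \row_i e (enum_val i).
pose w' := mpoly_lseries q ^+ d * w.
have vA : v *m map_mx (@mpoly_lseries K k) A = w' *: v.
  apply/rowP => i; rewrite !mxE Me (reindex _ (onW_bij _ (enum_val_bij I))) /=.
  by apply: eq_bigr => j _; rewrite !mxE mulrC.
have v0 : v != 0.
  apply: contraNneq e0 => /rowP /(_ (enum_rank i0)).
  by rewrite !mxE enum_rankK => ->.
have : eigenvalue (map_mx (@mpoly_lseries K k) A) w'.
  by apply/eigenvalueP; exists v.
rewrite eigenvalue_root_char -map_char_poly => /eqP rA.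
have sC : size (char_poly A) = #|I|.+1 by rewrite size_char_poly.
have dC : forall l, mdeg_le (char_poly A)`_l (#|I| * (d * H.+1)).
  by apply: coef_char_poly_deg => i j; rewrite mxE.
pose p j := if (j <= #|I|)%N then (char_poly A)`_j * q ^+ (d * j) else 0.
apply: (@alg_intro _ _ _ _ p) => [|j|].
- exists #|I|; first exact: leq_addr.
  rewrite /p leqnn mulf_neq0 ?expf_neq0 //.
  have /monicP := char_poly_monic A; rewrite lead_coefE sC /= => ->.
  exact: oner_neq0.
- rewrite /p; case: leqP => [jI|_]; last exact: mdeg_le0.
  apply: (@mdeg_leW _ _ _ (#|I| * (d * H.+1) + (d * j) * H)); last first.
    by apply: mdeg_leM => //; apply: mdeg_leX.
  have : (d * j * H <= #|I| * (d * H.+1))%N.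
    by rewrite [X in (_ <= X)%N]mulnA [(#|I| * d)%N]mulnC leq_mul // leq_mul.
  lia.
rewrite -(big_mkord xpredT (fun j => mpoly_lseries (p j) * w ^+ j)).
rewrite (@big_cat_nat _ _ _ #|I|.+1) //= ?ltnS ?leq_addr //.
rewrite [X in _ + X]big_nat [X in _ + X]big1 ?addr0; last first.
  by move=> j /andP[jI _]; rewrite /p leqNgt jI rmorph0 mul0r.
rewrite big_mkord -[RHS]rA (@horner_coef_wide _ #|I|.+1); last first.
  by rewrite -sC; apply: size_poly.
apply: eq_bigr => j _; rewrite coef_map /p -ltnS ltn_ord rmorphM rmorphXn.
by rewrite -mulrA /w' exprMn -exprM.
Qed.

End Closure.

Lemma frame_cons k (I : finType) (e : I -> lseries K k) q H h th :
    mdeg_le q H -> q != 0 -> (exists i, e i = 1) -> alg h th ->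
  exists (e' : I * 'I_h -> lseries K k) (q' : {mpoly K[k]}),
    [/\ mdeg_le q' (H + h) /\ q' != 0, exists i, e' i = 1,
        forall d w, filt e q H d w -> filt e' q' (H + h) d w,
        filt e' q' (H + h) 1 th &
        forall i, exists (i1 : I) (j : 'I_h), e' i = e i1 * th ^+ j].
Proof.
move=> dq q0 [i0 ei0] ath; have h0 := alg_gt0 ath.
have [p [ph dp pth]] := alg_elim ath.
pose e' (x : I * 'I_h) := e x.1 * th ^+ x.2.
exists e', (q * p h); split.
- by split; [apply: mdeg_leM|rewrite mulf_neq0].
- by exists (i0, Ordinal h0); rewrite /e' ei0 mul1r.
- move=> d w [M dM Me].
  exists (fun x z => if z.2 == x.2 then p h ^+ d * M x.1 z.1 else 0) => [x z|x].
    case: eqP => _; last exact: mdeg_le0.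
    apply: (@mdeg_leW _ _ _ (d * h + d * H.+1)); first by lia.
    by apply: mdeg_leM => //; apply: mdeg_leX.
  rewrite -(pair_bigA _ (fun i j => mpoly_lseries
    (if j == x.2 then p h ^+ d * M x.1 i else 0) * e' (i, j))) /=.
  transitivity (\sum_i mpoly_lseries (p h ^+ d * M x.1 i) * e' (i, x.2)).
    rewrite rmorphM exprMn.
    transitivity (mpoly_lseries (p h) ^+ d * th ^+ x.2 *
      (mpoly_lseries q ^+ d * w * e x.1)); first by rewrite /e'; ring.
    rewrite Me mulr_sumr; apply: eq_bigr => i _.
    by rewrite rmorphM rmorphXn /e' /=; ring.
  apply: eq_bigr => i _; rewrite (bigD1 x.2) //= eqxx big1 ?addr0 // => j jx.
  by rewrite (negPf jx) rmorph0 mul0r.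
- pose M (x z : I * 'I_h) : {mpoly K[k]} := if z.1 == x.1 then
     (if x.2.+1 == h then - (q * p z.2)
      else if z.2 == x.2.+1 :> nat then q * p h else 0) else 0.
  exists M => [x z|x].
    have dqp j : mdeg_le (q * p j) (1 * (H + h).+1).
      by rewrite mul1n; apply: (@mdeg_leW _ _ _ (H + h)) => //; apply: mdeg_leM.
    rewrite /M; case: eqP => _; last exact: mdeg_le0.
    case: eqP => _; first exact: mdeg_leN.
    by case: eqP => _; last exact: mdeg_le0.
  rewrite -(pair_bigA _ (fun i j => mpoly_lseries (M x (i, j)) * e' (i, j))) /=.
  rewrite (bigD1 x.1) //= [X in _ + X]big1 ?addr0; last first.
    move=> i ix; apply: big1 => j _.
    by rewrite /M /= (negPf ix) rmorph0 mul0r.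
  rewrite /M /= eqxx expr1 rmorphM; case: (eqVneq x.2.+1 h) => [xh|xh].
    transitivity (- (mpoly_lseries q * e x.1) *
        \sum_(j < h) mpoly_lseries (p j) * th ^+ j).
      move/eqP: pth; rewrite big_ord_recr /= addrC addr_eq0 => /eqP pth.
      have thE : th ^+ h = th ^+ x.2 * th by rewrite -exprSr xh.
      by rewrite mulNr -mulrN -pth thE /e'; ring.
    rewrite mulr_sumr; apply: eq_bigr => j _.
    by rewrite rmorphN rmorphM /e' /=; ring.
  have xh' : (x.2.+1 < h)%N by rewrite ltn_neqAle xh ltn_ord.
  rewrite (bigD1 (Ordinal xh')) //= eqxx [X in _ + X]big1 ?addr0.
    by rewrite rmorphM /e' /= exprS; ring.
  move=> j jx; rewrite ifN ?rmorph0 ?mul0r //.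
- by move=> [i j]; exists i, j.
Qed.

Lemma frame_exists k h (s : seq (lseries K k)) :
    (0 < h)%N -> (forall w, w \in s -> alg h w) ->
  exists (I : finType) (e : I -> lseries K k) (q : {mpoly K[k]}),
    [/\ #|I| = (h ^ size s)%N, mdeg_le q (size s * h) /\ q != 0,
        exists i, e i = 1, forall w, w \in s -> filt e q (size s * h) 1 w &
        forall i, filt e q (size s * h) (size s * h) (e i)].
Proof.
move=> h0; elim: s => [|th s IH] sh.
  exists unit, (fun=> 1), 1; rewrite card_unit; split=> //.
  - by split; [apply: mdeg_le1|apply: oner_neq0].
  - by move=> i; apply/filt1/mdeg_le1.
have [|I [e [q [cI [dq q0] e1 es ee]]]] := IH.
  by move=> w ws; apply: sh; rewrite inE ws orbT.
have ath : alg h th by apply: sh; rewrite inE eqxx.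
have [e' [q' [[dq' q0'] e1' sub fth e'E]]] := frame_cons dq q0 e1 ath.
have HE : (size (th :: s) * h = size s * h + h)%N by rewrite mulSn addnC.
rewrite HE; exists (I * 'I_h)%type, e', q'; split=> //.
- by rewrite card_prod card_ord cI expnSr.
- by move=> w; rewrite inE => /predU1P[->//|/es]; apply: sub.
- move=> i; have [i1 [j ->]] := e'E i; apply: filtM; first exact/sub/ee.
  have := filtX dq' j fth; rewrite muln1; apply: filtW => //.
  exact: ltnW.
Qed.

Lemma filt_widen k (I : finType) (e : I -> lseries K k) q H d w :
  filt e q H d w ->
  filt (fun i => laurentC (e i) : lseries K k.+1) (mwiden q) H d (laurentC w).
Proof.
move=> [M dM Me]; exists (fun i j => mwiden (M i j)) => [i j|i].
  exact: mdeg_le_widen.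
rewrite mpoly_lseries_widen -rmorphXn.
transitivity (laurentC (mpoly_lseries q ^+ d * w * e i)).
  by rewrite !rmorphM.
rewrite Me rmorph_sum; apply: eq_bigr => j _.
by rewrite mpoly_lseries_widen [LHS]rmorphM.
Qed.

End Frames.

(** * Separability *)

Section Splitting.
Local Open Scope ring_scope.

Lemma vanish_below_exp F (f : laurent F) a n :
  vanish_below f a -> vanish_below (f ^+ n) (n%:Z * a).
Proof.
move=> fa; elim: n => [|n IH]; first by rewrite mul0r; apply: vanish_belowC.
rewrite exprS (_ : n.+1%:Z * a = a + n%:Z * a); first exact: vanish_below_mul.
by rewrite -addn1 PoszD; ring.
Qed.

Lemma laurent_split F (f : laurent F) a n : vanish_below f a ->
  exists2 g : laurent F, vanish_below g (a + n%:Z) &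
    f = \sum_(j < n) lmonom (f (a + j%:Z)) (a + j%:Z) + g.
Proof.
move=> fa; exists (f - \sum_(j < n) lmonom (f (a + j%:Z)) (a + j%:Z)).
  move=> m ma; rewrite lcoefD lcoefN lcoef_sum; have [mla|am] := ltP m a.
    by rewrite fa // big1 ?subr0 // => j _; rewrite lcoef_monom ifF //; lia.
  have jn : (`|(m - a)%R|%N < n)%N by lia.
  have me : a + `|(m - a)%R|%N%:Z = m by lia.
  rewrite (bigD1 (Ordinal jn)) // lcoef_monom me eqxx big1 => [|j jne].
    by rewrite [X in _ - X]addr0 subrr.
  rewrite lcoef_monom ifF //; apply/eqP => mj.
  by case/eqP: jne; apply: val_inj => /=; lia.
by rewrite addrC subrK.
Qed.

Lemma lmonomX (F : fieldType) (c : F) m n : lmonom c m ^+ n = lmonom (c ^+ n) (n%:Z * m).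
Proof.
elim: n => [|n IH]; first by rewrite mul0r.
by rewrite !exprS IH lmonomM -addn1 PoszD; congr (lmonom _ _); ring.
Qed.

End Splitting.

Section Cartier.
Local Open Scope ring_scope.
Variables (K : fieldType) (p : nat).
Hypothesis pK : p \in [pchar K].

Let p_gt0 : (0 < p)%N. Proof. exact/prime_gt0/(pcharf_prime pK). Qed.

Lemma expf0p (F : fieldType) : (0 : F) ^+ p = 0.
Proof. by rewrite expr0n gtn_eqF. Qed.

Lemma pchar_exprD (F : fieldType) (x y : F) : p \in [pchar F] ->
  (x + y) ^+ p = x ^+ p + y ^+ p.
Proof. by move=> pF; rewrite -!(pFrobenius_autE pF) rmorphD. Qed.

Lemma pchar_exprN (F : fieldType) (x : F) : p \in [pchar F] ->
  (- x) ^+ p = - x ^+ p.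
Proof. by move=> pF; rewrite -!(pFrobenius_autE pF) rmorphN. Qed.

Section Functional.
Variable a : K.
Hypothesis a0 : a != 0.

Definition good_graph (G : set (K * K)) :=
  [/\ forall x y x' y', G (x, y) -> G (x', y') -> G (x + x', y + y'),
      forall c x y, G (x, y) -> G (c ^+ p * x, c * y),
      forall y, G (0, y) -> y = 0 & G (a, 1)].

Lemma good_graph0 : good_graph [set z | exists c, z = (c ^+ p * a, c)].
Proof.
split=> [x y x' y' [c [-> ->]] [c' [-> ->]]|c x y [c' [-> ->]]|y [c [/esym/eqP]]|].
- by exists (c + c'); rewrite pchar_exprD // mulrDl.
- by exists (c * c'); rewrite exprMn mulrA.
- by rewrite mulf_eq0 (negPf a0) orbF expf_eq0 p_gt0 => /eqP -> ->.
- by exists 1; rewrite expr1n mul1r.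
Qed.

(* A Zorn argument: K is a vector space over its subfield of p-th powers. *)
Lemma pinv_linear_functional : exists l : K -> K,
  [/\ forall x y, l (x + y) = l x + l y, forall c x, l (c ^+ p * x) = c * l x
    & l a = 1].
Proof.
pose P (G : set (K * K)) := G = set0 \/ good_graph G.
have [|G [PG maxG]] := @Zorn_bigcup _ P.
  move=> C CP tot; have [[G0 [CG0 G0n]]|none] :=
      pselect (exists G, C G /\ good_graph G); last first.
    left; apply/seteqP; split=> // z [G CG Gz].
    have [G0|gG] := CP _ CG; first by move: Gz; rewrite G0.
    by case: none; exists G.
  right; have good G z : C G -> G z -> good_graph G.
    by move=> CG Gz; have [G0'|//] := CP _ CG; move: Gz; rewrite G0'.
  split=> [x y x' y' [G CG Gx] [G' CG' Gx']|c x y [G CG Gx]|y [G CG Gx]|].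
  - have [GG'|GG'] := tot _ _ CG CG'.
      exists G' => //; have [add _ _ _] := good _ _ CG' Gx'.
      exact: add (GG' _ Gx) Gx'.
    exists G => //; have [add _ _ _] := good _ _ CG Gx.
    exact: add Gx (GG' _ Gx').
  - by exists G => //; have [_ sc _ _] := good _ _ CG Gx; apply: sc.
  - by have [_ _ fn _] := good _ _ CG Gx; apply: fn.
  - by exists G0 => //; case: G0n.
have gG : good_graph G.
  case: PG => // G0; case: (maxG [set z | exists c, z = (c ^+ p * a, c)]%classic).
    rewrite G0 properEneq; split=> //; apply/eqP => /esym e.
    have : [set z | exists c, z = (c ^+ p * a, c)]%classic (1 ^+ p * a, 1).
      by exists 1.
    by rewrite e.
  by right; apply: good_graph0.
have [add sc fn Ga] := gG.
have G00 : G (0, 0) by have := sc 0 _ _ Ga; rewrite expf0p !mul0r.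
have tot x : exists y, G (x, y).
  apply: contrapT => nx.
  pose G' := [set z | exists u v c, G (u, v) /\ z = (u + c ^+ p * x, v)]%classic.
  have GG' : (G `<=` G')%classic.
    by move=> [u v] Guv; exists u, v, 0; rewrite expf0p mul0r addr0.
  apply: (maxG G').
    split=> // G'G; apply: nx; exists 0; apply: G'G.
    by exists 0, 0, 1; rewrite expr1n mul1r add0r.
  right; split.
  - move=> _ _ _ _ [u [v [c [Guv [-> ->]]]]] [u' [v' [c' [Guv' [-> ->]]]]].
    exists (u + u'), (v + v'), (c + c'); split; first exact: add.
    by rewrite pchar_exprD // mulrDl addrACA.
  - move=> d _ _ [u [v [c [Guv [-> ->]]]]].
    exists (d ^+ p * u), (d * v), (d * c); split; first exact: sc.
    by rewrite mulrDr mulrA exprMn.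
  - move=> y [u [v [c [Guv [/esym/eqP uc ->]]]]].
    have [c0|c0] := eqVneq c 0.
      by move: uc Guv; rewrite c0 expf0p mul0r addr0 => /eqP ->; apply: fn.
    case: nx; exists ((- c^-1) * v).
    have -> : x = (- c^-1) ^+ p * u.
      move: uc; rewrite addr_eq0 => /eqP ->; rewrite pchar_exprN // mulrNN.
      by rewrite mulrA -exprMn mulVf // expr1n mul1r.
    exact: sc.
  - exact: GG'.
have [l lG] := choice tot.
have uniq x y y' : G (x, y) -> G (x, y') -> y = y'.
  move=> Gy Gy'; apply/eqP; rewrite -subr_eq0; apply/eqP/fn.
  have := sc (-1) _ _ Gy'; rewrite pchar_exprN // expr1n !mulN1r.
  by move/(add _ _ _ _ Gy); rewrite subrr.
exists l; split=> [x y|c x|]; apply: uniq (lG _) _ => //.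
  exact: add.
exact: sc.
Qed.

End Functional.

Section Operator.
Variable l : K -> K.
Hypothesis lD : forall x y, l (x + y) = l x + l y.
Hypothesis lZ : forall c x, l (c ^+ p * x) = c * l x.
Variable r : nat -> nat.
Hypothesis rp : forall j, (r j < p)%N.

Definition lsub_fun (F G : fieldType) (g : F -> G) (s : nat) (f : laurent F) :=
  fun m : int => if f (p%:Z * m + s%:Z) == 0 then 0 else g (f (p%:Z * m + s%:Z)).

Lemma lsub_pred (F G : fieldType) (g : F -> G) s f :
  lsub_fun g (r s) f \in @laurent_pred G.
Proof.
have [a fa] := lcoefP f; apply/asboolP; exists (- `|a|%N%:Z - 1) => m ma.
rewrite /lsub_fun fa ?eqxx //; have := rp s; nia.
Qed.

Definition lsub (F G : fieldType) (g : F -> G) s f : laurent G :=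
  Laurent (lsub_pred g s f).

Lemma lcoef_lsub (F G : fieldType) (g : F -> G) s f m : g 0 = 0 ->
  lsub g s f m = g (f (p%:Z * m + (r s)%:Z)).
Proof. by move=> g0 /=; rewrite /lsub_fun; case: eqP => // ->. Qed.

(* sum a_i x^i is sent to sum l(a_(p i + r)) x^i. *)
Fixpoint cartier k : lseries K k -> lseries K k :=
  match k return lseries K k -> lseries K k with
  | 0 => l
  | k'.+1 => fun F : laurent (lseries K k') => lsub (@cartier k') k' F
  end.

Lemma cartier0 k : cartier (0 : lseries K k) = 0.
Proof.
elim: k => [|k IH]; last by apply: lcoef_inj => m; rewrite [LHS]lcoef_lsub.
by have := lZ 0 0; rewrite mulr0 mul0r.
Qed.

Lemma cartierS k (F : laurent (lseries K k)) m :
  (cartier (F : lseries K k.+1) : laurent _) m =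
  cartier (F (p%:Z * m + (r k)%:Z)).
Proof. by rewrite [LHS]lcoef_lsub //; apply: cartier0. Qed.

Lemma cartierD k (F G : lseries K k) : cartier (F + G) = cartier F + cartier G.
Proof.
elim: k F G => [|k IH] F G; first exact: lD.
by apply: lcoef_inj => m; rewrite lcoefD !cartierS -IH.
Qed.

Lemma cf_cartier k (F : lseries K k) i :
  cf (cartier F) i = l (cf F (fun j => p%:Z * i j + (r j)%:Z)).
Proof. by elim: k F => [//|k IH] F; rewrite cfS cartierS IH. Qed.

Lemma lseries_pchar k : p \in [pchar (lseries K k)].
Proof. exact: (rmorph_pchar (lseriesC K k)). Qed.

Lemma cartierM k (u v : lseries K k) : cartier (u ^+ p * v) = u * cartier v.
Proof.
elim: k u v => [|k IH] u v; first exact: lZ.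
pose u' : laurent (lseries K k) := u; pose v' : laurent (lseries K k) := v.
pose cv : laurent (lseries K k) := cartier v.
have monom c m : cartier (lmonom c m ^+ p * v' : lseries K k.+1) = lmonom c m * cv.
  apply: lcoef_inj => i; rewrite cartierS lmonomX !lcoef_monomM IH cartierS.
  by congr (_ * cartier (v' _)); ring.
have add (x y : lseries K k.+1) :
    cartier ((x + y) ^+ p * v) = cartier (x ^+ p * v) + cartier (y ^+ p * v).
  by rewrite (pchar_exprD _ _ (lseries_pchar k.+1)) mulrDl cartierD.
have [a ua] := lcoefP u'; have [b vb] := lcoefP v'; have [d cd] := lcoefP cv.
apply: lcoef_inj => i.
pose n := (`|(i - d - a)%R|%N + `|(p%:Z * i + (r k)%:Z - b)%R|%N + `|a|%N).+1.
have [g ga ug] := laurent_split n ua.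
rewrite [u in LHS]ug [u in RHS]ug [X in lcoef X i]add mulrDl !lcoefD.
congr (_ + _); last first.
  rewrite (vanish_below_mul ga cd); last by rewrite /n; lia.
  rewrite cartierS (vanish_below_mul (@vanish_below_exp _ _ _ p ga) vb) ?cartier0 //.
  rewrite /n; have := rp k; nia.
congr (lcoef _ i).
elim: {n ga ug}(n) => [|n IHn].
  by rewrite big_ord0 expf0p !mul0r cartier0.
rewrite big_ord_recr mulrDl -IHn; apply: etrans (add _ _) _.
by congr (_ + _); apply: monom.
Qed.

End Operator.
End Cartier.

Section Separability.
Local Open Scope ring_scope.
Variable K : fieldType.

Lemma cf_monomial k c (m : 'X_{1..k}) i :
  cf (mpoly_lseries (c *: 'X_[m] : {mpoly K[k]})) i =
  if [forall j : 'I_k, i j == (m j)%:Z] then c else 0.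
Proof.
rewrite /mpoly_lseries mmapZ mmapX /mmap1.
rewrite -(@lseries_coefE _ _ _ (\row_j i j)); last by move=> j; rewrite mxE.
rewrite lseries_coef_monom; congr (if _ then _ else _).
by apply: eq_forallb => j; rewrite mxE.
Qed.

Lemma cf_mpoly k (p : {mpoly K[k]}) (m : 'X_{1..k}) (i : nat -> int) :
  (forall j : 'I_k, i j = (m j)%:Z) -> cf (mpoly_lseries p) i = p@_m.
Proof.
move=> im; rewrite -lseries_coef_mpoly; apply/esym/lseries_coefE => j.
by rewrite mxE im.
Qed.

Section Char.
Variable p : nat.
Hypothesis pK : p \in [pchar K].
Variable l : K -> K.
Hypothesis lD : forall x y, l (x + y) = l x + l y.
Hypothesis lZ : forall c x, l (c ^+ p * x) = c * l x.
Variable r : nat -> nat.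
Hypothesis rp : forall j, (r j < p)%N.

Let l0 : l 0 = 0.
Proof. by have := lZ 0 0; rewrite mulr0 mul0r. Qed.

Lemma cartier_mpoly k (a : {mpoly K[k]}) N : mdeg_le a N ->
  exists2 a' : {mpoly K[k]}, mdeg_le a' N &
    cartier pK l rp (mpoly_lseries a) = mpoly_lseries a'.
Proof.
move=> da; have p0 : (0 < p)%N by apply/prime_gt0/(pcharf_prime pK).
pose mm (m : 'X_{1..k}) := [multinom (m i %/ p)%N | i < k].
pose c (m : 'X_{1..k}) : {mpoly K[k]} :=
  if [forall j : 'I_k, (m j %% p)%N == r j] then l a@_m *: 'X_[mm m] else 0.
exists (\sum_(m <- msupp a) c m).
  rewrite big_seq; apply: mdeg_le_sum => m; rewrite mcoeff_msupp.
  move=> /(mdeg_le_mcoeff da) mN; rewrite /c; case: ifP => _; last exact: mdeg_le0.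
  apply: leq_trans (msizeZ_le _ _) _; rewrite msizeX ltnS; apply: leq_trans mN.
  by rewrite !mdegE; apply: leq_sum => i _; rewrite mnmE leq_div.
rewrite [in LHS](mpolyE a) !raddf_sum.
rewrite (big_morph (cartier pK l rp (k := k)) (cartierD pK lD lZ rp (k := k))
  (cartier0 pK lZ rp k)).
apply: eq_bigr => m _; apply: cf_inj => i; rewrite cf_cartier // [X in l X]cf_monomial.
have eqP' (j : 'I_k) : (p%:Z * i j + (r j)%:Z == (m j)%:Z) =
    ((m j %% p)%N == r j) && (i j == (m j %/ p)%N%:Z).
  have mE := divn_eq (m j) p; have mp := ltn_pmod (m j) p0; have rj := rp j.
  move: (m j %/ p)%N (m j %% p)%N mE mp => u v -> vp.
  apply/eqP/andP => [h|[/eqP -> /eqP ->]]; last by lia.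
  have iu : i j = u%:Z by nia.
  by split; apply/eqP => //; move: h; rewrite iu; lia.
rewrite /c; have [mr|mr] := boolP [forall j : 'I_k, (m j %% p)%N == r j].
  rewrite [RHS]cf_monomial (fun_if l) l0; congr (if _ then _ else _).
  apply: eq_forallb => j; rewrite eqP' (forallP mr j) mnmE //.
rewrite [in RHS]raddf0 cf0 ifF ?l0 //; apply/negbTE.
apply: contra mr => /forallP h; apply/forallP => j.
by have := h j; rewrite eqP' => /andP[].
Qed.

End Char.

(* If an annihilator of least degree has zero derivative, it is a polynomial in
   Y^p, and a Cartier operator turns it into an annihilator of smaller degree. *)
Lemma alg_separable k h (f : lseries K k) : alg h f ->
  exists P : {poly {mpoly K[k]}},
    [/\ (size P <= h.+1)%N, forall j, mdeg_le P`_j h,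
        (map_poly (@mpoly_lseries K k) P).[f] = 0
      & (map_poly (@mpoly_lseries K k) P)^`().[f] != 0].
Proof.
move=> ah.
pose ann s := `[< exists P : {poly {mpoly K[k]}},
    [/\ P != 0, size P = s, forall j, mdeg_le P`_j h
      & (map_poly (@mpoly_lseries K k) P).[f] = 0] >].
have [s0 s0h sann] : exists2 s, (s <= h.+1)%N & ann s.
  by have [P [P0 sP dP Pf]] := ah; exists (size P) => //; apply/asboolP; exists P.
case: (ex_minnP (ex_intro ann s0 sann)) => s /asboolP[P [P0 sP dP Pf]] mins.
have sh : (s <= h.+1)%N by apply: leq_trans s0h; apply: mins.
have mphi_eq0 : forall Q : {poly {mpoly K[k]}},
    map_poly (@mpoly_lseries K k) Q = 0 -> Q = 0.
  move=> Q /polyP Q0; apply/polyP => j; apply: (@mpoly_lseries_inj K k).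
  by have := Q0 j; rewrite coef_map !coef0 rmorph0.
exists P; split=> //; first by rewrite sP.
apply/negP => /eqP P'f.
have P'0 : P^`() = 0.
  apply/eqP; apply: contraT => P'n0.
  have : ann (size P^`()).
    apply/asboolP; exists P^`(); split=> //; last by rewrite -deriv_map.
    by move=> j; rewrite coef_deriv; apply: mdeg_le_mulrn.
  move/mins; rewrite leqNgt -sP; case/negP; exact: lt_size_deriv.
have Pj j : P`_j.+1 *+ j.+1 = 0 by rewrite -coef_deriv P'0 coef0.
have [j Pjn0] : exists j, P`_j.+1 != 0.
  apply: contrapT => nj; case/eqP: P0.
  have PC : P = (P`_0)%:P.
    apply/polyP => -[|j]; rewrite coefC //=; apply/eqP; apply: contrapT => /negP Pj'.
    by apply: nj; exists j.
  move: Pf; rewrite PC map_polyC hornerC /= => /eqP.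
  by rewrite mpoly_lseries_eq0 => /eqP ->.
have [p pK] : exists p, p \in [pchar K].
  apply: (@natf0_pchar _ j.+1) => //; apply: contraNT Pjn0 => jn0.
  have := Pj j; rewrite -mulr_natr -mpolyC_nat => /eqP.
  by rewrite mulf_eq0 mpolyC_eq0 (negPf jn0) orbF.
have p0 : (0 < p)%N by apply/prime_gt0/(pcharf_prime pK).
have p1 : (1 < p)%N by apply/prime_gt1/(pcharf_prime pK).
have pP i : ~~ (p %| i)%N -> P`_i = 0.
  case: i => [|i]; rewrite ?dvdn0 // => npi; apply/eqP.
  have := Pj i; rewrite -mulr_natr -mpolyC_nat => /eqP.
  by rewrite mulf_eq0 mpolyC_eq0 -(dvdn_pcharf pK) (negPf npi) orbF.
have [j1 j1E] : exists j1, j.+1 = (j1 * p)%N.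
  by apply/dvdnP; apply: contraNT Pjn0 => /pP ->.
have [m am] : exists m, P`_j.+1@_m != 0.
  apply: contrapT => nm; case/eqP: Pjn0; apply/mpolyP => m; rewrite mcoeff0.
  by apply/eqP; apply: contrapT => /negP Pm; apply: nm; exists m.
have [l [lD lZ la]] := pinv_linear_functional pK am.
pose r i := if insub i is Some o then (m (o : 'I_k) %% p)%N else 0%N.
have rp i : (r i < p)%N by rewrite /r; case: insub => // o; apply: ltn_pmod.
have [b bP] : exists b : nat -> {mpoly K[k]}, forall i, mdeg_le (b i) h /\
    cartier pK l rp (mpoly_lseries P`_(i * p)) = mpoly_lseries (b i).
  suff /choice [b bP] : forall i, exists b, mdeg_le b h /\
    cartier pK l rp (mpoly_lseries P`_(i * p)) = mpoly_lseries b by exists b.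
  by move=> i; have [b] := cartier_mpoly pK lD lZ rp (dP (i * p)%N); exists b.
pose s' := (s.-1 %/ p).+1.
have s1 : (1 < s)%N.
  rewrite ltnNge -sP; apply: contra Pjn0 => sP1.
  by rewrite nth_default // (leq_trans sP1).
have ss : (s' < s)%N.
  by rewrite /s'; have := ltn_Pdiv p1 (_ : (0 < s.-1)%N); lia.
have pIs i : (s' <= i)%N -> P`_(i * p) = 0.
  rewrite /s' => si; rewrite nth_default // sP.
  by move: si; rewrite ltn_divLR //; lia.
pose Q : {poly {mpoly K[k]}} := \poly_(i < s') b i.
suff : ann (size Q).
  by move/mins; rewrite leqNgt (leq_trans _ ss) // ltnS size_poly.
apply/asboolP; exists Q; split=> //.
- apply/eqP => Q0; have bj1 : b j1 != 0.
    rewrite -mpoly_lseries_eq0 -(bP j1).2 -j1E.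
    apply/eqP => c0; have := oner_neq0 K; rewrite -la; case/eqP.
    pose i0 (i : nat) : int :=
      if insub i is Some o then (m (o : 'I_k) %/ p)%N%:Z else 0.
    have := cf_cartier pK lZ rp (mpoly_lseries P`_j.+1) i0.
    rewrite c0 cf0 (@cf_mpoly _ _ m) // => i.
    rewrite /i0 /r valK; have := divn_eq (m i) p; lia.
  have j1s : (j1 < s')%N.
    by rewrite ltnNge; apply: contra Pjn0 => /pIs; rewrite j1E => ->.
  have := congr1 (fun R : {poly _} => R`_j1) Q0.
  by rewrite coef_poly j1s coef0; apply/eqP.
- by move=> i; rewrite coef_poly; case: ifP => _; [apply: (bP i).1|apply: mdeg_le0].
rewrite (@horner_coef_wide _ s'); last first.
  by apply: leq_trans (size_poly _ _) (size_poly _ _).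
have := congr1 (cartier pK l rp (k := k)) Pf; rewrite (cartier0 pK lZ rp k) => cP.
rewrite -[RHS]cP {cP}.
have PE : (map_poly (@mpoly_lseries K k) P).[f] =
    \sum_(i < s') mpoly_lseries P`_(i * p) * (f ^+ i) ^+ p.
  rewrite (@horner_coef_wide _ (s' * p)); last first.
    apply: leq_trans (size_poly _ _) _; rewrite sP /s'.
    by have := ltn_ceil s.-1 p0; lia.
  rewrite -(big_mkord xpredT (fun i => (map_poly (@mpoly_lseries K k) P)`_i * f ^+ i)).
  rewrite big_nat_mul big_mkord; apply: eq_bigr => i _.
  rewrite big_ltn ?ltn_pmul2r // big_nat big1 ?addr0 => [|e /andP[ie ei]].
    by rewrite [LHS]addr0 coef_map exprM.
  rewrite coef_map pP; first by rewrite raddf0 mul0r.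
  apply/negP => /dvdnP[d eE].
  by move: ie ei; rewrite eE !ltn_pmul2r //; lia.
rewrite PE (big_morph (cartier pK l rp (k := k)) (cartierD pK lD lZ rp (k := k))
  (cartier0 pK lZ rp k)).
apply: eq_bigr => i _; rewrite coef_map /= coef_poly ltn_ord -(bP i).2.
by rewrite [in RHS]mulrC (cartierM pK lD lZ) mulrC.
Qed.

End Separability.

(** * Gauss's lemma and heights *)

Section Factorial.
Local Open Scope ring_scope.

Definition divides (R : nzRingType) (a b : R) := exists c, b = c * a.

Definition prime_elt (R : idomainType) (p : R) :=
  [/\ p != 0, p \isn't a GRing.unit &
      forall a b, divides p (a * b) -> divides p a \/ divides p b].

Definition factorial (R : idomainType) := forall c : R, c != 0 ->
  exists (u : R) (s : seq R), [/\ u \is a GRing.unit,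
    forall p, p \in s -> prime_elt p & c = u * \prod_(p <- s) p].

Section Polynomials.
Variable R : idomainType.

Lemma prime_assoc (p x : R) : prime_elt p -> prime_elt x -> divides p x ->
  divides x p.
Proof.
move=> [p0 pu pp] [x0 xu xp] [v xE].
have /xp[[w vE]|//] : divides x (v * p) by rewrite -xE; exists 1; rewrite mul1r.
case/negP: pu; apply/unitrPr; exists w.
by apply: (mulIf x0); rewrite mul1r [RHS]xE vE; ring.
Qed.

Lemma divides_polyC (p : R) (F : {poly R}) :
  divides p%:P F <-> forall i, divides p F`_i.
Proof.
split=> [[G ->] i|pF]; first by exists G`_i; rewrite coefMC.
have [g gP] := choice pF.
exists (\poly_(i < size F) g i); apply/polyP => i; rewrite coefMC coef_poly.
by case: ltnP => [_|Fi]; rewrite ?mul0r //; apply/gP || rewrite nth_default.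
Qed.

Lemma divides_sum (p : R) I (r : seq I) (P : pred I) (F : I -> R) :
  (forall i, P i -> divides p (F i)) -> divides p (\sum_(i <- r | P i) F i).
Proof.
move=> pF; elim/big_rec: _ => [|i x Pi [c ->]]; first by exists 0; rewrite mul0r.
by have [d ->] := pF i Pi; exists (d + c); rewrite mulrDl.
Qed.

Lemma prime_polyC (p : R) : prime_elt p -> prime_elt (p%:P : {poly R}).
Proof.
move=> [p0 pu pp]; split; first by rewrite polyC_eq0.
  apply: contra pu => /unitrPr[G pG]; apply/unitrPr; exists G`_0.
  by rewrite -coefCM pG coef1.
move=> A B pAB; apply: contrapT => /not_orP[nA nB].
have least (F : {poly R}) : ~ divides p%:P F ->
    exists2 i, ~ divides p F`_i & forall j, (j < i)%N -> divides p F`_j.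
  move=> nF; pose bad i := ~~ `[< divides p F`_i >].
  have [i bi] : exists i, bad i.
    apply: contrapT => nb; apply/nF/divides_polyC => i.
    apply: contrapT => ni; apply: nb; exists i; exact/asboolPn.
  case: (ex_minnP (ex_intro bad i bi)) => {i bi} i /asboolPn ni mini.
  exists i => // j ji; apply: contrapT => nj.
  by have /mini := introT (asboolPn _) nj; rewrite leqNgt ji.
have [i ni Ai] := least A nA; have [j nj Bj] := least B nB.
have [c cE] := (divides_polyC p (A * B)).1 pAB (i + j)%N.
have ij : (i < (i + j).+1)%N by rewrite ltnS leq_addr.
move: cE; rewrite coefM (bigD1 (Ordinal ij)) //= addKn; set S := \sum_(_ | _) _.
move=> cE; have [d SE] : divides p S.
  apply: divides_sum => k kne; have [ki|ki|ki] := ltngtP k i.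
  - by have [x ->] := Ai _ ki; exists (x * B`_(i + j - k)); rewrite mulrAC.
  - have [|x ->] := Bj (i + j - k)%N; first by have := ltn_ord k; lia.
    by exists (A`_k * x); rewrite mulrA.
  - by case/eqP: kne; apply: val_inj.
have /pp[] // : divides p (A`_i * B`_j).
by exists (c - d); rewrite mulrBl -cE -SE addrK.
Qed.

Lemma gauss_cancel_primes (s : seq R) (u : R) (F G H : {poly R}) :
    u \is a GRing.unit -> (forall p, p \in s -> prime_elt p) ->
    (u * \prod_(p <- s) p) *: F = G * H ->
  exists (a b : R) (G' H' : {poly R}),
    [/\ a != 0, b != 0, F = G' * H', G = a *: G' & H = b *: H'].
Proof.
move=> uu; elim: s G H => [|p s IH] G H ps.
  rewrite big_nil mulr1 => uF; exists u, 1, (u^-1 *: G), H.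
  rewrite oner_neq0 scale1r scalerA mulrV // scale1r; split=> //.
    by apply: contraTneq uu => ->; rewrite unitr0.
  by rewrite -scalerAl -uF scalerA mulVr // scale1r.
rewrite big_cons mulrCA => uF.
have pp : prime_elt p by apply: ps; rewrite inE eqxx.
have [p0 _ _] := pp; have [_ _ ppC] := prime_polyC pp.
have ps' x : x \in s -> prime_elt x by move=> xs; apply: ps; rewrite inE xs orbT.
have : divides p%:P (G * H).
  by rewrite -uF -scalerA; exists ((u * \prod_(p <- s) p) *: F); rewrite -mul_polyC mulrC.
have pI : injective (fun X : {poly R} => p *: X).
  by move=> X Y; rewrite -!mul_polyC; apply: mulfI; rewrite polyC_eq0.
case/ppC => -[X XE].
  have [|a [b [G' [H' [a0 b0 FE XE' HE]]]]] := IH X H ps'.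
    by apply: pI; rewrite /= scalerA uF XE mulrC -mul_polyC; ring.
  exists (p * a), b, G', H'; split=> //; first by rewrite mulf_neq0.
  by rewrite XE mulrC mul_polyC XE' scalerA.
have [|a [b [G' [H' [a0 b0 FE GE XE']]]]] := IH G X ps'.
  by apply: pI; rewrite /= scalerA uF XE -!mul_polyC; ring.
exists a, (p * b), G', H'; split=> //; first by rewrite mulf_neq0.
by rewrite XE mulrC mul_polyC XE' scalerA.
Qed.

Hypothesis factR : factorial R.

Lemma gauss_cancel (c : R) (F G H : {poly R}) : c != 0 -> c *: F = G * H ->
  exists (a b : R) (G' H' : {poly R}),
    [/\ a != 0, b != 0, F = G' * H', G = a *: G' & H = b *: H'].
Proof.
move=> c0; have [u [s [uu ps ->]]] := factR c0.
exact: gauss_cancel_primes.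
Qed.

Definition primitive_poly (F : {poly R}) :=
  forall p, prime_elt p -> ~ divides p%:P F.

Lemma primitive_part (F : {poly R}) : F != 0 ->
  exists (c : R) (G : {poly R}), [/\ c != 0, F = c *: G & primitive_poly G].
Proof.
move=> F0; have [u [s [uu ps lE]]] : exists (u : R) (s : seq R),
    [/\ u \is a GRing.unit, forall p, p \in s -> prime_elt p
      & lead_coef F = u * \prod_(p <- s) p].
  by apply: factR; rewrite lead_coef_eq0.
have [n sn] : exists n, (size s <= n)%N by exists (size s).
elim: n F F0 u s uu ps lE sn => [|n IH] F F0 u s uu ps lE sn;
  (have [prim|] := pselect (primitive_poly F);
    [by exists 1, F; rewrite oner_neq0 scale1r|]);
  move=> /existsNP[p] /not_implyP[pp /contrapT pF];
  have [p0 pu ppr] := pp; have [G FE] := pF.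
  move: sn lE; rewrite leqn0 => /nilP ->; rewrite big_nil mulr1 => lE.
  case/negP: pu; apply/unitrPr; exists (u^-1 * lead_coef G).
  have : lead_coef F = lead_coef G * p by rewrite FE lead_coefM lead_coefC.
  by rewrite lE mulrCA [p * _]mulrC => <-; rewrite mulVr.
have lG : lead_coef F = lead_coef G * p by rewrite FE lead_coefM lead_coefC.
have [x xs px] : exists2 x, x \in s & divides p x.
  have : divides p (u * \prod_(p <- s) p) by rewrite -lE lG; exists (lead_coef G).
  case/ppr => [[w wE]|].
    by case/negP: pu; move: uu; rewrite wE unitrM => /andP[].
  elim: (s) => [|x t IHt]; rewrite ?big_nil ?big_cons.
    by case=> w w1; case/negP: pu; apply/unitrPr; exists w; rewrite mulrC.
  case/ppr => [px|/IHt[z zt pz]]; first by exists x; rewrite ?inE ?eqxx.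
  by exists z; rewrite // inE zt orbT.
have [v xE] := px; have [x0 xu _] := ps x xs.
have [w pE] := prime_assoc pp (ps x xs) px.
have vw : v * w = 1.
  by apply: (mulIf x0); rewrite mul1r -mulrA -pE -xE.
have uv : v \is a GRing.unit by apply/unitrPr; exists w.
have lG' : lead_coef G = (u * v) * \prod_(p <- rem x s) p.
  have sE : \prod_(p <- s) p = x * \prod_(p <- rem x s) p.
    by rewrite (perm_big _ (perm_to_rem xs)) big_cons.
  by apply: (mulIf p0); rewrite -lG lE sE; set Q := \prod_(_ <- _) _; rewrite xE; ring.
have G0 : G != 0 by apply: contraNneq F0 => G0; rewrite FE G0 mul0r.
have [|||c [G' [c0 GE prim]]] := IH G G0 (u * v) (rem x s) _ _ lG'.
- by rewrite unitrM uu.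
- by move=> z /mem_rem; apply: ps.
- by rewrite size_rem //; case: (s) sn.
exists (p * c), G'; split=> //; first by rewrite mulf_neq0.
by rewrite FE GE mulrC mul_polyC scalerA.
Qed.

Lemma divides_primitive (c : R) (F X q : {poly R}) : F != 0 ->
  primitive_poly F -> c != 0 -> c *: X = q * F -> divides F X.
Proof.
move=> F0 prim c0 /(gauss_cancel c0)[a [b [q' [F' [a0 b0 -> _ FE]]]]].
suff bu : b \is a GRing.unit.
  by exists (b^-1 *: q'); rewrite FE -scalerAl -scalerAr scalerA mulVr // scale1r.
have [u [[|p s] [uu ps bE]]] := factR b0; first by rewrite bE big_nil mulr1.
case: (prim p); first by apply: ps; rewrite inE eqxx.
exists ((u * \prod_(x <- s) x) *: F').
by rewrite FE bE big_cons -!mul_polyC !rmorphM /=; ring.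
Qed.

Lemma unit_polyC (u : R) : u \is a GRing.unit -> (u%:P : {poly R}) \is a GRing.unit.
Proof. exact: rmorph_unit. Qed.

Lemma prime_primitive (F : {poly R}) : primitive_poly F -> (1 < size F)%N ->
    (forall G H, F = G * H -> (size G <= 1)%N \/ (size H <= 1)%N) ->
  prime_elt F.
Proof.
move=> prim sF irr.
have F0 : F != 0 by rewrite -size_poly_gt0; apply: leq_trans sF.
split=> //.
  apply/negP => /unitrPr[G FG].
  have G0 : G != 0.
    by apply/eqP => G0; move/esym/eqP: FG; rewrite G0 mulr0 oner_eq0.
  have := congr1 (fun X : {poly R} => size X) FG.
  have := size_poly_gt0 G; rewrite G0 size_mul // size_poly1; lia.
move=> A B [C FAB]; pose D := Pdiv.Idomain.gcdp A F.
have /Pdiv.Idomain.dvdpP[[c q] /= c0 cF] := Pdiv.Idomain.dvdp_gcdr A F.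
have D0 : D != 0.
  apply: contraNneq F0 => D0; move: cF; rewrite -/D D0 mulr0 => /eqP.
  by rewrite -mul_polyC mulf_eq0 polyC_eq0 (negPf c0).
have [a [b [q' [D' [a0 b0 FE qE DE]]]]] := gauss_cancel c0 cF.
have sD : size D = size D' by rewrite /D DE size_scale.
have [sq|sD1] := irr _ _ FE.
  left; have /Pdiv.Idomain.dvdpP[[c' r] /= c'0 c'A] := Pdiv.Idomain.dvdp_gcdl A F.
  have q'0 : q' != 0 by apply: contraNneq F0 => q'0; rewrite FE q'0 mul0r.
  have [e q'E] : exists e, q' = e%:P by exists q'`_0; apply: size1_polyC.
  apply: (@divides_primitive (c' * e) _ _ (b *: r)) => //.
    by rewrite mulf_neq0 //; apply: contraNneq q'0 => e0; rewrite q'E e0.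
  rewrite mulrC -scalerA c'A DE FE q'E -!mul_polyC; ring.
right; have cop : Pdiv.Idomain.coprimep F A.
  rewrite Pdiv.Idomain.coprimep_sym Pdiv.Idomain.coprimep_def -/D.
  by rewrite eqn_leq sD sD1 -sD size_poly_gt0.
have : Pdiv.Idomain.dvdp F (A * B).
  by apply/Pdiv.Idomain.dvdpP; exists (1, C); rewrite ?oner_neq0 //= scale1r.
rewrite Pdiv.Idomain.Gauss_dvdpr // => /Pdiv.Idomain.dvdpP[[c' r] /= c'0 c'B].
exact: divides_primitive c'B.
Qed.

Lemma factorial_poly : factorial {poly R}.
Proof.
move=> F F0; have [n sn] : exists n, (size F <= n)%N by exists (size F).
elim: n F F0 sn => [|n IH] F F0 sn.
  by move: F0; rewrite -size_poly_gt0; lia.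
have [[G [H [FE sG sH]]]|irr] := pselect (exists G H : {poly R},
    [/\ F = G * H, (1 < size G)%N & (1 < size H)%N]).
  have [G0 H0] : G != 0 /\ H != 0.
    by split; [apply: contraNneq F0|apply: contraNneq F0] => e;
      rewrite FE e ?mul0r ?mulr0.
  have sF : size F = (size G + size H).-1 by rewrite FE size_mul.
  have [||u [s [uu ps GE]]] := IH G => //; first by move: sn; rewrite sF; lia.
  have [||v [t [uv pt HE]]] := IH H => //; first by move: sn; rewrite sF; lia.
  exists (u * v), (s ++ t); split.
  - by rewrite unitrM uu.
  - by move=> p; rewrite mem_cat => /orP[/ps|/pt].
  - by rewrite FE GE HE big_cat /= mulrACA.
have [c [G [c0 FE prim]]] := primitive_part F0.
have [u [s [uu ps cE]]] := factR c0.
have cP : c%:P = u%:P * \prod_(p <- [seq x%:P | x <- s]) p :> {poly R}.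
  by rewrite cE rmorphM rmorph_prod big_map.
have psP p : p \in [seq x%:P | x <- s] -> prime_elt (p : {poly R}).
  by move=> /mapP[x /ps px ->]; apply: prime_polyC.
have sFG : size F = size G by rewrite FE size_scale.
have G0 : G != 0 by rewrite -size_poly_eq0 -sFG size_poly_eq0.
have [sG|sG] := leqP (size G) 1.
  have [e GE] : exists e, G = e%:P by exists G`_0; apply: size1_polyC.
  have e0 : e != 0 by apply: contraNneq G0 => e0; rewrite GE e0.
  have [v [t [uv pt eE]]] := factR e0.
  exists (u * v)%:P, [seq x%:P | x <- s ++ t]; split.
  - by apply: unit_polyC; rewrite unitrM uu.
  - by move=> p /mapP[x]; rewrite mem_cat => /orP[/ps|/pt] px ->; apply: prime_polyC.
  - have eP : e%:P = v%:P * \prod_(p <- [seq x%:P | x <- t]) p :> {poly R}.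
      by rewrite eE rmorphM rmorph_prod big_map.
    by rewrite map_cat big_cat /= FE -mul_polyC cP GE eP rmorphM; ring.
exists u%:P, (G :: [seq x%:P | x <- s]); split.
- exact: unit_polyC.
- move=> p; rewrite inE => /predU1P[->|/psP//]; apply: prime_primitive => //.
  move=> A B GE; apply: contrapT => /not_orP[/negP + /negP +].
  rewrite -!ltnNge => sA sB; apply: irr; exists (c *: A), B.
  by rewrite size_scale // -scalerAl -GE.
- by rewrite big_cons mulrCA -cP FE -mul_polyC mulrC.
Qed.

End Polynomials.

Lemma factorial_iso (R S : idomainType) (f : {rmorphism R -> S})
    (g : {rmorphism S -> R}) :
  cancel f g -> cancel g f -> factorial R -> factorial S.
Proof.
move=> fK gK factR c c0.
have [|u [s [uu ps cE]]] := factR (g c).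
  by apply: contraNneq c0 => gc0; rewrite -(gK c) gc0 rmorph0.
have div a b : divides (f a) b -> divides a (g b).
  by move=> [x ->]; exists (g x); rewrite rmorphM fK.
exists (f u), [seq f x | x <- s]; split; first exact: rmorph_unit.
- move=> _ /mapP[p /ps[p0 pu pp] ->]; split.
  + by apply: contraNneq p0 => fp0; rewrite -(fK p) fp0 rmorph0.
  + by apply: contra pu => fpu; rewrite -(fK p); apply: rmorph_unit.
  + move=> a b /div; rewrite rmorphM => /pp[] [x xE]; [left|right];
      by exists (f x); rewrite -[LHS]gK xE rmorphM.
- by rewrite -(gK c) cE rmorphM rmorph_prod big_map.
Qed.

Section Mpoly.
Variable K : fieldType.

Lemma factorial_mpoly0 : factorial {mpoly K[0]}.
Proof.
move=> c c0; exists c, [::]; rewrite big_nil mulr1; split=> //.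
have cE : c = (c@_0%MM)%:MP by apply/msize1_polyC; rewrite msizeE;
  apply/bigmax_leqP_seq => m _ _; rewrite mdegE big_ord0.
apply/unitrPr; exists (c@_0%MM)^-1%:MP.
rewrite {1}cE -mpolyCM mulfV ?mpolyC1 //.
by apply: contraNneq c0 => e; rewrite cE e mpolyC0.
Qed.

Variable n : nat.
Local Notation A := {mpoly K[n]}.

Definition multi (r : {poly A}) : {mpoly K[n.+1]} :=
  (map_poly (@mwiden n K) r).['X_ord_max].

Lemma multiD r s : multi (r + s) = multi r + multi s.
Proof. by rewrite /multi rmorphD hornerD. Qed.

Lemma multiM r s : multi (r * s) = multi r * multi s.
Proof. by rewrite /multi rmorphM hornerM. Qed.

Lemma multi_zmod : zmod_morphism multi.
Proof. by move=> r s; rewrite /multi rmorphB hornerD hornerN. Qed.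

Lemma multi_monoid : monoid_morphism multi.
Proof.
by split=> [|r s]; rewrite /multi ?rmorph1 ?hornerC // rmorphM hornerM.
Qed.

HB.instance Definition _ :=
  GRing.isZmodMorphism.Build {poly A} {mpoly K[n.+1]} multi multi_zmod.
HB.instance Definition _ :=
  GRing.isMonoidMorphism.Build {poly A} {mpoly K[n.+1]} multi multi_monoid.

Lemma muniXU i : muni ('X_i : {mpoly K[n.+1]}) =
  if unlift ord_max i is Some j then ('X_j)%:P else 'X.
Proof.
rewrite muniE msuppX big_seq1 mcoeffX eqxx scale1r.
case: (unliftP ord_max i) => [j ->|->].
  rewrite (_ : [multinom _ | _ < _] = U_(j)%MM).
    rewrite mnm1E (_ : _ == _ = false) ?scale1r; last first.
      by apply/negbTE; rewrite eq_sym neq_lift.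
    by rewrite -mul_polyC expr0 mulr1.
  apply/mnmP => l; rewrite mnmE !mnm1E; congr nat_of_bool.
  by rewrite -!val_eqE /= /bump leqNgt ltn_ord add0n.
rewrite mnm1E eqxx expr1 (_ : [multinom _ | _ < _] = 0%MM).
  by rewrite mpolyX0 scale1r.
apply/mnmP => l; rewrite mnmE mnm1E mnm0E -val_eqE /= gtn_eqF //.
Qed.

Lemma muniK : cancel (@muni n K) multi.
Proof.
elim/mpoly_ring_ind=> [c|i|p q Pp Pq|p q Pp Pq].
- by rewrite muniC /multi map_polyC hornerC /= mwidenC.
- rewrite muniXU; case: (unliftP ord_max i) => [j ->|->].
    rewrite /multi map_polyC hornerC /= mwidenX mnmwiden1.
    by congr 'X_[U_(_)]; apply: val_inj; rewrite /= /bump leqNgt ltn_ord.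
  by rewrite /multi map_polyX hornerX.
- by rewrite -[RHS](congr2 +%R Pp Pq) -multiD -muniD.
- by rewrite -[RHS](congr2 *%R Pp Pq) -multiM -muniM.
Qed.

Lemma muni_widen (a : A) : muni (mwiden a) = a%:P.
Proof.
elim/mpoly_ring_ind: a => [c|i|p q Pp Pq|p q Pp Pq].
- by rewrite mwidenC muniC.
- rewrite mwidenX mnmwiden1 muniXU.
  rewrite (_ : widen_ord _ i = lift ord_max i) ?liftK //.
  by apply: val_inj; rewrite [RHS]lift_max.
- by rewrite mwidenD muniD polyCD Pp Pq.
- by rewrite mwidenM muniM polyCM Pp Pq.
Qed.

Lemma multiK : cancel multi (@muni n K).
Proof.
move=> r; rewrite /multi horner_coef raddf_sum /= -[RHS]coefK poly_def.
rewrite size_map_inj_poly ?mwiden0 //; last exact: inj_mwiden.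
apply: eq_bigr => i _; rewrite coef_map /= [LHS]rmorphM rmorphXn /=.
by rewrite muni_widen muniXU unlift_none mul_polyC.
Qed.

End Mpoly.

Lemma factorial_mpoly (K : fieldType) n : factorial {mpoly K[n]}.
Proof.
elim: n => [|n IH]; first exact: factorial_mpoly0.
exact: (factorial_iso (@multiK K n) (@muniK K n) (factorial_poly IH)).
Qed.

End Factorial.

Section Height.
Local Open Scope ring_scope.
Variable K : fieldType.

Lemma mdeg_le_divisor k (G H : {poly {mpoly K[k]}}) h : G * H != 0 ->
  (forall j, mdeg_le (G * H)`_j h) -> forall j, mdeg_le H`_j h.
Proof.
rewrite mulf_eq0 negb_or => /andP[G0 H0] dGH.
(* The last coefficient of largest total degree, with its size. *)
have top (F : {poly {mpoly K[k]}}) : F != 0 -> exists i : nat,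
    [/\ F`_i != 0, forall j, (msize F`_j <= msize F`_i)%N
      & forall j, (i < j)%N -> (msize F`_j < msize F`_i)%N].
  move=> F0; pose M := (\max_(i < size F) msize F`_i)%N.
  have leM j : (msize F`_j <= M)%N.
    have [jF|Fj] := ltnP j (size F); last by rewrite nth_default ?msize0.
    exact: (@bigop.leq_bigmax 'I_(size F) (fun i => msize F`_i) (Ordinal jF)).
  pose P i := (i < size F)%N && (msize F`_i == M).
  have [i0 Pi0] : exists i, P i.
    have F1 : (0 < #|'I_(size F)|)%N by rewrite card_ord size_poly_gt0.
    have [i iM] := @bigop.eq_bigmax 'I_(size F) (fun i => msize F`_i) F1.
    by exists i; rewrite /P ltn_ord /M iM eqxx.
  have Pub i : P i -> (i <= size F)%N by move=> /andP[/ltnW].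
  case: (ex_maxnP (ex_intro P i0 Pi0) Pub) => i /andP[iF /eqP iM] maxi.
  exists i; rewrite iM; split=> // [|j ij].
    rewrite -msize_poly_eq0 iM; apply/eqP => M0; case/eqP: F0; apply/polyP => j.
    by apply/eqP; rewrite coef0 -msize_poly_eq0 -leqn0 -M0.
  have [jF|Fj] := ltnP j (size F).
    rewrite ltn_neqAle leM andbT; apply: contraL ij => jM.
    by rewrite -leqNgt maxi // /P jF.
  rewrite nth_default // msize0 lt0n; apply/eqP => M0; case/eqP: F0.
  by apply/polyP => l; apply/eqP; rewrite coef0 -msize_poly_eq0 -leqn0 -M0.
have [i [Gi Gm Gl]] := top _ G0; have [j [Hj Hm Hl]] := top _ H0.
suff dH : mdeg_le H`_j h by move=> l; apply: leq_trans (Hm l) dH.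
have := dGH (i + j)%N; rewrite /mdeg_le coefM.
have ij : (i < (i + j).+1)%N by rewrite ltnS leq_addr.
rewrite (bigD1 (Ordinal ij)) //= addKn; set S := \sum_(_ | _) _ => dS.
have SE : S = 0 \/ (msize S < msize (G`_i * H`_j))%N.
  have [->|S0] := eqVneq S 0; [by left|right].
  have sGH := msizeM Gi Hj; have := mpolySpred _ Gi; have := mpolySpred _ Hj.
  move=> sG sH; rewrite sGH -[X in (_ < X)%N]prednK; last first.
    by rewrite sG sH addSn addnS.
  rewrite ltnS; apply: leq_trans (msize_sum _ _ _) _.
  apply/bigmax_leqP => l lij.
  have [->|Gl0] := eqVneq G`_l 0; first by rewrite mul0r msize0.
  have [->|Hl0] := eqVneq H`_(i + j - l) 0; first by rewrite mulr0 msize0.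
  rewrite msizeM //; have := Gm l; have := Hm (i + j - l)%N.
  have sl : (msize G`_l < msize G`_i)%N \/ (msize H`_(i + j - l) < msize H`_j)%N.
    have [li|il|li] := ltngtP i l; first by left; apply: Gl.
      by right; apply: Hl; have := ltn_ord l; lia.
    by case/eqP: lij; apply: val_inj.
  have := mpolySpred _ Gl0; have := mpolySpred _ Hl0; move: sl sH sG.
  move: (msize G`_l) (msize G`_i) (msize H`_j) (msize H`_(i + j - l)).
  by move=> a b c d; case; lia.
have : (msize (G`_i * H`_j) <= h.+1)%N.
  rewrite leqNgt; apply/negP => hGH.
  case: SE => [S0|sS]; first by move: dS; rewrite S0 addr0 leqNgt hGH.
  have := msizeD_le (G`_i * H`_j + S) (- S); rewrite addrK mmeasureN leq_max.
  by rewrite [X in _ || X]leqNgt sS orbF => /leq_trans/(_ dS); rewrite leqNgt hGH.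
rewrite msizeM // (mpolySpred _ Gi) addSn /=.
by apply: leq_trans; apply: leq_addl.
Qed.

Lemma minpoly_annihilator k (f : lseries K k) d : algebraic_of_degree f d ->
  exists P : {poly {mpoly K[k]}}, [/\ P != 0, (size P <= d.+1)%N
    & (map_poly (@mpoly_lseries K k) P).[f] = 0].
Proof.
move=> [p [pmon _ /eqP pf] sp].
pose num i := \n_(repr p`_i); pose den i := \d_(repr p`_i).
have pE i : frac_lseries p`_i = mpoly_lseries (num i) / mpoly_lseries (den i) by [].
have den0 i : mpoly_lseries (den i) != 0 by apply: denom_lseries_neq0.
pose D := \prod_(i < d.+1) mpoly_lseries (den i).
pose c (i : 'I_d.+1) := num i * \prod_(j < d.+1 | j != i) den j.
have cE i : mpoly_lseries (c i) = D * frac_lseries p`_i.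
  have DE : D = mpoly_lseries (den i) * \prod_(j | j != i) mpoly_lseries (den j).
    by rewrite /D (bigD1 i).
  rewrite mpoly_lseriesM pE DE [RHS]mulrC mulrA divfK //.
  by congr (_ * _); apply: (rmorph_prod (@mpoly_lseries K k)).
pose P := \poly_(i < d.+1) c (inord i).
have Pi (i : 'I_d.+1) : P`_i = c i by rewrite coef_poly ltn_ord inord_val.
have D0 : D != 0 by apply/prodf_neq0.
have pd : frac_lseries p`_d = 1.
  have /monicP := pmon; rewrite lead_coefE sp /= => ->.
  exact: rmorph1.
exists P; split.
- apply: contraNneq D0 => P0; have := cE ord_max.
  by rewrite -Pi P0 coef0 rmorph0 /= pd mulr1 => <-.
- exact: size_poly.
rewrite (@horner_coef_wide _ d.+1); last first.
  by apply: leq_trans (size_poly _ _) (size_poly _ _).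
move: pf; rewrite (@horner_coef_wide _ d.+1); last first.
  by rewrite -sp; apply: size_poly.
move=> pf; rewrite -[RHS](mulr0 D) -[X in _ = D * X]pf mulr_sumr; apply: eq_bigr => i _.
rewrite !coef_map Pi /= cE; exact: esym (mulrA _ _ _).
Qed.

Lemma alg_of_height k (f : lseries K k) d h :
  algebraic_of_degree f d -> height_at_most f h -> alg (d + h) f.
Proof.
move=> fd [m [[P [P0 Pf] Pm] _] mh].
pose ann s := `[< exists P : {poly {mpoly K[k]}}, [/\ P != 0, size P = s
    & (map_poly (@mpoly_lseries K k) P).[f] = 0] >].
have [P1 [P10 sP1 P1f]] := minpoly_annihilator fd.
have a1 : ann (size P1) by apply/asboolP; exists P1.
case: (ex_minnP (ex_intro ann _ a1)) => s /asboolP[Q [Q0 sQ Qf]] mins.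
have sd : (s <= d.+1)%N by apply: leq_trans (mins _ a1) sP1.
have dP j : mdeg_le P`_j h.
  have [jP|Pj] := ltnP j (size P); last by rewrite nth_default //; apply: mdeg_le0.
  rewrite /mdeg_le; apply: (@leq_trans (msize P`_j).-1.+1); first exact: leqSpred.
  rewrite ltnS; apply: leq_trans mh; rewrite -Pm /max_coef_degree.
  exact: (@bigop.leq_bigmax 'I_(size P) (fun i => (msize P`_i).-1) (Ordinal jP)).
have := Pdiv.Idomain.divp_eq P Q; set c := _ ^+ _; set T := Pdiv.Idomain.divp P Q.
set U := Pdiv.Idomain.modp P Q => PE.
have U0 : U = 0.
  apply/eqP; apply: contraT => U0; have : ann (size U).
    apply/asboolP; exists U; split=> //.
    have := congr1 (fun X => (map_poly (@mpoly_lseries K k) X).[f]) PE.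
    rewrite /= map_polyZ hornerZ rmorphD rmorphM hornerD hornerM Qf mulr0 add0r.
    by move=> <-; move/eqP: Pf => ->; rewrite mulr0.
  move/mins; rewrite leqNgt -sQ; case/negP.
  exact: Pdiv.Idomain.ltn_modpN0.
move: PE; rewrite U0 addr0 => PE.
have c0 : c != 0 by rewrite expf_neq0 // lead_coef_eq0.
have [a [b [T' [Q' [a0 b0 PE' TE QE]]]]] := gauss_cancel (factorial_mpoly (n := k)) c0 PE.
exists Q'; split.
- by apply: contraNneq Q0 => Q'0; rewrite QE Q'0 scaler0.
- apply: (@leq_trans s); last by lia.
  by rewrite -sQ QE size_scale.
- move=> j; apply: (@mdeg_leW _ _ _ h); first exact: leq_addl.
  by apply: (@mdeg_le_divisor _ T'); rewrite -PE'.
have b0' : mpoly_lseries b != 0 by rewrite mpoly_lseries_eq0.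
by apply: (mulfI b0'); rewrite mulr0 -[RHS]Qf QE map_polyZ hornerZ.
Qed.

End Height.

(** * Orders and coefficients of algebraic series *)

Section Orders.
Local Open Scope ring_scope.
Variable F : fieldType.

Lemma laurent_order (f : laurent F) : f != 0 ->
  exists2 v, vanish_below f v & f v != 0.
Proof.
move=> f0; have [a fa] := lcoefP f.
have [i fi] : exists i : nat, f (a + i%:Z) != 0.
  apply: contrapT => nf; case/eqP: f0; apply: lcoef_inj => m.
  rewrite lcoef0; have [ma|am] := ltP m a; first exact: fa.
  apply/eqP; apply: contrapT => /negP fm; apply: nf; exists `|(m - a)%R|%N.
  by rewrite (_ : a + _ = m) //; lia.
case: (ex_minnP (ex_intro (fun i : nat => f (a + i%:Z) != 0) i fi)) => v fv minv.
exists (a + v%:Z) => // m mv; have [ma|am] := ltP m a; first exact: fa.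
apply/eqP; apply: contrapT => /negP fm.
have := minv `|(m - a)%R|%N; rewrite (_ : a + `|(m - a)%R|%N%:Z = m); last lia.
by move/(_ fm); lia.
Qed.

Lemma vanish_belowV (f : laurent F) v :
  vanish_below f v -> f v != 0 -> vanish_below (f^-1)%R (- v).
Proof.
move=> fv fv0; have f0 : f != 0.
  by apply: contraNneq fv0 => ->.
have [|w gw gw0] := @laurent_order f^-1; first by rewrite invr_eq0.
suff -> : - v = w by [].
have := lcoefM_lead fv gw; rewrite mulfV // lcoef1 => /eqP.
case: (eqVneq (v + w) 0) => [vw _|_]; first by lia.
by rewrite eq_sym mulf_eq0 (negPf fv0) (negPf gw0).
Qed.

Lemma vanish_below_sum I (r : seq I) (P : pred I) (f : I -> laurent F) a :
  (forall i, P i -> vanish_below (f i) a) ->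
  vanish_below (\sum_(i <- r | P i) f i) a.
Proof. by move=> fa m ma; rewrite lcoef_sum big1 // => i /fa ->. Qed.

Lemma vanish_below_Taylor (p : {poly laurent F}) (u d : laurent F) (N : nat) :
    (forall i, vanish_below p`_i 0) -> vanish_below u 0 ->
    vanish_below d N%:Z ->
  vanish_below (p.[u + d] - p.[u]) N%:Z.
Proof.
move=> p0 u0 dN; have pN k : vanish_below (p^`N(k)).[u] 0.
  rewrite horner_coef; apply: vanish_below_sum => i _.
  apply: vanish_below0_mul; last exact: vanish_belowXn.
  rewrite coef_nderivn -mulr_natl => m m0.
  rewrite (vanish_below0_mul _ (p0 _)) //.
  by rewrite -(rmorph_nat (@laurentC F)); apply: vanish_belowC.
have d0 : vanish_below d 0 by apply: vanish_belowW dN.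
rewrite nderiv_taylor; last exact: mulrC.
have [->|p_neq0] := eqVneq p 0.
  by rewrite size_poly0 big_ord0 horner0 subrr => m _; rewrite lcoef0.
rewrite -(prednK (_ : 0 < size p)%N) ?size_poly_gt0 // big_ord_recl.
rewrite nderivn0 expr0 mulr1 addrC addKr.
apply: vanish_below_sum => i _; rewrite lift0 exprS.
rewrite mulrCA -[N%:Z]addr0; apply: vanish_below_mul => //.
exact: vanish_below0_mul (pN _) (vanish_belowXn _ d0).
Qed.

End Orders.

Section Coefs.
Local Open Scope ring_scope.
Variable K : fieldType.

Definition alg_bound (r h d : nat) := (h ^ r + 2 * (h ^ r * (d * (r * h).+1)))%N.

Lemma alg_frame k h (s : seq (lseries K k)) d w : (0 < h)%N ->
    (forall v, v \in s -> alg h v) ->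
    (forall (I : finType) (e : I -> lseries K k) q H, mdeg_le q H ->
      (forall v, v \in s -> filt e q H 1 v) -> filt e q H d w) ->
  alg (alg_bound (size s) h d) w.
Proof.
move=> h0 sh sw; have [I [e [q [cI [dq q0] [i0 e1] es _]]]] := frame_exists h0 sh.
rewrite /alg_bound -cI; apply: (@alg_filt _ _ _ e _ _ dq _ _ i0) => //.
  by rewrite e1 oner_neq0.
exact: sw es.
Qed.

Definition clear_bound h := alg_bound 1 h h.+1.

Lemma filt_X k (I : finType) (e : I -> lseries K k) q H j : mdeg_le q H ->
  (j < k)%N -> filt e q H 1 (lX K k j).
Proof. by move=> dq jk; rewrite (lX_mpoly K jk); apply/filt_mpoly/mdeg_leXU. Qed.

Lemma alg_clear k h (f : lseries K k.+1) (f1 := lX K k.+1 k ^+ h * f) :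
  alg h f -> vanish_below (f1 : laurent _) 0 /\ alg (clear_bound h) f1.
Proof.
move=> fh; have h0 := alg_gt0 fh; split.
  rewrite /f1 lX_max => m m0; rewrite lcoefXnM.
  have [f0|f0] := eqVneq f 0; first by rewrite f0 lcoef0.
  have [v fv fv0] := @laurent_order _ (f : laurent _) f0.
  have [hv|vh] := leP (- h%:Z) v; first by apply: fv; lia.
  have gv := vanish_belowV fv fv0.
  have gv0 : vanish_below ((f^-1)%R : laurent (lseries K k)) 0.
    by apply: vanish_belowW gv; lia.
  have [|e [eh _]] := alg_order gv0 _ (alg_inv f0 fh); first by rewrite invr_eq0.
  by rewrite gv ?eqxx //; lia.
apply: (@alg_frame _ _ [:: f]) => // [v|I e q H dq es].
  by rewrite inE => /eqP ->.
rewrite -[h.+1]addn1; apply: filtM; last by apply: es; rewrite inE eqxx.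
by rewrite -[X in filt _ _ _ X]muln1; apply: filtX => //; apply: filt_X.
Qed.

Definition shift_bound h := alg_bound 3 h 2.

Lemma shift_bound_ge h : (h <= shift_bound h)%N.
Proof.
rewrite /shift_bound /alg_bound; apply: leq_trans (leq_addr _ _).
by case: h => // h; rewrite !expnS expn0 muln1 leq_pmulr.
Qed.

Lemma alg_shift k h (f : lseries K k.+1) : alg h f ->
    vanish_below (f : laurent _) 0 ->
  exists g : lseries K k.+1, [/\ alg (shift_bound h) g,
    vanish_below (g : laurent _) 0 &
    forall m, 0 <= m -> (g : laurent _) m = (f : laurent _) (m + 1)].
Proof.
move=> fh f0; have h0 := alg_gt0 fh; have X0 := lX_neq0 K (ltnSn k).
pose c : lseries K k.+1 := laurentC ((f : laurent (lseries K k)) 0).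
pose g := (lX K k.+1 k)^-1 * (f - c).
have gE m : (g : laurent (lseries K k)) m = (f - c : laurent _) (m + 1).
  have -> : f - c = lX K k.+1 k * g by rewrite mulrA mulfV ?mul1r.
  by rewrite lX_max lcoefXM addrK.
exists g; split.
- apply: (@alg_frame _ _ [:: f; c; (lX K k.+1 k)^-1]) => // [v|I e q H dq es].
    rewrite !inE => /or3P[/eqP -> //|/eqP ->|/eqP ->].
      by apply/alg_widen/alg_coef0.
    apply: alg_inv => //; rewrite (lX_mpoly K (ltnSn k)).
    by apply: alg_mpoly => //; apply: mdeg_leXU.
  apply: (@filtM _ _ _ _ _ _ 1 1); first by apply: es; rewrite !inE eqxx !orbT.
  apply: filtD; first by apply: es; rewrite inE eqxx.
  by apply/filtN/es; rewrite !inE eqxx orbT.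
- move=> m m0; rewrite gE lcoefD lcoefN lcoef_monom.
  case: (eqVneq (m + 1) 0) => [->|m1]; first by rewrite subrr.
  by rewrite f0 ?subr0 //; lia.
- move=> m m0; rewrite gE lcoefD lcoefN lcoef_monom ifF ?subr0 //; lia.
Qed.

Lemma alg_coef k h (f : lseries K k.+1) (m : nat) : alg h f ->
    vanish_below (f : laurent _) 0 ->
  alg (iter m shift_bound h) ((f : laurent _) m%:Z).
Proof.
move=> fh f0; suff [g [gh g0 gE]] : exists g : lseries K k.+1,
    [/\ alg (iter m shift_bound h) g, vanish_below (g : laurent _) 0 &
      forall i, 0 <= i -> (g : laurent _) i = (f : laurent _) (i + m%:Z)].
  by have := alg_coef0 g0 gh; rewrite gE // add0r.
elim: m => [|m [g [gh g0 gE]]]; first by exists f; split=> // i _; rewrite addr0.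
have [g' [gh' g0' gE']] := alg_shift gh g0.
exists g'; split=> // i i0; rewrite gE' // gE; last by lia.
by congr (lcoef _ _); lia.
Qed.

Lemma iter_shift_bound_le h m m' : (m <= m')%N ->
  (iter m shift_bound h <= iter m' shift_bound h)%N.
Proof.
move=> /subnK <-; elim: (m' - m)%N => // i IH.
by rewrite addSn iterS; apply: leq_trans IH (shift_bound_ge _).
Qed.

Definition order_bound h := alg_bound 1 h (h + h).

Lemma order_bound_ge h : (h <= order_bound h)%N.
Proof. by rewrite /order_bound /alg_bound expn1 leq_addr. Qed.

Lemma alg_horner_deriv k h (f : lseries K k) (P : {poly {mpoly K[k]}}) :
    alg h f -> (size P <= h.+1)%N -> (forall j, mdeg_le P`_j h) ->
  alg (order_bound h) ((map_poly (@mpoly_lseries K k) P)^`().[f]).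
Proof.
move=> fh sP dP; have h0 := alg_gt0 fh.
apply: (@alg_frame _ _ [:: f]) => // [v|I e q H dq es].
  by rewrite inE => /eqP ->.
rewrite deriv_map (@horner_coef_wide _ h.+1); last first.
  apply: leq_trans (size_poly _ _) _; apply: leq_trans (size_poly _ _) _.
  exact: leq_trans (leq_pred _) sP.
apply: filt_sum => // j _; apply: filtM.
  rewrite coef_map; apply: filt_mpoly => //.
  by rewrite coef_deriv; apply: mdeg_le_mulrn.
have := filtX dq j (es f (mem_head _ _)); rewrite muln1; apply: filtW => //.
by rewrite -ltnS.
Qed.

End Coefs.

(** * Reduction to a simple root *)

Section Fractions.
Local Open Scope ring_scope.

Section EqMod.
Variables (R : comNzRingType) (y : R).

Definition eqmod a b := exists t, a = b + y * t.

Lemma eqmod_refl a : eqmod a a.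
Proof. by exists 0; rewrite mulr0 addr0. Qed.

Lemma eqmodD a b c d : eqmod a b -> eqmod c d -> eqmod (a + c) (b + d).
Proof. by move=> [t ->] [u ->]; exists (t + u); ring. Qed.

Lemma eqmodM a b c d : eqmod a b -> eqmod c d -> eqmod (a * c) (b * d).
Proof. by move=> [t ->] [u ->]; exists (t * d + b * u + y * t * u); ring. Qed.

Lemma det_eqmod m (A B : 'M[R]_m) :
  (forall i j, eqmod (A i j) (B i j)) -> eqmod (\det A) (\det B).
Proof.
move=> AB; rewrite /determinant.
elim/big_rec2: _ => [|s a b _ ab]; first exact: eqmod_refl.
apply: eqmodD => //; apply: eqmodM; first exact: eqmod_refl.
by elim/big_rec2: _ => [|i c d _ cd]; [apply: eqmod_refl|apply: eqmodM].
Qed.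

End EqMod.

Variable K : fieldType.

Lemma mdeg_le_sign k (b : bool) (p : {mpoly K[k]}) N :
  mdeg_le p N -> mdeg_le ((-1) ^+ b * p) N.
Proof. by move=> dp; rewrite mulr_sign; case: b => //; apply: mdeg_leN. Qed.

Lemma mdeg_le_det k m (A : 'M[{mpoly K[k]}]_m) N :
  (forall i j, mdeg_le (A i j) N) -> mdeg_le (\det A) (m * N).
Proof.
move=> dA; rewrite /determinant; apply: mdeg_le_sum => s _; apply: mdeg_le_sign.
suff dP (f : 'I_m -> 'I_m) : mdeg_le (\prod_i A i (f i)) (m * N) by apply: dP.
have sE : size (index_enum 'I_m) = m.
  by rewrite -[index_enum _]/(Finite.enum _) -enumT size_enum_ord.
by rewrite -[X in mdeg_le _ (X * N)]sE; apply: mdeg_le_prod.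
Qed.

Lemma mdeg_le_adj k m (A : 'M[{mpoly K[k]}]_m) N i j :
  (forall i j, mdeg_le (A i j) N) -> mdeg_le (\adj A i j) (m * N).
Proof.
move=> dA; rewrite mxE /cofactor -signr_odd; apply: mdeg_le_sign.
apply: (@mdeg_leW _ _ _ (m.-1 * N)); first by rewrite leq_mul ?leq_pred.
by apply: mdeg_le_det => i' j'; rewrite !mxE.
Qed.

Definition fraction_bound D d H := (D * (d * H.+1).+1 + d * H.+1)%N.

(* Cramer's rule for the matrix by which q^d (1 + Y T) acts on the family e. *)
Lemma filt_fraction k (I : finType) (e : I -> lseries K k) q H d i0 Y T W :
    mdeg_le q H -> e i0 = 1 -> mdeg_le Y 1 ->
    1 + mpoly_lseries Y * T != 0 ->
    filt e q H d T -> filt e q H d W -> q != 0 ->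
  exists (num : I -> {mpoly K[k]}) (T' : {mpoly K[k]})
    (den := q ^+ (d * #|I|) + Y * T'),
    [/\ mdeg_le den (fraction_bound #|I| d H),
        forall i, mdeg_le (num i) (fraction_bound #|I| d H) &
        mpoly_lseries den * (W / (1 + mpoly_lseries Y * T)) =
          \sum_i mpoly_lseries (num i) * e i].
Proof.
move=> dq e1 dY T1 [M dM Me] [M' dM' Me'] q0.
pose phi := @mpoly_lseries K k; pose D := #|I|.
pose MT : 'M[{mpoly K[k]}]_D := \matrix_(i, j) M (enum_val i) (enum_val j).
pose MW : 'M[{mpoly K[k]}]_D := \matrix_(i, j) M' (enum_val i) (enum_val j).
pose v : 'cV[lseries K k]_D := \col_i e (enum_val i).
pose N := (q ^+ d)%:M + Y *: MT.
have actE (A : I -> I -> {mpoly K[k]}) (c : lseries K k) :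
    (forall i, c * e i = \sum_j phi (A i j) * e j) ->
    map_mx phi (\matrix_(i, j) A (enum_val i) (enum_val j) : 'M_D) *m v = c *: v.
  move=> Ae; apply/colP => i; rewrite !mxE Ae.
  rewrite [RHS](reindex _ (onW_bij _ (enum_val_bij I))) /=.
  by apply: eq_bigr => j _; rewrite !mxE.
have vT := actE _ _ Me; have vW := actE _ _ Me'.
have NE i j : eqmod Y (N i j) ((q ^+ d)%:M i j).
  by rewrite !mxE; exists (MT i j); rewrite !mxE.
have [T' detE] := det_eqmod NE.
have dH : mdeg_le (q ^+ d) (d * H) by apply: mdeg_leX.
have dN i j : mdeg_le (N i j) (d * H.+1).+1.
  rewrite !mxE; apply: mdeg_leD.
    case: (_ == _); rewrite ?mulr1n ?mulr0n; last exact: mdeg_le0.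
    by apply: mdeg_leW dH; rewrite mulnS; lia.
  by rewrite -[(d * H.+1).+1]add1n; apply: mdeg_leM.
pose i1 := enum_rank i0.
pose num i := (\adj N *m MW) i1 (enum_rank i).
have denE : \det N = q ^+ (d * D) + Y * T' by rewrite detE det_scalar -exprM.
exists num, T' => den; have {}denE : den = \det N by rewrite denE.
split.
- rewrite denE; apply: (@mdeg_leW _ _ _ (D * (d * H.+1).+1)); first exact: leq_addr.
  exact: mdeg_le_det.
- move=> i; rewrite /num mxE; apply: mdeg_le_sum => j _; apply: mdeg_leM.
    exact: mdeg_le_adj.
  by rewrite mxE.
have vN : map_mx phi N *m v = (phi q ^+ d * (1 + phi Y * T)) *: v.
  rewrite /N map_mxD map_scalar_mx map_mxZ mulmxDl mul_scalar_mx -scalemxAl vT.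
  by rewrite rmorphXn scalerA -scalerDl; congr (_ *: _); ring.
have adjv : phi den *: v = (phi q ^+ d * (1 + phi Y * T)) *: (map_mx phi (\adj N) *m v).
  rewrite scalemxAr -vN mulmxA -map_mxM mul_adj_mx map_scalar_mx mul_scalar_mx.
  by rewrite denE.
have key : (phi den * W) *: v =
    (1 + phi Y * T) *: (map_mx phi (\adj N *m MW) *m v).
  have qd0 : phi q ^+ d != 0 by rewrite expf_neq0 // mpoly_lseries_eq0.
  have -> : map_mx phi (\adj N *m MW) *m v = (phi q ^+ d * W) *: (map_mx phi (\adj N) *m v).
    by rewrite map_mxM -mulmxA vW -scalemxAr.
  rewrite [phi den * W]mulrC -[LHS]scalerA adjv !scalerA; congr (_ *: _); ring.
have := congr1 (fun A : 'cV[lseries K k]_D => A i1 0) key.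
rewrite mxE mxE enum_rankK e1 mulr1 => key1.
apply: (mulIf T1); rewrite mulrA divfK // key1 mxE mulrC mxE; congr (_ * _).
rewrite [RHS](reindex _ (onW_bij _ (enum_val_bij I))) /=.
by apply: eq_bigr => j _; rewrite /num enum_valK [v _ _]mxE [map_mx _ _ _ _]mxE.
Qed.

End Fractions.

Section SeriesFiltration.
Local Open Scope ring_scope.
Variables (K : fieldType) (k : nat) (I : finType) (e : I -> lseries K k).
Variables (q : {mpoly K[k]}) (H : nat) (dq : mdeg_le q H).
Local Notation S := (filt e q H).

Definition psfilt d (F : laurent (lseries K k)) :=
  [/\ vanish_below F 0, forall i, d%:Z < i -> F i = 0 & forall i, S d (F i)].

Lemma psfiltW d d' F : (d <= d')%N -> psfilt d F -> psfilt d' F.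
Proof.
move=> dd [F0 Fd SF]; split=> // [i i1|i]; first by apply: Fd; lia.
exact: filtW (SF i).
Qed.

Lemma psfilt_mpoly d (p : {mpoly K[k.+1]}) : mdeg_le p d -> psfilt d (mpoly_lseries p).
Proof.
move=> dp; split; first exact: mpoly_lseries_ge0.
  by move=> i; apply: mpoly_lseries_below.
move=> i; have [p' dp' [-> _]] := mpoly_lseries_coef i dp.
exact: filt_mpoly.
Qed.

Lemma psfiltD d F G : psfilt d F -> psfilt d G -> psfilt d (F + G).
Proof.
move=> [F0 Fd SF] [G0 Gd SG]; split; first exact: vanish_below_D.
  by move=> i di; rewrite lcoefD Fd ?Gd ?addr0.
by move=> i; rewrite lcoefD; apply: filtD.
Qed.

Lemma psfilt0 d : psfilt d 0.
Proof. by split=> // i; apply: filt0. Qed.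

Lemma psfilt_sum d J (r : seq J) (P : pred J) (F : J -> laurent (lseries K k)) :
  (forall j, P j -> psfilt d (F j)) -> psfilt d (\sum_(j <- r | P j) F j).
Proof.
move=> PF; elim/big_rec: _ => [|j G Pj PG]; first exact: psfilt0.
by apply: psfiltD => //; apply: PF.
Qed.

Lemma psfilt_mulrn d F m : psfilt d F -> psfilt d (F *+ m).
Proof.
move=> PF; elim: m => [|m IH]; first exact: psfilt0.
by rewrite mulrS; apply: psfiltD.
Qed.

Lemma psfiltM d d' F G : psfilt d F -> psfilt d' G -> psfilt (d + d') (F * G).
Proof.
move=> [F0 Fd SF] [G0 Gd SG]; split; first exact: vanish_below0_mul.
  move=> i di; apply: lcoefM_eq0 => j.
  have [jd|jd] := ltP d%:Z j; first by rewrite Fd ?mul0r.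
  by rewrite Gd ?mulr0 //; lia.
move=> i; have i1 : i < 0 + 0 + (`|i|%N.+1)%:Z by lia.
rewrite (lcoefM_fin F0 G0 i1); apply: filt_sum => // j _.
exact: filtM.
Qed.

Lemma psfilt_monom d c m : S d c -> (m <= d)%N -> psfilt d (lmonom c m%:Z).
Proof.
move=> Sc md; split=> [i i0|i di|i]; rewrite lcoef_monom.
- by rewrite ifF //; lia.
- by rewrite ifF //; lia.
- by case: ifP => // _; apply: filt0.
Qed.

Lemma psfilt1 : psfilt 0 1.
Proof. by apply: (@psfilt_monom 0 1 0) => //; apply: filt1. Qed.

Lemma psfiltX d F m : psfilt d F -> psfilt (m * d) (F ^+ m).
Proof.
move=> PF; elim: m => [|m IH]; first exact: psfilt1.
by rewrite exprS mulSn; apply: psfiltM.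
Qed.

End SeriesFiltration.

Section Hensel.
Local Open Scope ring_scope.
Variables (K : fieldType) (k : nat).
Local Notation L := (lseries K k).

Definition hensel_degree h n := (h + h * (n + 3))%N.

(* n is the order of P'(f), a the coefficient of t^n in P'(f), and Q(Y) is
   P(u + t^(n+1) Y) / (a t^(2n+1)), where u is f truncated at t^(n+3). *)
Lemma hensel_data h (f : laurent L) :
    alg h (f : lseries K k.+1) -> vanish_below f 0 ->
  exists (n : nat) (a : L) (Q : {poly laurent L}) (g : laurent L),
  [/\ (n <= order_bound h)%N,
      a != 0 /\ alg (iter n shift_bound (order_bound h)) a,
      f = \sum_(j < n + 3) lmonom (f j%:Z) j%:Z + laurentX L ^+ n.+1 * g,
      [/\ (size Q <= h.+1)%N, vanish_below g 2, Q.[g] = 0 &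
        [/\ forall i, vanish_below Q`_i 0, Q`_1 0 = 1 & vanish_below Q`_0 2]] &
      forall (I : finType) (e : I -> L) q H, mdeg_le q H ->
        filt e q H 1 a^-1 ->
        (forall j, (j < n + 3)%N -> filt e q H 1 (f j%:Z)) ->
      forall i, (forall m, filt e q H (hensel_degree h n).+1 (Q`_i m)) /\
        (forall m, (hensel_degree h n + n.+1 * h)%N%:Z < m -> Q`_i m = 0)].
Proof.
move=> fh f0; have h0 := alg_gt0 fh.
have [P [sP dP Pf P'f]] := alg_separable fh.
pose p : {poly laurent L} := map_poly (@mpoly_lseries K k.+1) P.
have p0 i : vanish_below p`_i 0.
  by rewrite coef_map; apply: mpoly_lseries_ge0.
have p'0 i : vanish_below p^`()`_i 0.
  by rewrite deriv_map coef_map; apply: mpoly_lseries_ge0.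
pose b : laurent L := p^`().[f].
have bh : alg (order_bound h) (b : lseries K k.+1) by apply: alg_horner_deriv.
have horner0 (r : {poly laurent L}) (v : laurent L) : (forall i, vanish_below r`_i 0) ->
    vanish_below v 0 -> vanish_below r.[v] 0.
  move=> r0 v0; rewrite horner_coef; apply: vanish_below_sum => i _.
  exact: vanish_below0_mul (r0 _) (vanish_belowXn _ v0).
have b0 : vanish_below b 0 by apply: horner0.
have [n [nh bn bn0]] := alg_order b0 P'f bh.
set a : L := b n%:Z in bn0.
have [d dN fE] := laurent_split (n + 3) f0.
set u := \sum_(j < n + 3) _ in fE.
have uE : u = \sum_(j < n + 3) lmonom (f j%:Z) j%:Z.
  by apply: eq_bigr => j _; rewrite add0r.
rewrite add0r in dN.
have u0 : vanish_below u 0.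
  rewrite uE; apply: vanish_below_sum => j _ m m0.
  by rewrite lcoef_monom ifF //; lia.
pose B i := (p^`N(i)).[u].
have sp : (size p <= h.+1)%N by apply: leq_trans (size_poly _ _) sP.
have taylor : \sum_(i < h.+1) B i * d ^+ i = 0.
  rewrite -(nderiv_taylor_wide (mulrC _ _) sp) -fE.
  exact: Pf.
have B0 i : vanish_below (B i) 0.
  apply: horner0 => // j; rewrite coef_nderivn -mulr_natr.
  rewrite -(rmorph_nat (@laurentC L)); apply: vanish_below0_mul => //.
  exact: vanish_belowC.
have B1E m : m < (n + 3)%N%:Z -> B 1%N m = b m.
  move=> mn; have := vanish_below_Taylor p'0 u0 dN mn.
  by rewrite -fE lcoefD lcoefN /B poly.nderivn1 => /eqP; rewrite subr_eq0 => /eqP.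
have B1 : vanish_below (B 1%N) n%:Z by move=> m mn; rewrite B1E ?bn //; lia.
have d0 : vanish_below d 0 by apply: vanish_belowW dN.
have B00 : vanish_below (B 0%N) (2 * n%:Z + 3).
  have -> : B 0%N = - (B 1%N * d + \sum_(i < h.-1) B i.+2 * (d ^+ i * d ^+ 2)).
    apply/eqP; rewrite -addr_eq0 -[X in _ == X]taylor -(prednK h0) !big_ord_recl.
    rewrite expr0 mulr1 expr1; apply/eqP; congr (_ + (_ + _)).
    by apply: eq_bigr => i _; rewrite -exprD addn2.
  move=> m mn; rewrite lcoefN lcoefD (vanish_below_mul B1 dN) ?add0r; last by lia.
  rewrite lcoef_sum big1 ?oppr0 // => i _.
  have d2 : vanish_below (d ^+ 2) (2 * n%:Z + 6).
    by apply: vanish_belowW (vanish_below_mul dN dN); lia.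
  have d2' : vanish_below (d ^+ i * d ^+ 2) (0 + (2 * n%:Z + 6)).
    exact: vanish_below_mul (vanish_belowXn _ d0) d2.
  by rewrite (vanish_below_mul (B0 i.+2) d2') //; lia.
pose s i : int := n.+1%:Z * i%:Z - (2 * n%:Z + 1).
pose Q := \poly_(i < h.+1) (lmonom a^-1 (s i) * B i).
pose g := lmonom 1 (- n.+1%:Z) * d.
have Qi i m : (i <= h)%N -> Q`_i m = a^-1 * B i (m - s i).
  by move=> ih; rewrite coef_poly ltnS ih lcoef_monomM.
have Qi0 i : (h < i)%N -> Q`_i = 0 by move=> hi; rewrite coef_poly ltnS leqNgt hi.
exists n, a, Q, g; split=> //.
- by split=> //; apply: alg_coef.
- rewrite {1}fE uE; congr (_ + _).
  rewrite laurentXn /g mulrA lmonomM mulr1 subrr; exact: esym (mul1r d).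
- split; first exact: size_poly.
  + by move=> m m2; rewrite lcoef_monomM dN ?mulr0 //; lia.
  + rewrite (@horner_coef_wide _ h.+1) ?size_poly //.
    rewrite -[RHS](mulr0 (lmonom a^-1 (- (2 * n%:Z + 1)))) -[X in _ = _ * X]taylor.
    rewrite mulr_sumr; apply: eq_bigr => i _; rewrite coef_poly ltn_ord.
    rewrite /g exprMn lmonomX expr1n mulrACA lmonomM mulr1.
    by congr (lmonom _ _ * _); rewrite /s; ring.
  split=> [i m m0||].
  + have [ih|hi] := leqP i h; last by rewrite Qi0 // lcoef0.
    rewrite Qi //; case: i ih => [|[|i]] ih.
    * by rewrite B00 ?mulr0 // /s; lia.
    * by rewrite B1 ?mulr0 // /s; lia.
    * by rewrite B0 ?mulr0 // /s; nia.
  + rewrite Qi // (_ : 0 - s 1%N = n%:Z); last by rewrite /s; lia.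
    by rewrite B1E ?mulVf //; lia.
  + by move=> m m2; rewrite Qi // B00 ?mulr0 // /s; lia.
move=> I e q H dq Sa Sf i.
have uS : psfilt e q H (n + 3) u.
  rewrite uE; apply: psfilt_sum => // j _; apply: psfilt_monom => //.
    by apply: filtW (Sf j (ltn_ord j)) => //; lia.
  exact: ltnW.
have BS : psfilt e q H (hensel_degree h n) (B i).
  rewrite /B (@horner_coef_wide _ h.+1); last first.
    by apply: leq_trans (size_poly _ _) _; lia.
  apply: psfilt_sum => // j _; apply: psfiltM => //.
    by rewrite coef_nderivn coef_map; apply/psfilt_mulrn/psfilt_mpoly.
  apply: (@psfiltW _ _ _ _ _ _ _ (j * (n + 3))) => //; last exact: psfiltX.
  by rewrite leq_mul2r -ltnS ltn_ord orbT.
have [_ Bd SB] := BS.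
have [ih|hi] := leqP i h; last first.
  by rewrite Qi0 //; split=> // m; apply: filt0.
split=> m; rewrite Qi //; first by rewrite -add1n; apply: filtM.
move=> dm; rewrite Bd ?mulr0 // /s.
have : (n.+1 * i <= n.+1 * h)%N by rewrite leq_mul2l ih orbT.
by move: dm; lia.
Qed.

End Hensel.

Lemma split_fraction (F : fieldType) (a b c x z : F) : (x != 0 -> z != 0 ->
  (a * z + b * (x * c)) / z = a + b * (x ^+ 2 * (c / (x * z))))%R.
Proof. by move=> x0 z0; field; rewrite x0 z0. Qed.

Lemma lcoef_tyM (F : fieldType) n (f : laurent (laurent F)) i j :
  (((laurentC (laurentX F) * laurentX (laurent F)) ^+ n * f)%R i j =
   f (i - n%:Z) (j - n%:Z))%R.
Proof.
have -> : ((laurentC (laurentX F) * laurentX (laurent F)) ^+ n * f =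
    laurentX (laurent F) ^+ n * (laurentC (laurentX F ^+ n) * f))%R.
  by rewrite exprMn rmorphXn -mulrA mulrCA.
by rewrite lcoefXnM lcoefCM lcoefXnM.
Qed.

Section Presentation.
Local Open Scope ring_scope.
Variables (K : fieldType) (k : nat).
Local Notation L := (lseries K k).
Local Notation L2 := (laurent (laurent L)).
Local Notation CC c := (laurentC (laurentC c) : L2).
Local Notation t := (laurentC (laurentX L) : L2).
Local Notation y := (laurentX (laurent L)).

Lemma dsub_monom (c : L) (m : nat) : dsub (lmonom c m%:Z) = CC c * (t * y) ^+ m.
Proof.
rewrite exprMn -rmorphXn laurentXn laurentXn mulrA -rmorphM mulrC.
apply: lcoef_inj => i; apply: lcoef_inj => j.
rewrite lcoef_dsub lcoef_monomM mul1r !lcoef_monom subr_eq0.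
case: (eqVneq i m%:Z) => [->|_]; last by rewrite if_same lcoef0.
by rewrite mulrC lcoef_monomM mul1r lcoef_monom subr_eq0.
Qed.

Lemma dsub_sum J (r : seq J) (P : pred J) (g : J -> laurent L) :
  dsub (\sum_(j <- r | P j) g j) = \sum_(j <- r | P j) dsub (g j).
Proof. exact: raddf_sum. Qed.

Lemma laurent_fin (g : laurent L) D : vanish_below g 0 ->
    (forall m, D%:Z < m -> g m = 0) ->
  g = \sum_(m < D.+1) lmonom (g m%:Z) m%:Z.
Proof.
move=> g0 gD; have [g' g'v gE] := laurent_split D.+1 g0.
have sE : \sum_(m < D.+1) lmonom (g (0 + m%:Z)) (0 + m%:Z) =
    \sum_(m < D.+1) lmonom (g m%:Z) m%:Z.
  by apply: eq_bigr => m _; rewrite add0r.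
rewrite {}sE in gE; suff g'0 : g' = 0 by rewrite {1}gE g'0 addr0.
apply: lcoef_inj => m; have [mD|Dm] := ltP m D.+1%:Z; first exact: g'v.
have := congr1 (fun F : laurent L => F m) gE; rewrite gD; last by lia.
rewrite lcoefD lcoef_sum big1 ?add0r // => i _.
by rewrite lcoef_monom ifF //; have := ltn_ord i; lia.
Qed.

Section Filtration.
Variables (I : finType) (e : I -> lseries K k.+2) (q : {mpoly K[k.+2]}) (H : nat).
Hypothesis dq : mdeg_le q H.
Local Notation S := (filt e q H).

Lemma filt_t : S 1 t.
Proof.
have -> : t = lX K k.+2 k by rewrite lX_lt // lX_max.
exact: filt_X.
Qed.

Lemma filt_y : S 1 y.
Proof.
have -> : y = lX K k.+2 k.+1 by rewrite lX_max.
exact: filt_X.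
Qed.

Lemma filt_dsub d D (g : laurent L) : vanish_below g 0 ->
    (forall m, D%:Z < m -> g m = 0) -> (forall m, S d (CC (g m))) ->
  S (d + D * 2) (dsub g).
Proof.
move=> g0 gD gS; rewrite (laurent_fin g0 gD) dsub_sum; apply: filt_sum => // m _.
rewrite dsub_monom; apply: filtM => //.
apply: (@filtW _ _ _ _ _ _ dq (m * 2)).
  by rewrite leq_mul2r -ltnS ltn_ord.
by apply: filtX => //; apply: (@filtM _ _ _ _ _ _ 1 1); [apply: filt_t|apply: filt_y].
Qed.

Lemma filt_mulrn d w m : S d w -> S d (w *+ m).
Proof.
move=> Sw; elim: m => [|m IH]; first exact: filt0.
by rewrite mulrS; apply: filtD.
Qed.

End Filtration.

(* T in Q(ty, y) = y (1 + y T). *)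
Definition tail_series (Q : {poly laurent L}) h D : L2 :=
  \sum_(i < h.+1) \sum_(m < D.+1)
    if (2 <= i + m)%N then CC (Q`_i m%:Z) * t ^+ m * y ^+ (i + m - 2) else 0.

Lemma tail_seriesE (Q : {poly laurent L}) h D :
    (0 < h)%N -> (size Q <= h.+1)%N -> (forall i, vanish_below Q`_i 0) ->
    Q`_1 0 = 1 -> vanish_below Q`_0 2 ->
    (forall i m, D%:Z < m -> Q`_i m = 0) ->
  (map_poly (@dsub L) Q).[y] = y * (1 + y * tail_series Q h D).
Proof.
move=> h0 sQ Q0 Q1 Q00 QD.
rewrite (@horner_coef_wide _ h.+1); last by apply: leq_trans (size_poly _ _) sQ.
have delta : y = \sum_(i < h.+1) \sum_(m < D.+1)
    if (i == 1 :> nat) && (m == 0 :> nat) then y else 0.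
  rewrite (bigD1 (Ordinal (h0 : 1 < h.+1)%N)) //= [X in _ + X]big1 ?addr0.
    by rewrite big_ord_recl /= big1 ?addr0.
  move=> i i1; apply: big1 => m _; rewrite ifF //; apply/negbTE.
  by apply: contra i1 => /andP[/eqP iE _]; apply/eqP/val_inj.
rewrite mulrDr mulr1 mulrA -expr2 {2}delta /tail_series mulr_sumr -big_split.
apply: eq_bigr => i _; rewrite coef_map /= {1}(laurent_fin (Q0 i) (QD i)).
rewrite dsub_sum mulr_suml mulr_sumr -big_split; apply: eq_bigr => m _ /=.
rewrite dsub_monom exprMn.
have E : CC (Q`_i m%:Z) * (t ^+ m * y ^+ m) * y ^+ i =
    CC (Q`_i m%:Z) * t ^+ m * y ^+ (i + m).
  by rewrite addnC exprD !mulrA.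
rewrite E; case: ltnP => im.
  rewrite ifF; last by apply/negP => /andP[/eqP i1 /eqP m0]; move: im; rewrite i1 m0.
  rewrite add0r [RHS]mulrCA -exprD subnKC //.
rewrite mulr0 addr0; move: (nat_of_ord i) (nat_of_ord m) im => [|[|i']] [|[|m']] //= _.
- by rewrite Q00 // !rmorph0 !mul0r.
- by rewrite Q00 // !rmorph0 !mul0r.
- by rewrite Q1 !rmorph1 !mul1r.
Qed.

Lemma filt_tail_series (I : finType) (e : I -> lseries K k.+2) q H d D
    (Q : {poly laurent L}) h :
    mdeg_le q H -> (forall i m, filt e q H d (CC (Q`_i m))) ->
  filt e q H (d + 2 * D + h) (tail_series Q h D).
Proof.
move=> dq QS; apply: filt_sum => // i _; apply: filt_sum => // m _.
case: ifP => _; last exact: filt0.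
have iS := ltn_ord i; have mS := ltn_ord m.
apply: (@filtW _ _ _ _ _ _ dq (d + m * 1 + (i + m - 2) * 1)); first by lia.
apply: filtM; last by apply: filtX => //; apply: filt_y.
by apply: filtM => //; apply: filtX => //; apply: filt_t.
Qed.

Lemma filt_deriv_dsub (I : finType) (e : I -> lseries K k.+2) q H d D
    (Q : {poly laurent L}) h :
    mdeg_le q H -> (size Q <= h.+1)%N -> (forall i, vanish_below Q`_i 0) ->
    (forall i m, D%:Z < m -> Q`_i m = 0) ->
    (forall i m, filt e q H d (CC (Q`_i m))) ->
  filt e q H (d + 2 * D + h) (map_poly (@dsub L) Q)^`().[y].
Proof.
move=> dq sQ Q0 QD QS; rewrite (@horner_coef_wide _ h.+1); last first.
  by rewrite deriv_map; apply: leq_trans (size_poly _ _) (leq_trans (size_poly _ _) _);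
    apply: leq_trans (leq_pred _) sQ.
apply: filt_sum => // i _; have iS := ltn_ord i.
apply: (@filtW _ _ _ _ _ _ dq (d + D * 2 + i * 1)); first by lia.
apply: filtM; last by apply: filtX => //; apply: filt_y.
rewrite coef_deriv; apply: filt_mulrn => //; rewrite coef_map.
by apply: (filt_dsub dq (Q0 _) (QD _)) => m; apply: QS.
Qed.

Definition coef_bound h := iter (order_bound h + 3) shift_bound (order_bound h).
Definition frame_height h := ((order_bound h + 4) * coef_bound h)%N.
Definition frame_card h := (coef_bound h ^ (order_bound h + 4))%N.
Definition basis_bound h :=
  (frame_card h + 2 * (frame_card h * (frame_height h * (frame_height h).+1)))%N.
Definition filt_bound h := let o := order_bound h in
  let D := (hensel_degree h o + o.+1 * h)%N in
  ((hensel_degree h o).+1 + 2 * D + h + 2 * o + 8)%N.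
Definition quotient_bound h :=
  fraction_bound (frame_card h) (filt_bound h) (frame_height h).

Theorem presentation h (f : laurent L) :
    alg h (f : lseries K k.+1) -> vanish_below f 0 ->
  exists (I : finType) (e : I -> L) (num : I -> {mpoly K[k.+2]})
    (q : {mpoly K[k]}) (T' : {mpoly K[k.+2]})
    (den := mwiden (mwiden q) + 'X_ord_max * T') (R : L2),
  [/\ (#|I| <= frame_card h)%N, q != 0,
      mdeg_le den (quotient_bound h) /\
        forall i, mdeg_le (num i) (quotient_bound h),
      forall i, alg (basis_bound h) (e i) &
      mpoly_lseries den * R = \sum_i mpoly_lseries (num i) * CC (e i)
      /\ forall m, R m m = f m].
Proof.
move=> fh f0; have h0 := alg_gt0 fh.
have [n [a [Q [g [no [a0 aalg] fE [sQ g2 Qg [Q0 Q1 Q00]] frame]]]]] :=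
  hensel_data fh f0.
have oh : alg (order_bound h) (f : lseries K k.+1).
  exact: algW (order_bound_ge h) fh.
have c0 : (0 < coef_bound h)%N.
  apply: leq_trans h0 (leq_trans (order_bound_ge h) _).
  exact: (@iter_shift_bound_le (order_bound h) 0).
pose s := a^-1 :: [seq f j%:Z | j <- iota 0 (n + 3)].
have ss : size s = (n + 4)%N by rewrite /= size_map size_iota -addnS.
have salg v : v \in s -> alg (coef_bound h) v.
  rewrite inE => /predU1P[->|/mapP[j]].
    apply: alg_inv => //; apply: algW aalg; apply: iter_shift_bound_le; lia.
  rewrite mem_iota => jn ->; apply: (@algW _ _ (iter j shift_bound (order_bound h))).
    by apply: iter_shift_bound_le; lia.
  exact: alg_coef.
have [I [e [q [cI [dq q0] [i0 e1] es ee]]]] := frame_exists c0 salg.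
set H := (size s * coef_bound h)%N in dq es ee.
have HH : (H <= frame_height h)%N by rewrite /H ss leq_mul2r leq_add2r no orbT.
have IH : (#|I| <= frame_card h)%N.
  by rewrite cI ss leq_pexp2l // leq_add2r.
have ealg i : alg (basis_bound h) (e i).
  have e0 : e i0 != 0 by rewrite e1 oner_neq0.
  apply: algW (alg_filt dq q0 e0 (ee i)); rewrite /basis_bound.
  by apply: leq_add => //; rewrite leq_mul2l /=; apply: leq_mul => //; apply: leq_mul.
have Sf j : (j < n + 3)%N -> filt e q H 1 (f j%:Z).
  move=> jn; apply: es; rewrite inE; apply/orP; right; apply/mapP.
  by exists j; rewrite ?mem_iota.
have fr := frame _ _ _ _ dq (es _ (mem_head _ _)) Sf.
pose D := (hensel_degree h n + n.+1 * h)%N; pose d1 := (hensel_degree h n).+1.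
pose e2 i : lseries K k.+2 := CC (e i); pose q2 := mwiden (mwiden q).
have dq2 : mdeg_le q2 H by do 2 apply: mdeg_le_widen.
have S2 d c : filt e q H d c -> filt e2 q2 H d (CC c).
  by move=> /filt_widen/filt_widen.
have QS i m : filt e2 q2 H d1 (CC (Q`_i m)) by apply/S2; exact: (fr i).1.
have QD i m : D%:Z < m -> Q`_i m = 0 by exact: (fr i).2.
pose T := tail_series Q h D; pose q' := (map_poly (@dsub L) Q).
have qy : q'.[y] = y * (1 + y * T) by apply: tail_seriesE.
have [qy0 diag] := Furstenberg Q0 Q1 g2 Qg; rewrite -/q' in qy0 diag.
have T0 : 1 + y * T != 0 by move: qy0; rewrite qy mulf_eq0 negb_or => /andP[].
pose u := \sum_(j < n + 3) lmonom (f j%:Z) j%:Z.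
pose W := dsub u * (1 + y * T) + (t * y) ^+ n.+1 * (y * q'^`().[y]).
pose d := (d1 + 2 * D + h + 2 * n + 8)%N.
have TS : filt e2 q2 H (d1 + 2 * D + h) T by apply: filt_tail_series.
have y1 : filt e2 q2 H 1 y by apply: filt_y.
have t1 : filt e2 q2 H 1 t by apply: filt_t.
have tyS m : filt e2 q2 H (m * 2) ((t * y) ^+ m).
  by apply: filtX => //; apply: (@filtM _ _ _ _ _ _ 1 1).
have WS : filt e2 q2 H d W.
  apply: filtD.
    apply: (@filtW _ _ _ _ _ _ dq2 ((1 + (n + 2) * 2) + (1 + (d1 + 2 * D + h)))).
      by rewrite /d; lia.
    apply: filtM; last by apply: filtD; [apply: filt1|apply: filtM].
    rewrite dsub_sum; apply: filt_sum => // j _; rewrite dsub_monom.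
    apply: filtM; first exact/S2/Sf.
    apply: filtW (tyS j) => //; have := ltn_ord j; lia.
  apply: (@filtW _ _ _ _ _ _ dq2 (n.+1 * 2 + (1 + (d1 + 2 * D + h)))).
    by rewrite /d; lia.
  by apply: filtM => //; apply: filtM => //; apply: filt_deriv_dsub.
have TSd : filt e2 q2 H d T by apply: filtW TS => //; rewrite /d; lia.
have yE : mpoly_lseries ('X_ord_max : {mpoly K[k.+2]}) = y.
  by rewrite mpoly_lseriesX lX_max.
have e21 : e2 i0 = 1 by rewrite /e2 e1 !rmorph1.
have dX : mdeg_le ('X_ord_max : {mpoly K[k.+2]}) 1 by apply: mdeg_leXU.
have q20 : q2 != 0.
  by rewrite /q2 -mpoly_lseries_eq0 !mpoly_lseries_widen !fmorph_eq0 mpoly_lseries_eq0.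
have T0' : 1 + mpoly_lseries ('X_ord_max : {mpoly K[k.+2]}) * (T : lseries K k.+2) != 0.
  by rewrite yE.
have [num [T' [dden dnum]]] := filt_fraction dq2 e21 dX T0' TSd WS q20.
rewrite yE => RE.
have bnd : (fraction_bound #|I| d H <= quotient_bound h)%N.
  have hd : (hensel_degree h n <= hensel_degree h (order_bound h))%N.
    by rewrite leq_add2l leq_mul2l leq_add2r no orbT.
  have dd : (d <= filt_bound h)%N.
    rewrite /d /filt_bound /d1 /D.
    have : (n.+1 * h <= (order_bound h).+1 * h)%N by rewrite leq_mul2r ltnS no orbT.
    move: hd no; move: (hensel_degree h n) (hensel_degree h (order_bound h)).
    by move: (n.+1 * h)%N (_.+1 * h)%N (order_bound h) => u1 u2 u3 u4 u5; lia.
  have dH : (d * H.+1 <= filt_bound h * (frame_height h).+1)%N by apply: leq_mul.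
  by apply: leq_add => //; apply: leq_mul.
exists I, e, num, (q ^+ (d * #|I|)), T'.
have denE : mwiden (mwiden (q ^+ (d * #|I|))) = q2 ^+ (d * #|I|).
  by rewrite /q2 !rmorphXn.
rewrite denE => den; exists (W / (1 + y * T)).
split=> //; first by rewrite expf_neq0.
  by split; [apply: mdeg_leW dden|move=> i; apply: mdeg_leW (dnum i)].
split=> // m.
have y0 : y != 0 by apply: laurentX_neq0.
have -> : W / (1 + y * T) =
    dsub u + (t * y) ^+ n.+1 * (y ^+ 2 * (q'^`().[y] / q'.[y])).
  by rewrite qy; apply: split_fraction.
rewrite lcoef2D lcoef_dsub eqxx lcoef_tyM diag {1}fE lcoefD.
by congr (_ + _); rewrite lcoefXnM.
Qed.

End Presentation.

Lemma sum_div (F : fieldType) (I : finType) (d x : F) (a : I -> F) :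
  (d != 0 -> d * x = \sum_i a i -> x = \sum_i a i / d)%R.
Proof. by move=> d0 dx; rewrite -mulr_suml -dx mulrAC mulfV ?mul1r. Qed.

(** * Rational series with a given half diagonal *)

Section Rational.
Local Open Scope ring_scope.
Variable K : fieldType.

Definition pol k N (F : lseries K k) :=
  exists2 p : {mpoly K[k]}, mdeg_le p N & F = mpoly_lseries p.

Definition rat_le k N (F : lseries K k) := exists a b : {mpoly K[k]},
  [/\ mdeg_le a N, mdeg_le b N, b != 0 & F = mpoly_lseries a / mpoly_lseries b].

Lemma rat_le_pol k N F : pol N F -> @rat_le k N F.
Proof.
move=> [p dp ->]; exists p, 1; rewrite oner_neq0 rmorph1 divr1.
by split=> //; apply: mdeg_le1.
Qed.

Lemma rat_leW k M N (F : lseries K k) : (M <= N)%N -> rat_le M F -> rat_le N F.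
Proof.
move=> MN [a [b [da db b0 FE]]]; exists a, b; split=> //.
  exact: mdeg_leW da.
exact: mdeg_leW db.
Qed.

Lemma rat_leM k M N (F G : lseries K k) :
  rat_le M F -> rat_le N G -> rat_le (M + N) (F * G).
Proof.
move=> [a [b [da db b0 ->]]] [c [d [dc dd d0 ->]]]; exists (a * c), (b * d).
rewrite !mpoly_lseriesM mulf_neq0 // mulf_div.
by split=> //; apply: mdeg_leM.
Qed.

Lemma rat_leV k N (F : lseries K k) : rat_le N F -> rat_le N F^-1.
Proof.
move=> [a [b [da db b0 ->]]]; have [->|a0] := eqVneq a 0.
  exists 0, 1; rewrite oner_neq0 rmorph0 mul0r invr0 mul0r.
  by split=> //; [apply: mdeg_le0|apply: mdeg_le1].
by exists b, a; rewrite invf_div.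
Qed.

Lemma rat_leD k M N (F G : lseries K k) :
  rat_le M F -> rat_le N G -> rat_le (M + N) (F + G).
Proof.
move=> [a [b [da db b0 ->]]] [c [d [dc dd d0 ->]]].
exists (a * d + c * b), (b * d); split.
- by apply: mdeg_leD; [|rewrite addnC]; apply: mdeg_leM.
- exact: mdeg_leM.
- by rewrite mulf_neq0.
by rewrite addf_div ?mpoly_lseries_eq0 // mpoly_lseriesD !mpoly_lseriesM.
Qed.

Lemma rat_le_sum k N I (r : seq I) (F : I -> lseries K k) :
  (forall i, rat_le N (F i)) -> rat_le (size r * N) (\sum_(i <- r) F i).
Proof.
move=> FN; elim: r => [|i r IH].
  by rewrite big_nil; apply: rat_le_pol; exists 0; rewrite ?rmorph0 //; apply: mdeg_le0.
by rewrite big_cons mulSn; apply: rat_leD.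
Qed.

Lemma pol_lX k j : (j < k)%N -> pol 1 (lX K k j).
Proof.
by move=> jk; exists 'X_(Ordinal jk); [apply: mdeg_leXU|rewrite mpoly_lseriesX].
Qed.

Lemma pol_mmap k l (p : {mpoly K[k]}) N D (v : 'I_k -> lseries K l) :
    mdeg_le p N -> (forall i, pol D (v i)) ->
  pol (N * D) (mmap (lseriesC K l) v p).
Proof.
move=> dp vD; have [w wP] : exists w : 'I_k -> {mpoly K[l]},
    forall i, mdeg_le (w i) D /\ v i = mpoly_lseries (w i).
  suff /choice [w wP] : forall i, exists p : {mpoly K[l]},
    mdeg_le p D /\ v i = mpoly_lseries p by exists w.
  by move=> i; have [r] := vD i; exists r.
exists (mmap (@mpolyC l K) w p).
  by apply: mdeg_le_mmap => // i; apply: (wP i).1.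
elim/mpoly_ring_ind: p {dp} => [c|j|p r Pp Pr|p r Pp Pr].
- by rewrite !mmapC mpoly_lseriesC.
- by rewrite !mmapX !mmap1U (wP j).2.
- by rewrite !mmapD mpoly_lseriesD Pp Pr.
- by rewrite !rmorphM /= Pp Pr.
Qed.

Lemma pol_mul k M N (F G : lseries K k) : pol M F -> pol N G -> pol (M + N) (F * G).
Proof.
move=> [p dp ->] [q dq ->]; exists (p * q); first exact: mdeg_leM.
by rewrite mpoly_lseriesM.
Qed.

Lemma pol_stp n (p : {mpoly K[n.+2]}) N : mdeg_le p N -> pol (N * 2) (stp p).
Proof.
move=> dp; apply: pol_mmap => // j.
have [jn|nj] := ltnP j n.
  by rewrite /stp_var jn; apply: (@pol_mul _ 1 1); apply: pol_lX; lia.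
have W (F : lseries K (n.+1 + n.+1)) : pol 1 F -> pol 2 F.
  by move=> [r dr ->]; exists r => //; apply: mdeg_leW dr.
rewrite /stp_var ltnNge nj /=; apply: W.
by case: eqP => _; apply: pol_lX; lia.
Qed.

Lemma pol_sig n (p : {mpoly K[n]}) N : mdeg_le p N -> pol (N * 2) (sig p).
Proof.
move=> dp; apply: pol_mmap => // j; have jn := ltn_ord j.
by apply: (@pol_mul _ 1 1); apply: pol_lX; lia.
Qed.

Lemma rat_le_lins n N (S : lseries K (n + n)) : rat_le N S ->
  rat_le N (laurentC (lins K n n S) : lseries K (n.+1 + n.+1)).
Proof.
move=> [a [b [da db b0 ->]]].
pose v (j : 'I_(n + n)) := lX K (n.+1 + n.+1) (if (j < n)%N then j : nat else j.+1).
have vE (p : {mpoly K[n + n]}) : (laurentC (lins K n n (mpoly_lseries p))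
    : lseries K (n.+1 + n.+1)) = mmap (lseriesC K (n.+1 + n.+1)) v p.
  elim/mpoly_ring_ind: p => [c|j|p r Pp Pr|p r Pp Pr].
  - by rewrite mpoly_lseriesC mmapC linsC.
  - rewrite mpoly_lseriesX mmapX mmap1U linsX // /v.
    symmetry; apply: (@lX_lt K (n + n.+1)).
    by case: (j < n)%N; have := ltn_ord j; lia.
  - by rewrite mpoly_lseriesD mmapD -Pp -Pr (rmorphD (lins K n n)) [LHS]rmorphD.
  - rewrite mpoly_lseriesM [RHS]rmorphM /= -Pp -Pr (rmorphM (lins K n n)).
    by rewrite [LHS]rmorphM.
have vpol p : mdeg_le p N -> pol N (mmap (lseriesC K (n.+1 + n.+1)) v p).
  move=> dp; rewrite -[N]muln1; apply: pol_mmap => // j; apply: pol_lX.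
  by case: (j < n)%N; have := ltn_ord j; lia.
have [a' da' aE] := vpol _ da; have [b' db' bE] := vpol _ db.
exists a', b'; split=> //.
  rewrite -mpoly_lseries_eq0 -bE -vE; apply/eqP => /eqP.
  by rewrite fmorph_eq0 fmorph_eq0 mpoly_lseries_eq0 (negPf b0).
by rewrite -aE -bE -!vE fmorph_div fmorph_div.
Qed.

Definition step_bound g h := let h1 := clear_bound h in
  (frame_card h1 * (quotient_bound h1 * 2 + g + quotient_bound h1 * 2) + h * 2)%N.

Lemma rational_step n (G : nat -> nat) h (f : lseries K n.+1) :
    (forall h (g : lseries K n), alg h g ->
      exists2 S : lseries K (n + n), rat_le (G h) S & Delta S = g) ->
    alg h f ->
  exists2 F : lseries K (n.+1 + n.+1),
    rat_le (step_bound (G (basis_bound (clear_bound h))) h) F & Delta F = f.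
Proof.
move=> IH fh; have [f10 f1h] := alg_clear fh.
have [I [e [num [q [T' [R [cI q0 [dden dnum] ealg [RE Rdiag]]]]]]]] :=
  presentation f1h f10.
set h1 := clear_bound h in cI dden dnum ealg *.
set den := (_ + _) in dden RE.
have [S SP] : exists S : I -> lseries K (n + n), forall i,
    rat_le (G (basis_bound h1)) (S i) /\ Delta (S i) = e i.
  suff /choice [S SP] : forall i, exists S : lseries K (n + n),
    rat_le (G (basis_bound h1)) S /\ Delta S = e i by exists S.
  by move=> i; have [S] := IH _ _ (ealg i); exists S.
have den0 : mpoly_lseries den != 0.
  rewrite mpoly_lseries_eq0; apply: contraNneq (stp_den_neq0 T' q0) => d0.
  by rewrite -/den d0 rmorph0.
pose term i := (stp (num i) * laurentC (lins K n n (S i))) / stp den.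
have termE i : half2 (term i)
    (mpoly_lseries (num i) * laurentC (laurentC (e i)) / mpoly_lseries den).
  apply: half2_div => //; apply: half2_stp; rewrite -(SP i).2; exact: half2_lins.
pose F1 : laurent (lseries K (n + n.+1)) := \sum_i term i.
have F1R : half2 F1 R.
  have -> : R = \sum_i
      mpoly_lseries (num i) * laurentC (laurentC (e i)) / mpoly_lseries den.
    exact: sum_div den0 RE.
  rewrite /F1; elim: (index_enum I) => [|i r IHr].
    by rewrite !big_nil; apply: half2_0.
  by rewrite !big_cons; apply: half2_D.
pose Xh : {mpoly K[n.+1]} := 'X_ord_max ^+ h.
have Xh0 : Xh != 0.
  by rewrite expf_neq0 // -mpoly_lseries_eq0 mpoly_lseriesX; apply: lX_neq0.
exists ((F1 : lseries K (n.+1 + n.+1)) / sig Xh); last first.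
  rewrite Delta_sigV // (half2_Delta F1R Rdiag) rmorphXn /= mpoly_lseriesX.
  rewrite mulrC mulKf // expf_neq0 //; exact: (lX_neq0 K (ltnSn n)).
apply: rat_leM; last first.
  apply: rat_leV; apply: rat_le_pol; apply: pol_sig.
  by rewrite -[h]muln1; apply: mdeg_leX; apply: mdeg_leXU.
set N := (_ * 2 + _ + _)%N.
apply: (@rat_leW _ (size (index_enum I) * N)).
  rewrite leq_mul2r; apply/orP; right; apply: leq_trans cI.
  by rewrite -[index_enum _]/(Finite.enum _) -enumT cardT.
apply: rat_le_sum => i; apply: rat_leM.
  apply: rat_leM; first exact/rat_le_pol/pol_stp.
  exact: rat_le_lins (SP i).1.
exact/rat_leV/rat_le_pol/pol_stp.
Qed.

Fixpoint diag_bound n h :=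
  if n is n'.+1 then
    step_bound (diag_bound n' (basis_bound (clear_bound h))) h else 0%N.

Lemma rational_diagonal n h (f : lseries K n) : alg h f ->
  exists2 F : lseries K (n + n), rat_le (diag_bound n h) F & Delta F = f.
Proof.
elim: n h f => [|n IH] h f fh; last exact: rational_step.
exists f => //; apply: rat_le_pol; exists (f%:MP); first exact: mdeg_leC.
by rewrite mpoly_lseriesC.
Qed.

Lemma height_of_rational k N (a b : {mpoly K[k]}) :
    mdeg_le a N -> mdeg_le b N -> b != 0 ->
  height_at_most (mpoly_lseries a / mpoly_lseries b) N.
Proof.
move=> da db b0; set f := _ / _.
pose ht m := `[< exists2 P : {poly {mpoly K[k]}}, annihilates P f & max_coef_degree P = m >].
pose P : {poly {mpoly K[k]}} := b *: 'X - a%:P.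
have sP : size P = 2.
  rewrite size_polyDl ?size_scale ?size_polyX //.
  by rewrite size_polyN; apply: leq_ltn_trans (size_polyC_leq1 _) _.
have Pann : annihilates P f.
  split; first by rewrite -size_poly_eq0 sP.
  apply/rootP; rewrite rmorphB /= map_polyZ map_polyX map_polyC !hornerE /=.
  by rewrite mulrAC mulfV ?mul1r ?subrr // mpoly_lseries_eq0.
have htP : ht (max_coef_degree P) by apply/asboolP; exists P.
case: (ex_minnP (ex_intro ht _ htP)) => m /asboolP[Q Qf Qm] minm.
exists m; first split; first by exists Q.
  by move=> Q' Q'f; apply: minm; apply/asboolP; exists Q'.
apply: leq_trans (minm _ htP) _; apply/bigmax_leqP => i _.
rewrite -ltnS; apply: leq_trans (_ : N.+1 <= _)%N => //.
have : mdeg_le P`_i N.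
  rewrite coefB coefZ coefX coefC; apply: mdeg_leD.
    by rewrite mulr_natr; apply: mdeg_le_mulrn.
  by apply: mdeg_leN; case: eqP => // _; apply: mdeg_le0.
by rewrite /mdeg_le; case: (msize _) => //= l; rewrite ltnS.
Qed.

End Rational.

(** * Primitive recursive bounds *)

Section PrimitiveRecursion.
Implicit Types (k n : nat).

Lemma eq_primrec k (f g : k.-tuple nat -> nat) : f =1 g -> primrec f -> primrec g.
Proof. by move=> /funext ->. Qed.

Lemma primrec_iteri k (g : k.+2.-tuple nat -> nat) (f a : k.-tuple nat -> nat) :
    primrec g -> primrec f -> primrec a ->
  primrec (fun v => iteri (f v) (fun m r => g [tuple of m :: r :: v]) (a v)).
Proof.
move=> pg pf pa; pose pr i (v : k.-tuple nat) :=
  if unlift (@ord0 k) i is Some j then tnth v j else f v.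
have ppr i : primrec (pr i).
  by rewrite /pr; case: unlift => [j|//]; apply: PrimrecProj.
pose R (w : k.+1.-tuple nat) := iteri (thead w)
  (fun m r => g [tuple of m :: r :: behead w]) (a [tuple of behead w]).
have pR : primrec R by apply: PrimrecRec.
apply: (eq_primrec _ (PrimrecComp pR ppr)) => v.
have -> : [tuple pr i v | i < k.+1] = [tuple of f v :: v].
  apply: eq_from_tnth => i; rewrite tnth_mktuple /pr.
  by case: unliftP => [j|] ->; rewrite ?tnthS ?tnth0.
have bE : [tuple of behead [tuple of f v :: v]] = v by apply: val_inj.
rewrite /R theadE bE; congr (iteri _ _ _).
by apply: funext => m; apply: funext => r; congr g; apply: val_inj.
Qed.

Lemma primrec_succ k (f : k.-tuple nat -> nat) : primrec f -> primrec (fun v => (f v).+1).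
Proof.
move=> pf; apply: (eq_primrec _ (PrimrecComp PrimrecSucc (fun _ : 'I_1 => pf))) => v.
by rewrite /thead tnth_mktuple.
Qed.

Lemma primrec_const k c : primrec (fun _ : k.-tuple nat => c).
Proof.
elim: c => [|c IH]; first exact: PrimrecZero.
exact: primrec_succ IH.
Qed.

Lemma primrec_comp k l (g : l.-tuple nat -> nat) (f : k.-tuple nat -> l.-tuple nat) :
    primrec g -> (forall i, primrec (fun v => tnth (f v) i)) ->
  primrec (fun v => g (f v)).
Proof.
move=> pg pf; apply: eq_primrec (PrimrecComp pg pf) => v.
by congr g; apply: eq_from_tnth => i; rewrite tnth_mktuple.
Qed.

Lemma primrec_iteri_param k (g : nat -> nat -> k.-tuple nat -> nat)
    (f a : k.-tuple nat -> nat) :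
    (forall l (F G : l.-tuple nat -> nat) (V : l.-tuple nat -> k.-tuple nat),
      primrec F -> primrec G -> (forall i, primrec (fun v => tnth (V v) i)) ->
      primrec (fun v => g (F v) (G v) (V v))) ->
    primrec f -> primrec a ->
  primrec (fun v => iteri (f v) (fun m r => g m r v) (a v)).
Proof.
move=> pg pf pa.
pose V (w : k.+2.-tuple nat) := [tuple tnth w (rshift 2 i) | i < k].
have pV i : primrec (fun w => tnth (V w) i).
  by apply: eq_primrec (PrimrecProj (rshift 2 i)) => w; rewrite tnth_mktuple.
have := primrec_iteri (pg _ _ _ V (PrimrecProj (@ord0 k.+1))
  (PrimrecProj (lift ord0 (@ord0 k))) pV) pf pa.
apply: eq_primrec => v; congr (iteri _ _ _); apply: funext => m; apply: funext => r.
congr g => //; apply: eq_from_tnth => i; rewrite tnth_mktuple.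
have -> : rshift 2 i = lift ord0 (lift ord0 i) by apply: val_inj.
by rewrite !tnthS.
Qed.

Lemma primrec_iter k (g : nat -> k.-tuple nat -> nat) (f a : k.-tuple nat -> nat) :
    (forall l (G : l.-tuple nat -> nat) (V : l.-tuple nat -> k.-tuple nat),
      primrec G -> (forall i, primrec (fun v => tnth (V v) i)) ->
      primrec (fun v => g (G v) (V v))) ->
    primrec f -> primrec a ->
  primrec (fun v => iter (f v) (fun r => g r v) (a v)).
Proof.
move=> pg pf pa.
apply: (eq_primrec _ (primrec_iteri_param (g := fun _ => g) _ pf pa)) => [v|].
  by elim: (f v) => //= n ->.
by move=> l F G V _; apply: pg.
Qed.

Lemma primrec_add k (f g : k.-tuple nat -> nat) :
  primrec f -> primrec g -> primrec (fun v => f v + g v).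
Proof.
move=> pf pg.
apply: (eq_primrec _ (primrec_iter (g := fun r _ => r.+1) _ pf pg)) => [v|].
  by elim: (f v) => //= n ->.
by move=> l G V pG _; apply: primrec_succ.
Qed.

Lemma primrec_mul k (f g : k.-tuple nat -> nat) :
  primrec f -> primrec g -> primrec (fun v => f v * g v).
Proof.
move=> pf pg; apply: (eq_primrec _ (primrec_iter (g := fun r v => g v + r) _ pf
  (primrec_const k 0))) => [v|].
  by elim: (f v) => //= n ->; rewrite mulSn.
by move=> l G V pG pV; apply: primrec_add => //; apply: primrec_comp.
Qed.

Lemma primrec_exp k (f g : k.-tuple nat -> nat) :
  primrec f -> primrec g -> primrec (fun v => f v ^ g v).
Proof.
move=> pf pg; apply: (eq_primrec _ (primrec_iter (g := fun r v => f v * r) _ pg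
  (primrec_const k 1))) => [v|].
  by elim: (g v) => //= n ->; rewrite expnS.
by move=> l G V pG pV; apply: primrec_mul => //; apply: primrec_comp.
Qed.

Lemma primrec_iter1 (g : nat -> nat) k (f a : k.-tuple nat -> nat) :
    (forall l (G : l.-tuple nat -> nat), primrec G -> primrec (fun v => g (G v))) ->
    primrec f -> primrec a ->
  primrec (fun v => iter (f v) g (a v)).
Proof.
move=> pg pf pa; apply: (@primrec_iter k (fun r _ => g r)) => // l G V pG _.
exact: pg.
Qed.

End PrimitiveRecursion.

Section Bounds.
Variables (k : nat).
Implicit Types (f g h : k.-tuple nat -> nat).

Lemma primrec_alg_bound r f g : primrec f -> primrec g ->
  primrec (fun v => alg_bound r (f v) (g v)).
Proof.
move=> pf pg; have pr := primrec_const k r; have p2 := primrec_const k 2.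
have pe := primrec_exp pf pr.
apply: primrec_add => //; apply: primrec_mul => //; apply: primrec_mul => //.
by apply: primrec_mul => //; apply/primrec_succ/primrec_mul.
Qed.

Lemma primrec_clear_bound f : primrec f -> primrec (fun v => clear_bound (f v)).
Proof. by move=> pf; apply/primrec_alg_bound/primrec_succ. Qed.

Lemma primrec_order_bound f : primrec f -> primrec (fun v => order_bound (f v)).
Proof. by move=> pf; apply/primrec_alg_bound/primrec_add. Qed.

Lemma primrec_hensel_degree f g : primrec f -> primrec g ->
  primrec (fun v => hensel_degree (f v) (g v)).
Proof.
move=> pf pg; apply: primrec_add => //; apply: primrec_mul => //.
by apply: primrec_add => //; apply: primrec_const.
Qed.

Lemma primrec_fraction_bound f g h : primrec f -> primrec g -> primrec h ->
  primrec (fun v => fraction_bound (f v) (g v) (h v)).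
Proof.
move=> pf pg ph; have pgh : primrec (fun v => g v * (h v).+1).
  by apply/primrec_mul/primrec_succ.
by apply: primrec_add => //; apply/primrec_mul/primrec_succ.
Qed.

End Bounds.

Section QuotientBounds.
Variables (k : nat).
Implicit Types (f g h : k.-tuple nat -> nat).

Lemma primrec_coef_bound f : primrec f -> primrec (fun v => coef_bound (f v)).
Proof.
move=> pf; have po := primrec_order_bound pf.
apply: primrec_iter1 => //; last by apply: primrec_add => //; apply: primrec_const.
by move=> l G pG; apply: primrec_alg_bound => //; apply: primrec_const.
Qed.

Lemma primrec_order4 f : primrec f -> primrec (fun v => order_bound (f v) + 4).
Proof.
move=> pf; apply: primrec_add; first exact: primrec_order_bound.
exact: primrec_const.
Qed.

Lemma primrec_frame_height f : primrec f -> primrec (fun v => frame_height (f v)).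
Proof.
move=> pf; apply: primrec_mul; first exact: primrec_order4.
exact: primrec_coef_bound.
Qed.

Lemma primrec_frame_card f : primrec f -> primrec (fun v => frame_card (f v)).
Proof.
move=> pf; apply: primrec_exp; first exact: primrec_coef_bound.
exact: primrec_order4.
Qed.

Lemma primrec_basis_bound f : primrec f -> primrec (fun v => basis_bound (f v)).
Proof.
move=> pf; have pc := primrec_frame_card pf; have ph := primrec_frame_height pf.
apply: primrec_add => //; apply: primrec_mul; first exact: primrec_const.
by apply: primrec_mul => //; apply/primrec_mul/primrec_succ.
Qed.

Lemma primrec_filt_bound f : primrec f -> primrec (fun v => filt_bound (f v)).
Proof.
move=> pf; have po := primrec_order_bound pf; have pd := primrec_hensel_degree pf po.
have p2 := primrec_const k 2; rewrite /filt_bound.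
apply: primrec_add (primrec_const k 8); apply: primrec_add; last exact: primrec_mul.
apply: primrec_add => //; apply: primrec_add; first exact: primrec_succ.
apply: primrec_mul => //; apply: primrec_add => //; apply: primrec_mul => //.
exact: primrec_succ.
Qed.

Lemma primrec_quotient_bound f : primrec f -> primrec (fun v => quotient_bound (f v)).
Proof.
move=> pf; apply: primrec_fraction_bound.
- exact: primrec_frame_card.
- exact: primrec_filt_bound.
- exact: primrec_frame_height.
Qed.

Lemma primrec_step_bound f g : primrec f -> primrec g ->
  primrec (fun v => step_bound (f v) (g v)).
Proof.
move=> pf pg; have pc := primrec_clear_bound pg; have p2 := primrec_const k 2.
have pq := primrec_mul (primrec_quotient_bound pc) p2.
apply: primrec_add; last exact: primrec_mul.
apply: primrec_mul; first exact: primrec_frame_card.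
by apply: primrec_add => //; apply: primrec_add.
Qed.

End QuotientBounds.

(* The sum makes this monotone in x without any monotonicity of the bounds. *)
Definition growth x :=
  iteri x.+1 (fun i r => basis_bound (clear_bound i) + step_bound x i + r) x.

Lemma primrec_growth k (f : k.-tuple nat -> nat) : primrec f -> primrec (fun v => growth (f v)).
Proof.
move=> pf; apply: (@primrec_iteri_param k (fun i r v =>
  basis_bound (clear_bound i) + step_bound (f v) i + r)) => //; last first.
  exact: primrec_succ.
move=> l F G V pF pG pV; apply: primrec_add => //; apply: primrec_add.
  exact/primrec_basis_bound/primrec_clear_bound.
by apply: primrec_step_bound => //; apply: primrec_comp.
Qed.

Lemma iteri_sum (F : nat -> nat) n x :
  iteri n (fun i r => F i + r) x = x + \sum_(i < n) F i.
Proof.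
elim: n => [|n IH]; first by rewrite big_ord0 addn0.
by rewrite big_ord_recr /= IH addnC -addnA.
Qed.

Lemma growthE x :
  growth x = x + \sum_(i < x.+1) (basis_bound (clear_bound i) + step_bound x i).
Proof.
exact: iteri_sum.
Qed.

Lemma growth_ge x : x <= growth x.
Proof. by rewrite growthE leq_addr. Qed.

Lemma step_bound_mono g g' h : g <= g' -> step_bound g h <= step_bound g' h.
Proof.
by move=> gg; rewrite /step_bound leq_add2r leq_mul2l leq_add2r leq_add2l gg orbT.
Qed.

Lemma growth_basis i x : i <= x -> basis_bound (clear_bound i) <= growth x.
Proof.
move=> ix; rewrite growthE (bigD1 (Ordinal (ix : i < x.+1))) //=.
apply: leq_trans (leq_addl _ _); apply: leq_trans (leq_addr _ _); exact: leq_addr.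
Qed.

Lemma growth_step g i x : g <= x -> i <= x -> step_bound g i <= growth x.
Proof.
move=> gx ix; apply: leq_trans (step_bound_mono i gx) _.
rewrite growthE (bigD1 (Ordinal (ix : i < x.+1))) //=.
apply: leq_trans (leq_addl _ _); apply: leq_trans (leq_addr _ _); exact: leq_addl.
Qed.

Lemma growth_mono x y : x <= y -> growth x <= growth y.
Proof.
move=> xy; rewrite !growthE leq_add // -(subnKC xy) -addSn big_split_ord /=.
apply: leq_trans (leq_addr _ _); apply: leq_sum => i _.
by rewrite leq_add2l; apply: step_bound_mono; rewrite subnKC.
Qed.

Lemma iter_growth_ge n x : x <= iter n growth x.
Proof. by elim: n => //= n IH; apply: leq_trans IH (growth_ge _). Qed.

Lemma iter_growth_mono n x y : x <= y -> iter n growth x <= iter n growth y.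
Proof. by move=> xy; elim: n => //= n; apply: growth_mono. Qed.

Lemma diag_bound_le n h : diag_bound n h <= iter (2 * n) growth h.
Proof.
elim: n h => // n IH h; have -> : 2 * n.+1 = (2 * n).+2 by rewrite mulnS.
apply: growth_step; last exact: (iter_growth_ge (2 * n).+1).
apply: leq_trans (IH _) _; rewrite -/iter -iterS iterSr.
exact/iter_growth_mono/growth_basis.
Qed.

Theorem theorem6p1 :
  exists2 N : 3.-tuple nat -> nat, primrec N &
    forall (K : fieldType) (n d h : nat) (f : lseries K n),
      algebraic_of_degree f d -> height_at_most f h ->
      exists2 R : {fraction {mpoly K[n + n]}},
        height_at_most (frac_lseries R) (N [tuple n; d; h]) &
        half_diagonal (frac_lseries R) f.
Proof.
exists (fun v => iter (2 * tnth v ord0) growth (tnth v (inord 1) + tnth v (inord 2))).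
  apply: primrec_iter1 => [l G||]; first exact: primrec_growth.
    apply: primrec_mul; [exact: primrec_const|exact: PrimrecProj].
  by apply: primrec_add; apply: PrimrecProj.
move=> K n d h f fd fh; have fa := alg_of_height fd fh.
have [F [a [b [da db b0 ->]]] Ff] := rational_diagonal fa.
exists (tofrac a / tofrac b)%R; rewrite fmorph_div /= !frac_lseries_tofrac; last first.
  by rewrite -Ff; apply: half_diagonal_Delta.
have -> : tnth [tuple n; d; h] ord0 = n by [].
rewrite !(tnth_nth 0) !inordK //=.
by apply: height_of_rational => //; apply: mdeg_leW (diag_bound_le _ _) _.
Qed.
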